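(* Let $d\ge1$, let $\omega=(\omega_1,\ldots,\omega_d)$ with arbitrary $\omega_1,\ldots,\omega_d>0$, and let $\sigma=\sigma_0+B^{\mathrm{cl}}$ with $\sigma_0(x,\xi)=\sum_{j=1}^d\frac12(\xi_j^2+\omega_j^2x_j^2)$ and $B^{\mathrm{cl}}\in\mathscr{S}^{\mathbb{R}}[[\varepsilon]]$ of order $\ge1$ in $\varepsilon$. Let $X=X_0+B^{\mathrm{qu}}$ be the Weyl quantization of $\sigma$ (taken coefficientwise in $\varepsilon$), where $X_0=-\frac12\hbar^2\Delta+\sum_{j=1}^d\frac12\omega_j^2x_j^2$ on $L^2(\mathbb{R}^d)$ is the Weyl quantization of $\sigma_0$. Let $(F^\bullet,G^\bullet)$ be a pair of alternal moulds on the alphabet $\mathbb{C}$ with values in $\mathbb{C}$ satisfying $$\nabla F^\bullet=0,\qquad\nabla(e^{G^\bullet})=I^\bullet\times e^{G^\bullet}-e^{G^\bullet}\times F^\bullet .$$ With $\mathcal{N}=\mathbb{Z}^d$ and $\lambda(n)=\mathrm{i}\langle n,\omega\rangle$, let $\sigma_0+Z^{\mathrm{cl}}$ and $X_0+Z^{\mathrm{qu}}$ be the classical Birkhoff normal form of $\sigma$ and the quantum Birkhoff normal form of $X$ defined by $$Z^{\mathrm{cl}}=\sum_{r\ge1}\sum_{n_1,\ldots,n_r\in\mathcal{N}}\frac1rF^{\lambda(n_1)\cdots\lambda(n_r)}\{B^{\mathrm{cl}}_{n_r},\{\ldots\{B^{\mathrm{cl}}_{n_2},B^{\mathrm{cl}}_{n_1}\}\ldots\}\},$$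 $$Z^{\mathrm{qu}}=\sum_{r\ge1}\sum_{n_1,\ldots,n_r\in\mathcal{N}}\frac1rF^{\lambda(n_1)\cdots\lambda(n_r)}[B^{\mathrm{qu}}_{n_r},[\ldots[B^{\mathrm{qu}}_{n_2},B^{\mathrm{qu}}_{n_1}]_{\mathrm{qu}}\ldots]_{\mathrm{qu}}]_{\mathrm{qu}},$$ where $B^{\mathrm{cl}}=\sum_{n\in\mathbb{Z}^d}B_n^{\mathrm{cl}}$ is the homogeneous decomposition of $B^{\mathrm{cl}}$ and $B_n^{\mathrm{qu}}$ is the Weyl quantization of $B_n^{\mathrm{cl}}$. Then $$\sigma_{Z^{\mathrm{qu}}}\xrightarrow[\hbar\to0]{}Z^{\mathrm{cl}}\quad\text{termwise in }\varepsilon,$$ i.e. for each $p$, the symbol of the coefficient of $\varepsilon^p$ in $Z^{\mathrm{qu}}$ converges (pointwise in $(x,\xi)$), as $\hbar\to0$, to the coefficient of $\varepsilon^p$ in $Z^{\mathrm{cl}}$.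
   Context: Class of symbols. For $\mathbf{k}=\mathbb{R}$ or $\mathbb{C}$, $\mathscr{S}_0^{\mathbf{k}}$ is the set of $\mathbf{k}$-valued Schwartz functions $f$ on $\mathbb{R}^d\times\mathbb{R}^d$ such that there is $\tilde f\in C^\infty((\mathbb{R}_{\ge0})^d,\mathbf{k})$ with $f(x,\xi)\equiv\tilde f\big(\frac{\xi_1^2+\omega_1^2x_1^2}2,\ldots,\frac{\xi_d^2+\omega_d^2x_d^2}2\big)$; $\mathscr{S}^{\mathbf{k}}$ is the set of all finite sums $\sum b_{k,\ell}(x,\xi)x^k\xi^\ell$ with $k,\ell\in\mathbb{N}^d$, $b_{k,\ell}\in\mathscr{S}_0^{\mathbf{k}}$. $\varepsilon$ is an indeterminate, $\mathscr{S}^{\mathbf{k}}[[\varepsilon]]$ is the space of formal series in $\varepsilon$ with coefficients in $\mathscr{S}^{\mathbf{k}}$. Homogeneous decomposition. Put $z_j=\omega_jx_j+\mathrm{i}\xi_j$ and $w_j=\mathrm{i}\omega_jx_j+\xi_j$. Every element $B$ of $\mathscr{S}^{\mathbb{C}}[[\varepsilon]]$ can be written uniquely as $B=\sum_{n\in\mathbb{Z}^d}B_n$ where, for each power of $\varepsilon$, the coefficient of $B_n$ is a finite sum of terms $b\,z^kw^\ell$ with $b\in\mathscr{S}_0^{\mathbb{C}}$, $k,\ell\in\mathbb{N}^d$, $k-\ell=n$ (and, for each power of $\varepsilon$, only finitely many $n$ contribute). One has $\{\sigma_0,B_n\}=\mathrm{i}\langle n,\omega\rangle B_n$, where $\{f,g\}=\sum_{j=1}^d\big(\frac{\partial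 f}{\partial x_j}\frac{\partial g}{\partial\xi_j}-\frac{\partial f}{\partial\xi_j}\frac{\partial g}{\partial x_j}\big)$. Weyl quantization. For $\hbar>0$ the Weyl quantization of a function $\sigma(x,\xi)$ is the operator $V$ given by $V\varphi(x)=\int_{\mathbb{R}^d\times\mathbb{R}^d}\sigma\big(\frac{x+y}2,\xi\big)e^{\mathrm{i}\,\xi\cdot(x-y)/\hbar}\varphi(y)\frac{d\xi\,dy}{(2\pi\hbar)^d}$; $\sigma=\sigma_V$ is called the symbol of $V$ (the correspondence $\sigma\leftrightarrow V$ is invertible). Quantization and symbols are extended coefficientwise to formal series in $\varepsilon$. The quantum bracket is $[A,B]_{\mathrm{qu}}=\frac1{\mathrm{i}\hbar}(AB-BA)$. For $r=1$, the iterated brackets mean $B_{n_1}^{\mathrm{cl}}$, $B_{n_1}^{\mathrm{qu}}$. Moulds on the alphabet $\mathbb{C}$. A mould is a map $M^\bullet$ from the set of words $\lambda_1\cdots\lambda_r$ ($r\ge0$, $\lambda_i\in\mathbb{C}$) to $\mathbb{C}$, $\varnothing$ denoting the empty word. Product: $(M^\bullet\times N^\bullet)^{\underline n}=\sum_{\underline n=\underline a\,\underline b}M^{\underline a}N^{\underline b}$ over all decompositions by concatenation (including empty factors); $e^{M^\bullet}=\sum_{k\ge0}\frac1{k!}(M^\bullet)^{\times k}$ when $M^\varnothing=0$; $(\nabla M)^{\lambda_1\cdots\lambda_r}=(\lambda_1+\cdots+\lambda_r)M^{\lambda_1\cdots\lambda_r}$; $I^{\underline n}=1$ if $\underline n$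 has length $1$ and $0$ otherwise. $M^\bullet$ is alternal if $M^\varnothing=0$ and, for any two nonempty words $\underline a,\underline b$, $\sum_{\underline n}\operatorname{sh}(\underline a,\underline b;\underline n)M^{\underline n}=0$, where, with $r$ and $\ell$ the lengths of $\underline n$ and $\underline a$, $\operatorname{sh}(\underline a,\underline b;\underline n)$ is the number of permutations $\tau$ of $\{1,\ldots,r\}$, increasing on $\{1,\ldots,\ell\}$ and on $\{\ell+1,\ldots,r\}$, such that $n_{\tau(1)}\cdots n_{\tau(\ell)}=\underline a$ and $n_{\tau(\ell+1)}\cdots n_{\tau(r)}=\underline b$. The same mould $F^\bullet$ (independent of $\hbar$) is used in both formulas. *)

(* Defs.v *)
From HB Require Import structures.
From mathcomp Require Import all_boot all_order fingroup perm all_algebra.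
From mathcomp Require Import complex.
From mathcomp Require Import all_classical all_reals all_analysis.

Set Implicit Arguments.
Unset Strict Implicit.
Unset Printing Implicit Defensive.

Import Order.TTheory GRing.Theory Num.Theory.
Import numFieldNormedType.Exports.

Local Open Scope classical_set_scope.
Local Open Scope ring_scope.
Local Open Scope complex_scope.

(** * Smooth and Schwartz complex-valued functions on a real normed space

  The codomain [R[i]] is not a normed module over [R] in the library, so
  derivatives and integrals are taken on real and imaginary parts. *)

Section Smooth.
Context {R : realType} {V : normedModType R}.
Implicit Types (f : V -> R[i]) (v x : V).

Definition re_part f : V -> R := fun x => complex.Re (f x).
Definition im_part f : V -> R := fun x => complex.Im (f x).

Definition cderive v f : V -> R[i] :=
  fun x => Complex ('D_v (re_part f) x) ('D_v (im_part f) x).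

Definition iter_cderive (vs : seq V) f : V -> R[i] := foldr cderive f vs.

(* Quantifying over all directions rather than over a basis gives a
   coordinate-free condition; in finite dimension this is the usual C^oo. *)
Definition smooth f := forall vs : seq V,
  [/\ continuous (re_part (iter_cderive vs f)),
      continuous (im_part (iter_cderive vs f)) &
      forall v x, derivable (re_part (iter_cderive vs f)) x v /\
                  derivable (im_part (iter_cderive vs f)) x v].

(* Smoothness on a closed subset: restriction of a smooth function. *)
Definition smooth_on (A : set V) f :=
  exists2 g : V -> R[i], smooth g & forall x, A x -> f x = g x.

Definition schwartz f := smooth f /\
  forall (vs : seq V) (m : nat), exists M : R, forall x,
    (`|x| ^+ m)%:C * `|iter_cderive vs f x| <= M%:C.

End Smooth.

(** * Integration over R^n *)

Section Integral.
Context {R : realType}.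

Definition cintegral (f : R -> R[i]) : R[i] :=
  Complex (Rintegral (@lebesgue_measure R) setT (fun t => complex.Re (f t)))
          (Rintegral (@lebesgue_measure R) setT (fun t => complex.Im (f t))).

(* The library has no Lebesgue measure on R^n: integrals over R^n are iterated
   one-dimensional Lebesgue integrals, which is the same thing for Schwartz
   integrands by Fubini. *)
Fixpoint integral_rV (n : nat) : ('rV[R]_n -> R[i]) -> R[i] :=
  match n with
  | 0 => fun f => f 0
  | n'.+1 => fun f =>
      cintegral (fun t => integral_rV
        (fun y : 'rV[R]_n' => f (row_mx (t%:M : 'rV[R]_1) y : 'rV[R]_(1 + n'))))
  end.

End Integral.

(** * Moulds on the alphabet C *)

Section Mould.
Context {C : numClosedFieldType}.

Definition mould := seq C -> C.
Implicit Types (M N : mould) (a b n : seq C).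

Definition mould1 : mould := fun n => if n is [::] then 1 else 0.

Definition mould_I : mould := fun n => (size n == 1%N)%:R.

Definition mould_mul M N : mould :=
  fun n => \sum_(i < (size n).+1) M (take i n) * N (drop i n).

Definition mould_pow M (k : nat) : mould := iter k (mould_mul M) mould1.

(* When [M [::] = 0] the k-th power vanishes on words of length < k, so the
   sum over all k has finite support. *)
Definition mould_exp M : mould :=
  fun n => \sum_(k \in [set: nat]) (k`!%:R)^-1 * mould_pow M k n.

Definition mould_nabla M : mould := fun n => (\sum_(c <- n) c) * M n.

Definition sh a b n : nat :=
  #|[pred t : 'S_(size n) |
     [&& [forall i : 'I_(size n), forall j : 'I_(size n), (i < j < size a)%N ==> (t i < t j)%N],
         [forall i : 'I_(size n), forall j : 'I_(size n), (size a <= i < j)%N ==> (t i < t j)%N],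
         [seq nth 0 n (t i) | i : 'I_(size n) <- enum 'I_(size n) & (i < size a)%N] == a &
         [seq nth 0 n (t i) | i : 'I_(size n) <- enum 'I_(size n) & (size a <= i)%N] == b]]|.

Definition alternal M := M [::] = 0 /\
  forall a b, a <> [::] -> b <> [::] ->
    \sum_(n \in [set: seq C]) (sh a b n)%:R * M n = 0.

End Mould.
Arguments mould : clear implicits.

Section Birkhoff.
Context {R : realType} {d : nat}.
Local Notation C := R[i].
Local Notation phase := ('rV[R]_d * 'rV[R]_d)%type.
Local Notation symbol := (phase -> C).
Local Notation operator := (('rV[R]_d -> C) -> ('rV[R]_d -> C)).
Implicit Types (omega : 'rV[R]_d) (f g s : symbol) (u : phase) (hbar : R).

(** * Classes of symbols

  A point of phase space is [u = (x, xi)]. Real-valued functions are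
  complex-valued functions with values in [reals]. *)

Definition reals : set C := [set c | c \is Num.real].

Definition orthant : set 'rV[R]_d := [set a | forall j, 0 <= a 0 j].

Definition actions omega u : 'rV[R]_d :=
  \row_j ((u.2 0 j ^+ 2 + omega 0 j ^+ 2 * u.1 0 j ^+ 2) / 2).

Definition symbol_class0 omega (K : set C) f :=
  [/\ schwartz f, forall u, K (f u) &
      exists ft : 'rV[R]_d -> C,
        [/\ smooth_on orthant ft, forall a, orthant a -> K (ft a) &
            forall u, f u = ft (actions omega u)]].

Definition symbol_class omega (K : set C) f :=
  exists (m : nat) (b : 'I_m -> symbol) (k l : 'I_m -> 'I_d -> nat),
    (forall i, symbol_class0 omega K (b i)) /\
    forall u, f u = \sum_i b i u *
      (\prod_j (u.1 0 j ^+ k i j * u.2 0 j ^+ l i j))%:C.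

Definition zvar omega (j : 'I_d) u : C := Complex (omega 0 j * u.1 0 j) (u.2 0 j).
Definition wvar omega (j : 'I_d) u : C := Complex (u.2 0 j) (omega 0 j * u.1 0 j).

Definition homogeneous omega (n : 'rV[int]_d) f :=
  exists (m : nat) (b : 'I_m -> symbol) (k l : 'I_m -> 'I_d -> nat),
    [/\ forall i, symbol_class0 omega setT (b i),
        forall i j, (k i j)%:Z - (l i j)%:Z = n 0 j &
        forall u, f u = \sum_i b i u *
          \prod_j (zvar omega j u ^+ k i j * wvar omega j u ^+ l i j)].

(* Formal series in the indeterminate are given by their sequence of
   coefficients. *)
Definition homogeneous_decomposition omega (B : nat -> symbol)
    (Bn : 'rV[int]_d -> nat -> symbol) :=
  [/\ forall n p, homogeneous omega n (Bn n p),
      forall p, finite_set [set n | exists u, Bn n p u <> 0] &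
      forall p u, B p u = \sum_(n \in [set: 'rV[int]_d]) Bn n p u].

Definition sigma0 omega : symbol := fun u => (\sum_j actions omega u 0 j)%:C.

Definition poisson f g : symbol := fun u =>
  \sum_(j < d) (cderive (delta_mx 0 j, 0) f u * cderive (0, delta_mx 0 j) g u
              - cderive (0, delta_mx 0 j) f u * cderive (delta_mx 0 j, 0) g u).

Definition series_poisson (A B : nat -> symbol) : nat -> symbol :=
  fun p u => \sum_(i < p.+1) poisson (A i) (B (p - i)%N) u.

(** * Weyl quantization

  Operators are considered through their action on Schwartz functions. *)

Definition dotrV (x y : 'rV[R]_d) : R := \sum_j x 0 j * y 0 j.

Definition expi (t : R) : C := Complex (cos t) (sin t).

(* With the integral in y innermost, the formula makes sense for all Schwartz
   [phi] not only when [s] is Schwartz but also for [s = sigma0 omega]. *)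
Definition weyl hbar s : operator := fun phi x =>
  (((2 * pi * hbar) ^+ d)^-1)%:C *
  integral_rV (fun xi => integral_rV (fun y =>
    s (2^-1 *: (x + y), xi) * expi (dotrV xi (x - y) / hbar) * phi y)).

Definition is_weyl_symbol hbar (V : operator) s :=
  schwartz s /\ forall phi, schwartz phi -> forall x, weyl hbar s phi x = V phi x.

Definition X0 hbar omega : operator := fun phi x =>
  - (hbar ^+ 2 / 2)%:C *
      (\sum_(j < d) cderive (delta_mx 0 j) (cderive (delta_mx 0 j) phi) x)
  + (\sum_j omega 0 j ^+ 2 * x 0 j ^+ 2 / 2)%:C * phi x.

Definition qbracket hbar (A B : operator) : operator := fun phi x =>
  ('i * hbar%:C)^-1 * (A (B phi) x - B (A phi) x).

Definition series_qbracket hbar (A B : nat -> operator) : nat -> operator :=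
  fun p phi x => \sum_(i < p.+1) qbracket hbar (A i) (B (p - i)%N) phi x.

(** * Normal forms *)

Definition lambda omega (n : 'rV[int]_d) : C :=
  'i * (\sum_j (n 0 j)%:~R * omega 0 j)%:C.

(* [br (B n_r) (... (br (B n_2) (B n_1)))] for a nonempty word n_1 ... n_r *)
Definition nested_bracket (T : Type) (zero : T) (br : T -> T -> T)
    (B : 'rV[int]_d -> T) (w : seq 'rV[int]_d) : T :=
  if w is n1 :: w' then foldl (fun acc n => br (B n) acc) (B n1) w' else zero.

(* For each p only finitely many words contribute to the coefficient of order
   p, because the [Bn] have order >= 1 and, at each order, finitely many of them
   are nonzero. *)
Definition Zcl omega (F : mould C) (Bn : 'rV[int]_d -> nat -> symbol) :
    nat -> symbol := fun p u =>
  \sum_(r \in [set r | (1 <= r)%N])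
    \sum_(w \in [set w : seq 'rV[int]_d | size w = r])
      r%:R^-1 * F (map (lambda omega) w) *
      nested_bracket (fun _ _ => 0) series_poisson Bn w p u.

Definition Zqu hbar omega (F : mould C) (Bn : 'rV[int]_d -> nat -> symbol) :
    nat -> operator := fun p phi x =>
  \sum_(r \in [set r | (1 <= r)%N])
    \sum_(w \in [set w : seq 'rV[int]_d | size w = r])
      r%:R^-1 * F (map (lambda omega) w) *
      nested_bracket (fun _ _ _ => 0) (series_qbracket hbar)
        (fun n q => weyl hbar (Bn n q)) w p phi x.

End Birkhoff.

(* Main.v *)
Require Import Defs.
From HB Require Import structures.
From mathcomp Require Import all_boot all_order all_algebra.
From mathcomp Require Import complex.
From mathcomp Require Import all_classical all_reals all_analysis.
From mathcomp Require Import measurable_realfun ring lra.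

Set Implicit Arguments.
Unset Strict Implicit.
Unset Printing Implicit Defensive.

Import Order.TTheory GRing.Theory Num.Theory.
Import numFieldNormedType.Exports.

Local Open Scope classical_set_scope.
Local Open Scope ring_scope.
Local Open Scope complex_scope.

(** The normal forms are, at each order, the same linear combination of iterated
    brackets, Poisson brackets of symbols on one side and quantum brackets of
    operators on the other, so that everything rests on the classical limit of
    one bracket. For Schwartz symbols, the composition of two Weyl operators is
    the Weyl operator of a Moyal product: writing [f] as the superposition of
    the plane waves of frequency [eta] with density [fhat f eta], the product
    of [f] and [g] at [u] is the integral over [eta] of
    [fhat f eta * expi (dot_phase eta u) * g (u + (hbar / 2) *: symp eta)],
    and the product in the other order has [- (hbar / 2)] instead
    ([weyl_compose], [weyl_compose_rev]). Hence the symbol of a quantum bracket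
    is the same integral with [g] replaced by a symmetric difference quotient in
    the direction [symp eta]. As [hbar] tends to 0, the quotient tends to
    [- 'i] times the derivative of [g] along [symp eta], and dominated
    convergence gives the Poisson bracket.

    In an iterated bracket the inner symbol depends on [hbar] too. The limit is
    therefore proved for a sequence of symbols that converges with all its
    derivatives, pointwise and with uniform bounds; the Leibniz rule for both
    brackets shows that the sequence of brackets converges in the same sense
    ([moyal_bracket_converges]), and an induction on the word treats the nested
    brackets ([nested_symbol_converges]).

    Only finitely many words matter. The components of the perturbation have
    order at least 1, because symbols of distinct weights under the rotations
    of the phase planes are linearly independent
    ([homogeneous_decomposition_order]); so the words longer than [p] contribute
    nothing to the coefficient of order [p], and neither do those that contain
    a letter outside a finite set. A Schwartz symbol is determined by its
    operator ([weyl_inj]), which transfers the limit from the symbol given by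
    the Moyal brackets to an arbitrary one.

    The integrals over row vectors being iterated integrals on the line, the
    facts of analysis used here (Fubini, dominated convergence, translation,
    scaling, Fourier inversion) are proved on the line and then carried to
    products and along linear isomorphisms, for integrals of continuous
    functions dominated by a fixed weight ([integral_spec]). *)

Notation normc := Normc.normc.

(** * Complex-valued limits *)

Section ComplexModulus.
Context {R : realType}.
Implicit Types (z : R[i]) (t : R).

Lemma normc_ge0 z : 0 <= normc z.
Proof. by case: z => a b; exact: sqrtr_ge0. Qed.

Lemma normcE z : normc z = Num.sqrt (complex.Re z ^+ 2 + complex.Im z ^+ 2).
Proof. by case: z. Qed.

Lemma normr_Re_le z : `|complex.Re z| <= normc z.
Proof. by rewrite normcE -sqrtr_sqr ler_wsqrtr// lerDl sqr_ge0. Qed.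

Lemma normr_Im_le z : `|complex.Im z| <= normc z.
Proof. by rewrite normcE -sqrtr_sqr ler_wsqrtr// lerDr sqr_ge0. Qed.

Lemma normc_le_ReIm z : normc z <= `|complex.Re z| + `|complex.Im z|.
Proof.
rewrite normcE -[leRHS]ger0_norm ?addr_ge0// -sqrtr_sqr ler_wsqrtr//.
rewrite -(real_normK (num_real (complex.Re z))) -(real_normK (num_real (complex.Im z))).
by rewrite sqrrD -addrA lerD2l lerDr mulrn_wge0// mulr_ge0.
Qed.

Lemma normc_real t : normc t%:C = `|t|.
Proof. by rewrite normcE/= expr0n/= addr0 sqrtr_sqr. Qed.

Lemma normc_i : normc ('i : R[i]) = 1.
Proof. by rewrite normcE/= expr0n/= add0r expr1n sqrtr1. Qed.

Lemma normc_sum (I : Type) (s : seq I) (P : pred I) (F : I -> R[i]) :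
  normc (\sum_(i <- s | P i) F i) <= \sum_(i <- s | P i) normc (F i).
Proof.
elim/big_rec2: _ => [|i y1 y2 _ H]; first by rewrite Normc.normc0.
by rewrite (le_trans (le_normcD _ _))// lerD2l.
Qed.

Lemma expiD t1 t2 : expi (t1 + t2) = expi t1 * expi t2 :> R[i].
Proof.
rewrite /expi cosD sinD; apply/eqP; rewrite eq_complex/=; apply/andP; split; apply/eqP; ring.
Qed.

Lemma expi0 : expi 0 = 1 :> R[i].
Proof. by rewrite /expi cos0 sin0. Qed.

Lemma normc_expi t : normc (expi t) = 1.
Proof. by rewrite normcE/= cos2Dsin2 sqrtr1. Qed.

Lemma expi_neq0 t : expi t != 0.
Proof.
by apply/eqP => /(congr1 (@Normc.normc R)); rewrite normc_expi Normc.normc0 => /eqP; rewrite oner_eq0.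
Qed.

End ComplexModulus.

Section ComplexLimits.
Context {R : realType}.

(** The topology of the complex numbers is handled through real and imaginary
    parts, as in the definition of smoothness. *)
Definition clim {T : Type} (F : set_system T) (f : T -> R[i]) (l : R[i]) :=
  (complex.Re (f x) @[x --> F] --> complex.Re l) /\
  (complex.Im (f x) @[x --> F] --> complex.Im l).

Definition ccont {T : topologicalType} (f : T -> R[i]) :=
  forall x, clim (nbhs x) f (f x).

Section Lim.
Context {T : Type} (F : set_system T) {FF : Filter F}.
Implicit Types (f g : T -> R[i]) (l m : R[i]).

Lemma clim_cst l : clim F (fun=> l) l.
Proof. by split; exact: cvg_cst. Qed.

Lemma climD f g l m : clim F f l -> clim F g m -> clim F (fun x => f x + g x) (l + m).
Proof.
move=> [f1 f2] [g1 g2]; split.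
- under eq_fun do rewrite raddfD /=; rewrite raddfD; exact: cvgD.
- under eq_fun do rewrite raddfD /=; rewrite raddfD; exact: cvgD.
Qed.

Lemma complexReM z1 z2 : complex.Re (z1 * z2 : R[i]) =
  complex.Re z1 * complex.Re z2 - complex.Im z1 * complex.Im z2.
Proof. by case: z1 => a b; case: z2. Qed.

Lemma complexImM z1 z2 : complex.Im (z1 * z2 : R[i]) =
  complex.Re z1 * complex.Im z2 + complex.Im z1 * complex.Re z2.
Proof. by case: z1 => a b; case: z2. Qed.

Lemma climM f g l m : clim F f l -> clim F g m -> clim F (fun x => f x * g x) (l * m).
Proof.
move=> [f1 f2] [g1 g2]; split.
- under eq_fun do rewrite complexReM; rewrite complexReM.
  by apply: cvgB; apply: cvgM.
- under eq_fun do rewrite complexImM; rewrite complexImM.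
  by apply: cvgD; apply: cvgM.
Qed.

Lemma climZ c f l : clim F f l -> clim F (fun x => c * f x) (c * l).
Proof. exact/climM/clim_cst. Qed.

Lemma climN f l : clim F f l -> clim F (fun x => - f x) (- l).
Proof.
move=> /(@climZ (-1)); rewrite mulN1r.
by under eq_fun do rewrite mulN1r.
Qed.

Lemma climB f g l m : clim F f l -> clim F g m -> clim F (fun x => f x - g x) (l - m).
Proof. by move=> fl /climN; exact: climD. Qed.

Lemma clim_sum (I : Type) (s : seq I) (P : pred I) (f : I -> T -> R[i]) (l : I -> R[i]) :
  (forall i, clim F (f i) (l i)) ->
  clim F (fun x => \sum_(i <- s | P i) f i x) (\sum_(i <- s | P i) l i).
Proof.
move=> fl; elim: s => [|a s IH].
  rewrite big_nil; under eq_fun do rewrite big_nil; exact: clim_cst.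
rewrite big_cons; under eq_fun do rewrite big_cons.
by case: (P a) => //; exact: climD.
Qed.

Lemma clim_squeeze f l (g : T -> R) :
  (\forall x \near F, normc (f x - l) <= g x) -> g x @[x --> F] --> 0 -> clim F f l.
Proof.
move=> fg g0.
have h (h : R[i] -> R) : (forall z, `|h z| <= normc z) -> {morph h : x y / x - y} ->
    h (f x) @[x --> F] --> h l.
  move=> hn hB; apply/cvgrPdistC_le => e e0.
  have /cvgr_lt/(_ _ e0) g0e := g0.
  near=> x; rewrite -hB (le_trans (hn _))//.
  apply: (@le_trans _ _ (g x)); first by near: x.
  by apply/ltW; near: x.
by split; apply: h; [exact: normr_Re_le|exact: raddfB|exact: normr_Im_le|exact: raddfB].
Unshelve. all: by end_near. Qed.

Lemma clim_norm f l : clim F f l -> normc (f x - l) @[x --> F] --> 0.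
Proof.
move=> [f1 f2].
have h : `|complex.Re (f x) - complex.Re l| + `|complex.Im (f x) - complex.Im l|
    @[x --> F] --> 0.
  rewrite -[X in _ --> X]addr0; apply: cvgD.
  - by apply/norm_cvg0P; rewrite -(subrr (complex.Re l)); apply: cvgB => //; exact: cvg_cst.
  - by apply/norm_cvg0P; rewrite -(subrr (complex.Im l)); apply: cvgB => //; exact: cvg_cst.
apply: (squeeze_cvgr _ _ h); last exact: cvg_cst.
apply: nearW => x; rewrite normc_ge0/= (le_trans (normc_le_ReIm _))//.
by rewrite !raddfB.
Qed.

Lemma clim_real (f : T -> R) (l : R) : f x @[x --> F] --> l -> clim F (fun x => (f x)%:C) l%:C.
Proof. by move=> fl; split => //=; exact: cvg_cst. Qed.

Lemma clim_expi (f : T -> R) (l : R) :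
  f x @[x --> F] --> l -> clim F (fun x => expi (f x)) (expi l).
Proof.
move=> fl; split => /=.
- exact: (continuous_cvg _ (@continuous_cos R l) fl).
- exact: (continuous_cvg _ (@continuous_sin R l) fl).
Qed.

End Lim.

Lemma clim_unique (T : Type) (F : set_system T) {FF : ProperFilter F} (f : T -> R[i]) l m :
  clim F f l -> clim F f m -> l = m.
Proof.
move=> [f1 f2] [g1 g2]; apply/eqP; rewrite eq_complex; apply/andP; split; apply/eqP.
- exact: (cvg_unique _ f1 g1).
- exact: (cvg_unique _ f2 g2).
Qed.

Lemma clim_ext (T : Type) (F : set_system T) (f g : T -> R[i]) l :
  f =1 g -> clim F g l -> clim F f l.
Proof. by move=> /funext->. Qed.

Lemma clim_comp (S T : Type) (F : set_system S) (G : set_system T) (u : S -> T)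
  (f : T -> R[i]) l : u x @[x --> F] --> G -> clim G f l -> clim F (f \o u) l.
Proof.
by move=> uG [f1 f2]; split; [apply: cvg_comp uG f1|apply: cvg_comp uG f2].
Qed.

(** The topology of [R[i]^o] is that of its norm, with values in the nonnegative
    reals of [R[i]]. *)
Lemma cvg_of_clim (T : Type) (F : set_system T) {FF : Filter F} (f : T -> R[i]) l :
  clim F f l -> (f x : R[i]^o) @[x --> F] --> (l : R[i]^o).
Proof.
move=> /clim_norm h; apply/cvgrPdistC_le => e e0.
have e0' : 0 < complex.Re e by move: e0; rewrite ltcE/= => /andP[].
have eE : e = (complex.Re e)%:C.
  by move: e0; rewrite ltcE => /andP[/eqP/= + _]; case: (e) => a b /= ->.
have /cvgr_lt/(_ _ e0') H := h; near=> x.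
have -> : `|(f x : R[i]^o) - l| = (normc (f x - l))%:C by [].
by rewrite eE lecR ltW//; near: x.
Unshelve. all: by end_near. Qed.

Section Cont.
Context {T : topologicalType}.
Implicit Types (f g : T -> R[i]).

Lemma ccont_cst c : ccont (fun _ : T => c).
Proof. by move=> x; exact: clim_cst. Qed.

Lemma ccontD f g : ccont f -> ccont g -> ccont (fun x => f x + g x).
Proof. by move=> fc gc x; exact: climD. Qed.

Lemma ccontM f g : ccont f -> ccont g -> ccont (fun x => f x * g x).
Proof. by move=> fc gc x; exact: climM. Qed.

Lemma ccont_expi (f : T -> R) : continuous f -> ccont (fun x => expi (f x)).
Proof. by move=> fc x; apply: clim_expi; exact: fc. Qed.

Lemma ccont_real (f : T -> R) : continuous f -> ccont (fun x => (f x)%:C).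
Proof. by move=> fc x; apply: clim_real; exact: fc. Qed.

Lemma ccont_comp (S : topologicalType) (u : S -> T) f :
  continuous u -> ccont f -> ccont (f \o u).
Proof. by move=> uc fc x; apply: clim_comp (fc _); exact: uc. Qed.

End Cont.

End ComplexLimits.

(** * The one-dimensional Lebesgue integral *)

Lemma continuous_pairr (T U : topologicalType) (x : T) :
  continuous (fun y : U => (x, y)).
Proof. by move=> y; apply: (@cvg_pair _ _ _ (nbhs y)); [exact: cvg_cst|exact: cvg_id]. Qed.

Lemma continuous_pairl (T U : topologicalType) (y : U) :
  continuous (fun x : T => (x, y)).
Proof. by move=> x; apply: (@cvg_pair _ _ _ (nbhs x)); [exact: cvg_id|exact: cvg_cst]. Qed.

Lemma cvg_pairl (S : Type) (F : set_system S) {FF : Filter F} (T U : topologicalType)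
  (f : S -> T) (x : T) (y : U) : f s @[s --> F] --> x -> (f s, y) @[s --> F] --> (x, y).
Proof. by move=> fx; apply: (@cvg_pair _ _ _ F) => //; exact: cvg_cst. Qed.

Section RealLine.
Context {R : realType}.
Local Notation mu := (@lebesgue_measure R).
Local Notation w1 := (fun t : R => (oneDsqr t)^-1).

Lemma oneDsqr_gt0 (t : R) : 0 < oneDsqr t.
Proof. by rewrite (lt_le_trans _ (oneDsqr_ge1 t)). Qed.

Lemma integral_oneDsqrV : (\int[mu]_t (w1 t)%:E = pi%:E)%E.
Proof.
rewrite ge0_symfun_integralT/=; first last.
- by move=> t /=; rewrite /oneDsqr sqrrN.
- exact: continuous_oneDsqrV.
- by move=> t; rewrite invr_ge0 ltW// oneDsqr_gt0.
rewrite -set_itvcy integral0y_oneDsqr -EFinM; congr (_%:E); by field.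
Qed.

Lemma integrable_oneDsqrV : mu.-integrable setT (EFin \o w1).
Proof.
apply/integrableP; split.
  by apply/measurable_EFinP; apply: continuous_measurable_fun; exact: continuous_oneDsqrV.
under eq_integral do rewrite /= ger0_norm ?invr_ge0 ?(ltW (oneDsqr_gt0 _))//.
by rewrite integral_oneDsqrV ltry.
Qed.

(** Domination by a multiple of the Cauchy density makes integrability, bounds
    and dominated convergence automatic. *)
Definition tame (h : R -> R) := continuous h /\ exists M, forall t, `|h t| <= M * w1 t.

Lemma tame_bound_ge0 (h : R -> R) M : (forall t, `|h t| <= M * w1 t) -> 0 <= M.
Proof.
move=> /(_ 0) H; have := le_trans (normr_ge0 _) H.
by rewrite pmulr_lge0// invr_gt0 oneDsqr_gt0.
Qed.

Lemma integrable_dominated (h : R -> R) M : measurable_fun setT h ->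
  (forall t, `|h t| <= M * w1 t) -> mu.-integrable setT (EFin \o h).
Proof.
move=> mh hM; have M0 := tame_bound_ge0 hM.
apply: (@le_integrable _ _ _ mu _ measurableT _ (fun t => M%:E * (w1 t)%:E)%E).
- exact/measurable_EFinP.
- move=> t _ /=; rewrite lee_fin (le_trans (hM t))//.
  exact: ler_norm.
- exact: integrableZl integrable_oneDsqrV.
Qed.

Lemma tame_integrable (h : R -> R) : tame h -> mu.-integrable setT (EFin \o h).
Proof.
by move=> [ch [M hM]]; apply: integrable_dominated hM; exact: continuous_measurable_fun.
Qed.

Lemma Rintegral_bound (h : R -> R) M : continuous h ->
  (forall t, `|h t| <= M * w1 t) -> `|\int[mu]_t h t| <= M * pi.
Proof.
move=> ch hM; have ih : mu.-integrable setT (EFin \o h).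
  by apply: tame_integrable; split=> //; exists M.
apply: (le_trans (le_normr_Rintegral measurableT ih)).
have -> : M * pi = \int[mu]_t (M * w1 t).
  rewrite RintegralZl//; last exact: integrable_oneDsqrV.
  by rewrite /Rintegral integral_oneDsqrV.
apply: le_Rintegral => //.
- exact: (integrable_norm ih).
- exact: (integrableZl measurableT M integrable_oneDsqrV).
Qed.

Lemma Rintegral_dct (h_ : nat -> R -> R) (h : R -> R) M :
  (forall k, measurable_fun setT (h_ k)) -> measurable_fun setT h ->
  (forall k t, `|h_ k t| <= M * w1 t) ->
  (forall t, h_ k t @[k --> \oo] --> h t) ->
  \int[mu]_t h_ k t @[k --> \oo] --> \int[mu]_t h t.
Proof.
move=> ch_ ch hM hl.
have [||||| ih _ H] := @dominated_convergence _ _ _ mu _ measurableT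
  (fun k t => (h_ k t)%:E) (fun t => (h t)%:E) (fun t => M%:E * (w1 t)%:E)%E.
- by move=> k; apply/measurable_EFinP; exact: ch_.
- by apply/measurable_EFinP; exact: ch.
- by apply: aeW => t _; apply: cvg_EFin; [exact: nearW|exact: hl].
- exact: integrableZl integrable_oneDsqrV.
- by apply: aeW => t k _; rewrite lee_fin.
apply: fine_cvg; rewrite fineK; last exact: integrable_fin_num.
exact: H.
Qed.

(** Nonnegative integrands first, where the change of variables formula asks for no
    integrability; the general case splits into positive and negative parts. *)
Lemma ge0_integral_affine (h : R -> R) (c a : R) : 0 < c -> continuous h ->
  (forall t, 0 <= h t) ->
  (\int[mu]_t (h t)%:E = c%:E * \int[mu]_t (h (c * t + a))%:E)%E.
Proof.
move=> c0 ch h0.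
have dF (x : R) : is_derive x 1 (fun t : R => c * t + a) c.
  by apply: is_derive_eq; rewrite addr0 /GRing.scale/= mulr1 ?addr0.
have F'E : derive1 (fun t : R => c * t + a) = cst c.
  by apply/funext => x; rewrite derive1E; exact: derive_val.
rewrite (@increasing_ge0_integration_by_substitutionT _ (fun t => c * t + a) h)//.
- rewrite F'E.
  transitivity (\int[mu]_t (c%:E * (h (c * t + a))%:E))%E.
    by apply: eq_integral => t _; rewrite /= mulrC EFinM.
  rewrite ge0_integralZl//.
  + apply/measurable_EFinP; apply: continuous_measurable_fun => t.
    apply: continuous_comp; last exact: ch.
    by apply: cvgD; [apply: cvgM => //; exact: cvg_cst|exact: cvg_cst].
  + by move=> t _; rewrite lee_fin.
  + by rewrite lee_fin ltW.
- by move=> x y xy; rewrite ltrD2r ltr_pM2l.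
- by rewrite F'E => x; exact: cvg_cst.
- by rewrite F'E; exact: is_cvg_cst.
- by rewrite F'E; exact: is_cvg_cst.
- apply/cvgrNyPle => A; near=> x.
  rewrite -lerBrDr -ler_pdivlMl//; by near: x; apply: nbhs_ninfty_le; rewrite ?num_real.
- apply/cvgryPge => A; near=> x.
  rewrite -lerBlDr -ler_pdivrMl//; by near: x; apply: nbhs_pinfty_ge; rewrite ?num_real.
Unshelve. all: by end_near. Qed.

Lemma Rintegral_affine (h : R -> R) (c a : R) : 0 < c ->
  tame h -> tame (fun t => h (c * t + a)) ->
  \int[mu]_t h t = c * \int[mu]_t h (c * t + a).
Proof.
move=> c0 [ch _] th'.
have maxc (k : R -> R) : continuous k -> continuous (fun t => Num.max (k t) 0).
  by move=> ck t; apply: (@continuous_max _ _ k (cst 0)); [exact: ck|exact: cvg_cst].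
have Nc : continuous (fun t => - h t) by move=> t; apply: cvgN; exact: ch.
have posE (k : R -> R) : (EFin \o k)^\+%E = EFin \o (fun t => Num.max (k t) 0).
  by apply/funext => t; rewrite funeposE/= EFin_max.
have negE (k : R -> R) : (EFin \o k)^\-%E = EFin \o (fun t => Num.max (- k t) 0).
  by apply/funext => t; rewrite funenegE/= EFin_max.
rewrite /Rintegral.
rewrite [in LHS]integralE [in RHS]integralE.
rewrite !posE !negE.
rewrite (@ge0_integral_affine (fun t => Num.max (h t) 0) c a)//; first last.
- by move=> t; rewrite le_max lexx orbT.
- exact: maxc.
rewrite (@ge0_integral_affine (fun t => Num.max (- h t) 0) c a)//; first last.
- by move=> t; rewrite le_max lexx orbT.
- exact: maxc.
have := integrable_pos_fin_num measurableT (tame_integrable th').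
have := integrable_neg_fin_num measurableT (tame_integrable th').
rewrite posE negE => fn fp.
move: fn fp; rewrite /comp /=.
case: (X in X \is a fin_num -> _) => // b _; case: (X in X \is a fin_num -> _) => // b' _.
by rewrite /= mulrBr.
Qed.

(** Rounding the first variable gives functions that are measurable for the
    product sigma-algebra, since on each of countably many strips they depend on
    the second variable only; they converge to [f]. *)
Lemma measurable_jointly_continuous (f : R * R -> R) :
  continuous f -> measurable_fun setT f.
Proof.
move=> cf.
pose g (n : nat) (x : R) : R := (Num.floor (x * n.+1%:R))%:~R / n.+1%:R.
have gl x : g n x @[n --> \oo] --> x.
  apply/cvgrPdist_le => e e0; near=> n.
  have n0 : 0 < n.+1%:R :> R by [].
  have /andP[h1 h2] := floor_itv (x * n.+1%:R).
  have xE : x - g n x = (x * n.+1%:R - (Num.floor (x * n.+1%:R))%:~R) / n.+1%:R.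
    by rewrite /g mulrBl mulfK// gt_eqF.
  rewrite xE ger0_norm; last by rewrite divr_ge0// subr_ge0.
  apply: (@le_trans _ _ n.+1%:R^-1).
    rewrite ler_pdivrMr// mulVf ?gt_eqF// lerBlDl; move: h2.
    by rewrite intrD => /ltW.
  rewrite invf_ple// ?posrE//; apply: le_trans (_ : n%:R <= _).
    by near: n; exact: nbhs_infty_ger.
  by rewrite ler_nat.
apply: (@measurable_fun_cvg _ _ _ _ (fun n z => f (g n z.1, z.2))); last first.
  move=> [x y] _ /=; apply: (continuous_cvg _ (cf (x, y))).
  exact: cvg_pairl.
move=> n _ B mB; rewrite setTI.
have -> : (fun z => f (g n z.1, z.2)) @^-1` B =
    \bigcup_(k : int) ([set x | Num.floor (x * n.+1%:R) = k] `*`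
       [set y | B (f (k%:~R / n.+1%:R, y))]).
  apply/seteqP; split=> [[x y] /= H|[x y] [k _ [/= <-]]]//.
  by exists (Num.floor (x * n.+1%:R)).
apply: countable_bigcupT_measurable; first exact: countableP.
move=> k; apply: measurableX.
- rewrite (_ : [set _ | _] = `[k%:~R / n.+1%:R, (k + 1)%:~R / n.+1%:R[%classic).
    exact: measurable_itv.
  apply/seteqP; split=> x /=; rewrite in_itv/= ler_pdivrMr// ltr_pdivlMr//.
  + by move=> <-; exact: floor_itv.
  + by move=> /floor_def.
- rewrite -[X in measurable X]setTI.
  apply: (@continuous_measurable_fun R (fun y => f (k%:~R / n.+1%:R, y))) => //.
  move=> y; apply: (continuous_cvg _ (cf (_, y))).
  exact: continuous_pairr.
Unshelve. all: by end_near. Qed.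

Lemma Rintegral_swap (f : R * R -> R) M : continuous f ->
  (forall z, `|f z| <= M * w1 z.1 * w1 z.2) ->
  \int[mu]_x \int[mu]_y f (x, y) = \int[mu]_y \int[mu]_x f (x, y).
Proof.
move=> cf fM.
have M0 : 0 <= M.
  have := le_trans (normr_ge0 _) (fM (0, 0)).
  by rewrite pmulr_lge0 ?pmulr_lge0// invr_gt0 oneDsqr_gt0.
have w0 t : 0 <= w1 t by rewrite invr_ge0 ltW// oneDsqr_gt0.
have mf := measurable_jointly_continuous cf.
have c1 x : continuous (fun y => f (x, y)).
  move=> y; apply: (continuous_cvg _ (cf (_, y))).
  exact: continuous_pairr.
have c2 y : continuous (fun x => f (x, y)).
  move=> x; apply: (continuous_cvg _ (cf (x, _))).
  exact: continuous_pairl.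
have i1 x : mu.-integrable setT (fun y => (f (x, y))%:E).
  apply: tame_integrable; split; first exact: c1.
  by exists (M * w1 x) => y; exact: (fM (x, y)).
have i2 y : mu.-integrable setT (fun x => (f (x, y))%:E).
  apply: tame_integrable; split; first exact: c2.
  by exists (M * w1 y) => x; rewrite mulrAC; exact: (fM (x, y)).
(* Tonelli: the double integral of the bound is finite. *)
have if2 : (mu \x mu)%E.-integrable setT (EFin \o f).
  apply/integrable12ltyP; first exact/measurable_EFinP.
  apply: (@le_lt_trans _ _ (\int[mu]_x ((M * pi)%:E * (w1 x)%:E))%E).
    apply: ge0_le_integral => //.
    - by move=> x _; exact: integral_ge0.
    - apply: (@measurable_fun_fubini_tonelli_F _ _ _ _ _ mu (abse \o (EFin \o f))) => //=.
      by apply: measurableT_comp => //; exact/measurable_EFinP.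
    - by apply: measurable_funeM; exact: (measurable_int _ integrable_oneDsqrV).
    - move=> x _.
      apply: (@le_trans _ _ (\int[mu]_y ((M * w1 x)%:E * (w1 y)%:E))%E).
        apply: ge0_le_integral => //.
        + by apply: measurableT_comp => //; exact: (measurable_int _ (i1 x)).
        + by apply: measurable_funeM; exact: (measurable_int _ integrable_oneDsqrV).
        + by move=> y _; rewrite -EFinM lee_fin; exact: (fM (x, y)).
      rewrite ge0_integralZl//; last 2 first.
        exact: (measurable_int _ integrable_oneDsqrV).
        by rewrite lee_fin mulr_ge0.
      by rewrite integral_oneDsqrV -!EFinM lee_fin mulrAC.
  rewrite ge0_integralZl//; last 2 first.
    exact: (measurable_int _ integrable_oneDsqrV).
    by rewrite lee_fin mulr_ge0// pi_ge0.
  by rewrite integral_oneDsqrV -!EFinM ltry.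
rewrite /Rintegral.
have := Fubini if2; rewrite /=.
have E1 x : (\int[mu]_y (f (x, y))%:E)%E = (fine (\int[mu]_y (f (x, y))%:E))%:E.
  by rewrite fineK//; exact: integrable_fin_num.
have E2 y : (\int[mu]_x (f (x, y))%:E)%E = (fine (\int[mu]_x (f (x, y))%:E))%:E.
  by rewrite fineK//; exact: integrable_fin_num.
under eq_integral do rewrite E1.
by under [in RHS]eq_integral do rewrite E2; move=> ->.
Qed.

Lemma Rintegral_FTC (f F : R -> R) (a b : R) : a <= b -> continuous f ->
  (forall x : R, is_derive x (1 : R) F (f x)) -> \int[mu]_(x in `[a, b]) f x = F b - F a.
Proof.
move=> ab cf dF; have [<-|ab'] := eqVneq a b.
  by rewrite set_itv1 Rintegral_set1 subrr.
have cF : continuous F.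
  by move=> x; apply/differentiable_continuous/derivable1_diffP; exact: ex_derive.
rewrite /Rintegral (@continuous_FTC2 _ f F)//.
- by rewrite lt_neqAle ab' ab.
- exact: continuous_subspaceT.
- split; first by move=> x _; exact: ex_derive.
  + exact: cvg_at_right_filter (cF a).
  + exact: cvg_at_left_filter (cF b).
- by move=> x _; rewrite derive1E; exact: derive_val.
Qed.

(** The fundamental theorem of calculus on the intervals from [- k] to [k], cut
    at 0, and dominated convergence; meant for integrands that involve the
    absolute value of the variable. *)
Lemma Rintegral_two_sided (h h1 h2 F1 F2 : R -> R) : tame h ->
  continuous h1 -> continuous h2 ->
  (forall t, t <= 0 -> h t = h1 t) -> (forall t, 0 <= t -> h t = h2 t) ->
  (forall x : R, is_derive x (1 : R) F1 (h1 x)) -> (forall x : R, is_derive x (1 : R) F2 (h2 x)) ->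
  F1 (- k%:R) @[k --> \oo] --> 0 -> F2 k%:R @[k --> \oo] --> 0 ->
  \int[mu]_t h t = F1 0 - F2 0.
Proof.
move=> th ch1 ch2 hh1 hh2 dF1 dF2 F1y F2y.
have [ch [M hM]] := th; have M0 := tame_bound_ge0 hM.
have mh : measurable_fun setT h by exact: continuous_measurable_fun.
pose I (k : nat) := `[- k%:R, k%:R]%classic : set R.
have mI k : measurable (I k) by exact: measurable_itv.
have key k : \int[mu]_(t in I k) h t = (F1 0 - F1 (- k%:R)) + (F2 k%:R - F2 0).
  have ih : mu.-integrable (I k) (EFin \o h).
    by apply: (integrableS _ _ _ (tame_integrable th)) => //; exact: mI.
  have := @Rintegral_itvB _ h (BLeft (- k%:R)) (BRight k%:R) 0 ih.
  rewrite !bnd_simp oppr_le0 ler0n => /(_ isT isT) /eqP.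
  rewrite subr_eq => /eqP ->; rewrite addrC; congr (_ + _).
  + rewrite -(@Rintegral_FTC h1) ?oppr_le0//.
    apply: eq_Rintegral => x; rewrite inE/= in_itv/= => /andP[_ x0].
    exact: hh1.
  + rewrite Rintegral_itv_obnd_cbnd; last first.
      apply: (integrableS _ _ _ (tame_integrable th)) => //.
    rewrite -(@Rintegral_FTC h2)//.
    apply: eq_Rintegral => x; rewrite inE/= in_itv/= => /andP[x0 _].
    exact: hh2.
have lim1 : \int[mu]_(t in I k) h t @[k --> \oo] --> F1 0 - F2 0.
  under eq_fun do rewrite key.
  rewrite (_ : F1 0 - F2 0 = (F1 0 - 0) + (0 - F2 0)); last by ring.
  apply: cvgD; apply: cvgB => //; exact: cvg_cst.
have lim2 : \int[mu]_(t in I k) h t @[k --> \oo] --> \int[mu]_t h t.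
  under eq_fun do rewrite Rintegral_mkcond.
  apply: (@Rintegral_dct _ _ M) => //.
  - move=> k; rewrite -[h]/(fun t => h t).
    apply/(measurable_restrictT _ (mI k)).
    exact: measurable_funTS.
  - move=> k t; rewrite patchE; case: ifPn => // _.
    by rewrite normr0 mulr_ge0// invr_ge0 ltW// oneDsqr_gt0.
  - move=> t; apply: (@cvg_near_cst _ _ _ _).
    near=> k; rewrite patchE ifT// inE /I/= in_itv/= -ler_norml.
    by near: k; exact: nbhs_infty_ger.
exact: (cvg_unique _ lim2 lim1).
Unshelve. all: by end_near. Qed.

End RealLine.

(** * Abstract integrals *)

Section Sequential.
Context {R : realType} {V : normedModType R}.

(** Dominated convergence speaks of sequences: this lemma and the next ones let
    it handle all limits in normed modules. *)
Lemma cvg_within_seq (D : set V) (p : V) (f : V -> R) (l : R) :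
  (forall u : nat -> V, (forall k, D (u k)) -> u k @[k --> \oo] --> p ->
     f (u k) @[k --> \oo] --> l) ->
  f x @[x --> within D (nbhs p)] --> l.
Proof.
move=> H; apply: contrapT => fpl.
have [e e0 He] : exists2 e : R, 0 < e & forall d : R, 0 < d ->
    exists x, [/\ D x, `|x - p| < d & e <= `|f x - l|].
  apply: contrapT => nex; apply: fpl; apply/cvgrPdistC_le => e e0.
  apply: contrapT => nnear; apply: nex; exists e => // d d0.
  apply: contrapT => nx; apply: nnear.
  rewrite near_withinE; near=> x.
  have xd : `|x - p| < d by near: x; apply/nbhs_ballP; exists d => //= y; rewrite -ball_normE /= distrC.
  move=> Dx; rewrite leNgt; apply/negP => /ltW fe; apply: nx.
  by exists x; split.
pose u k := sval (cid (He k.+1%:R^-1 ltac:(by rewrite invr_gt0))).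
have uP k : [/\ D (u k), `|u k - p| < k.+1%:R^-1 & e <= `|f (u k) - l|].
  by rewrite /u; case: cid.
have up : u k @[k --> \oo] --> p.
  apply/cvgrPdistC_lt => r r0; near=> k.
  have [_ /lt_trans h _] := uP k; apply: h.
  by near: k; exact: (near_infty_natSinv_lt (PosNum r0)).
have Du k : D (u k) by case: (uP k).
have /cvgrPdistC_lt/(_ e e0) := H u Du up.
move=> [N _ /(_ N (leqnn N))]/=; have [_ _] := uP N.
by move=> /le_lt_trans h /h; rewrite ltxx.
Unshelve. all: by end_near. Qed.

Lemma clim_within_seq (D : set V) (p : V) (f : V -> R[i]) (l : R[i]) :
  (forall u : nat -> V, (forall k, D (u k)) -> u k @[k --> \oo] --> p ->
     clim \oo (f \o u) l) ->
  clim (within D (nbhs p)) f l.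
Proof.
move=> H; split; apply: cvg_within_seq => u Du up; by have [] := H u Du up.
Qed.

Lemma ccont_seq (f : V -> R[i]) :
  (forall (u : nat -> V) p, u k @[k --> \oo] --> p -> clim \oo (f \o u) (f p)) ->
  ccont f.
Proof.
move=> H p.
have -> : nbhs p = within setT (nbhs p).
  apply/seteqP; split => A; first by move=> h; apply: filterS h.
  by rewrite /within/= => h; apply: filterS h => x; exact.
by apply: clim_within_seq => u _; exact: H.
Qed.

Lemma ccont_seqP (f : V -> R[i]) (u : nat -> V) p :
  ccont f -> u k @[k --> \oo] --> p -> clim \oo (f \o u) (f p).
Proof. by move=> cf up; apply: clim_comp (cf p); exact: up. Qed.

End Sequential.

Section Integral.
Context {R : realType}.

Section Spec.
Context {V : normedModType R}.
Implicit Types (I : (V -> R[i]) -> R[i]) (w : V -> R) (f g : V -> R[i]).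

(** The weight plays the part of a fixed integrable function with polynomial
    decay; the functions that it dominates up to a constant are those that get
    integrated. *)
Definition dominated w (M : R) f := forall x, normc (f x) <= M * w x.

Definition good w f := ccont f /\ exists M, dominated w M f.

(** An integral of dimension [n], defined on the continuous functions
    dominated by a multiple of the weight [w]. These properties are stable
    under products and linear changes of coordinates, and they imply all the
    facts on integration used below. *)
Record integral_spec I w (n : nat) : Prop := IntegralSpec {
  weight_gt0 : forall x, 0 < w x;
  weight_le1 : forall x, w x <= 1;
  weight_cont : continuous w;
  weight_decay : exists m K, forall x, 1 <= K * w x * (1 + `|x|) ^+ m;
  intD : forall f g, good w f -> good w g -> I (fun x => f x + g x) = I f + I g;
  intZ : forall c f, good w f -> I (fun x => c * f x) = c * I f;
  int_bound : exists K, forall f M, ccont f -> dominated w M f -> normc (I f) <= K * M;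
  int_dct : forall (f_ : nat -> V -> R[i]) f M, (forall k, ccont (f_ k)) -> ccont f ->
    (forall k, dominated w M (f_ k)) -> (forall x, clim \oo (f_ ^~ x) (f x)) ->
    clim \oo (fun k => I (f_ k)) (I f);
  int_shift : forall a f, good w f -> good w (fun x => f (x + a)) ->
    I (fun x => f (x + a)) = I f;
  int_scale : forall c f, 0 < c -> good w f -> good w (fun x => f (c *: x)) ->
    I f = (c ^+ n)%:C * I (fun x => f (c *: x))
}.

(** Nondegeneracy is stated as coercivity over finitely many directions, which
    bounds powers of the norm by products of pairings: this is what makes the
    Fourier transforms of Schwartz functions decrease rapidly. *)
Record pairing_spec (p : V -> V -> R) : Prop := PairingSpec {
  pairC : forall x y, p x y = p y x;
  pairDr : forall x y z, p x (y + z) = p x y + p x z;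
  pairZr : forall s x y, p x (s *: y) = s * p x y;
  pair_le : exists K, 0 <= K /\ forall x y, `|p x y| <= K * `|x| * `|y|;
  pair_coercive : exists vs : seq V, forall x, `|x| <= \sum_(v <- vs) `|p x v|
}.

(** The unnormalized Fourier transform, and its inversion formula with
    constant [c]. *)
Definition fourier I (p : V -> V -> R) f : V -> R[i] :=
  fun eta => I (fun x => f x * expi (- p eta x)).

Definition fourier_inversion I w p (c : R) := forall f,
  good w f -> good w (fourier I p f) ->
  forall x, I (fun eta => fourier I p f eta * expi (p eta x)) = c%:C * f x.

End Spec.

Definition fubini {V1 V2 : normedModType R} (I1 : (V1 -> R[i]) -> R[i]) (w1 : V1 -> R)
    (I2 : (V2 -> R[i]) -> R[i]) (w2 : V2 -> R) :=
  forall (f : V1 * V2 -> R[i]) M, ccont f ->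
    (forall z, normc (f z) <= M * w1 z.1 * w2 z.2) ->
    I1 (fun x => I2 (fun y => f (x, y))) = I2 (fun y => I1 (fun x => f (x, y))).

End Integral.

Section BaseCase.
Context {R : realType}.
Local Notation mu := (@lebesgue_measure R).
Local Notation C := R[i].

Definition wR (t : R^o) : R := (oneDsqr t)^-1.
Definition intR : (R^o -> C) -> C := @cintegral R.
Definition pairR (x y : R^o) : R := x * y.

Lemma good_Re (f : R^o -> C) : good wR f -> tame (fun t => complex.Re (f t)).
Proof.
move=> [cf [M fM]]; split; first by move=> x; have [] := cf x.
by exists M => t; apply: le_trans (normr_Re_le _) (fM t).
Qed.

Lemma good_Im (f : R^o -> C) : good wR f -> tame (fun t => complex.Im (f t)).
Proof.
move=> [cf [M fM]]; split; first by move=> x; have [] := cf x.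
by exists M => t; apply: le_trans (normr_Im_le _) (fM t).
Qed.

Lemma wR_gt0 t : 0 < wR t.
Proof. by rewrite invr_gt0 oneDsqr_gt0. Qed.

Lemma wR_le1 t : wR t <= 1.
Proof. exact: oneDsqrV_le1. Qed.

Lemma RintegralD_tame (f g : R -> R) : tame f -> tame g ->
  Rintegral mu setT (fun t => f t + g t) = Rintegral mu setT f + Rintegral mu setT g.
Proof. by move=> tf tg; apply: RintegralD => //; exact: tame_integrable. Qed.

Lemma RintegralZ_tame (c : R) (f : R -> R) : tame f ->
  Rintegral mu setT (fun t => c * f t) = c * Rintegral mu setT f.
Proof. by move=> tf; apply: RintegralZl => //; exact: tame_integrable. Qed.

Lemma tameZ (c : R) (f : R -> R) : tame f -> tame (fun t => c * f t).
Proof.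
move=> [cf [M fM]]; split.
  by move=> x; apply: cvgM; [exact: cvg_cst|exact: cf].
by exists (`|c| * M) => t; rewrite normrM -mulrA ler_wpM2l.
Qed.

Lemma integral_spec_R : integral_spec intR wR 1.
Proof.
split.
- exact: wR_gt0.
- exact: wR_le1.
- exact: continuous_oneDsqrV.
- exists 2%N, 1 => x; rewrite mul1r /wR mulrC ler_pdivlMr ?oneDsqr_gt0// mul1r.
  rewrite /oneDsqr -[X in 1 + X]real_normK ?num_real//.
  have := normr_ge0 x; nra.
- move=> f g gf gg; rewrite /intR /cintegral.
  have [fr fi] := (good_Re gf, good_Im gf); have [gr gi] := (good_Re gg, good_Im gg).
  under eq_Rintegral do rewrite raddfD.
  under [X in Complex _ X]eq_Rintegral do rewrite raddfD.
  by rewrite !RintegralD_tame.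
- move=> c f gf; rewrite /intR /cintegral.
  have [fr fi] := (good_Re gf, good_Im gf).
  under eq_Rintegral do rewrite complexReM -mulNr.
  under [X in Complex _ X]eq_Rintegral do rewrite complexImM.
  rewrite !RintegralD_tame ?RintegralZ_tame//; try exact: tameZ.
  by case: c => a b /=; rewrite mulNr.
- exists (2 * pi) => f M cf fM; apply: le_trans (normc_le_ReIm _) _ => /=.
  have gf : good wR f by split => //; exists M.
  rewrite (_ : 2 * pi * M = M * pi + M * pi); last by ring.
  apply: lerD; apply: Rintegral_bound.
  + by case: (good_Re gf).
  + by move=> t; apply: le_trans (normr_Re_le _) (fM t).
  + by case: (good_Im gf).
  + by move=> t; apply: le_trans (normr_Im_le _) (fM t).
- move=> f_ f M cf_ cf fM fl.
  split => /=; apply: (@Rintegral_dct _ _ _ M).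
  + by move=> k; apply: continuous_measurable_fun => x; have [] := cf_ k x.
  + by apply: continuous_measurable_fun => x; have [] := cf x.
  + by move=> k t; apply: le_trans (normr_Re_le _) (fM k t).
  + by move=> t; have [] := fl t.
  + by move=> k; apply: continuous_measurable_fun => x; have [] := cf_ k x.
  + by apply: continuous_measurable_fun => x; have [] := cf x.
  + by move=> k t; apply: le_trans (normr_Im_le _) (fM k t).
  + by move=> t; have [] := fl t.
- move=> a f gf gfa; rewrite /intR /cintegral.
  have [fr fi] := (good_Re gf, good_Im gf); have [gr gi] := (good_Re gfa, good_Im gfa).
  rewrite [in RHS](@Rintegral_affine _ (fun t => complex.Re (f t)) 1 a)//; last first.
    by under eq_fun do rewrite mul1r.
  rewrite [X in _ = Complex _ X](@Rintegral_affine _ (fun t => complex.Im (f t)) 1 a)//; last first.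
    by under eq_fun do rewrite mul1r.
  rewrite !mul1r.
  under [in RHS]eq_Rintegral do rewrite mul1r.
  by under [X in _ = Complex _ X]eq_Rintegral do rewrite mul1r.
- move=> c f c0 gf gfc; rewrite /intR /cintegral expr1.
  have [fr fi] := (good_Re gf, good_Im gf); have [gr gi] := (good_Re gfc, good_Im gfc).
  rewrite [in LHS](@Rintegral_affine _ (fun t => complex.Re (f t)) c 0)//; last first.
    by under eq_fun do rewrite addr0.
  rewrite [X in Complex _ X](@Rintegral_affine _ (fun t => complex.Im (f t)) c 0)//; last first.
    by under eq_fun do rewrite addr0.
  under [in LHS]eq_Rintegral do rewrite addr0.
  under [X in Complex _ (_ * X)]eq_Rintegral do rewrite addr0.
  apply/eqP; rewrite eq_complex complexReM complexImM/= !mul0r subr0 addr0.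
  by apply/andP; split.
Qed.

Lemma pairing_spec_R : pairing_spec pairR.
Proof.
split.
- by move=> x y; rewrite /pairR mulrC.
- by move=> x y z; rewrite /pairR mulrDr.
- by move=> s x y; rewrite /pairR mulrCA.
- by exists 1; split => // x y; rewrite mul1r normrM.
- by exists [:: 1] => x; rewrite big_seq1 /pairR mulr1.
Qed.

Lemma fubini_R : fubini intR wR intR wR.
Proof.
move=> f M cf fM; rewrite /intR /cintegral /=.
apply/eqP; rewrite eq_complex/=; apply/andP; split; apply/eqP.
- apply: (@Rintegral_swap _ (fun z => complex.Re (f z)) M).
    by move=> z; have [] := cf z.
  by move=> z; apply: le_trans (normr_Re_le _) (fM z).
- apply: (@Rintegral_swap _ (fun z => complex.Im (f z)) M).
    by move=> z; have [] := cf z.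
  by move=> z; apply: le_trans (normr_Im_le _) (fM z).
Qed.

Lemma tame_expR_abs (eps : R) (g : R -> R) : 0 < eps -> continuous g ->
  (forall t, `|g t| <= 1) -> tame (fun t => expR (- (eps * `|t|)) * g t).
Proof.
move=> eps0 cg g1; split.
  move=> t; apply: cvgM; last exact: cg.
  apply: continuous_cvg; first exact: continuous_expR.
  apply: cvgN; apply: cvgM; first exact: cvg_cst.
  exact: norm_continuous.
exists (1 + 2 / eps ^+ 2) => t.
rewrite normrM ger0_norm ?expR_ge0//.
apply: (@le_trans _ _ (expR (- (eps * `|t|)))); first by rewrite ler_piMr ?expR_ge0.
rewrite ler_pdivlMr ?oneDsqr_gt0// expRN mulrC ler_pdivrMr ?expR_gt0//.
have e1 : 1 + eps ^+ 2 * `|t| ^+ 2 / 2 <= expR (eps * `|t|).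
  have x0 : 0 <= eps * `|t| by rewrite mulr_ge0// ltW.
  have := @expR_ge1Dxn R (eps * `|t|) 1 x0.
  rewrite exprMn /= => H; apply: le_trans H.
  by rewrite lerD2l ler_wpM2l// ?mulr_ge0 ?exprn_ge0// ltW.
rewrite /oneDsqr -[X in 1 + X]real_normK ?num_real//.
apply: (@le_trans _ _ ((1 + 2 / eps ^+ 2) * (1 + eps ^+ 2 * `|t| ^+ 2 / 2))); last first.
  by rewrite ler_wpM2l// addr_ge0// divr_ge0// sqr_ge0.
have -> : (1 + 2 / eps ^+ 2) * (1 + eps ^+ 2 * `|t| ^+ 2 / 2) =
  1 + `|t| ^+ 2 + (2 / eps ^+ 2 + eps ^+ 2 * `|t| ^+ 2 / 2).
  by field; rewrite gt_eqF.
rewrite lerDl addr_ge0//; first by rewrite divr_ge0// sqr_ge0.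
by rewrite divr_ge0// mulr_ge0// sqr_ge0.
Qed.

Lemma is_derive_exp_trig (a y x : R) :
  [/\ is_derive x (1 : R) (fun t => expR (a * t)) (a * expR (a * x)),
      is_derive x (1 : R) (fun t => cos (y * t)) (- (y * sin (y * x))) &
      is_derive x (1 : R) (fun t => sin (y * t)) (y * cos (y * x))].
Proof.
have dl (c : R) : is_derive x (1 : R) (fun t => c * t) c.
  by apply: is_derive_eq; rewrite /GRing.scale/= mulr1.
split.
- by rewrite mulrC; exact: (is_derive1_comp (is_derive_expR (a * x)) (dl a)).
- by rewrite mulrC -mulNr; exact: (is_derive1_comp (is_derive_cos (y * x)) (dl y)).
- by rewrite mulrC; exact: (is_derive1_comp (is_derive_sin (y * x)) (dl y)).
Qed.

Lemma is_derive_exp_cos (a y : R) : a ^+ 2 + y ^+ 2 != 0 -> forall x : R,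
  is_derive x (1 : R) (fun t => expR (a * t) * (a * cos (y * t) + y * sin (y * t))
                    / (a ^+ 2 + y ^+ 2))
    (expR (a * x) * cos (y * x)).
Proof.
move=> D0 x; have [de dc ds] := is_derive_exp_trig a y x.
by apply: is_derive_eq; rewrite /GRing.scale/=; field.
Qed.

Lemma is_derive_exp_sin (a y : R) : a ^+ 2 + y ^+ 2 != 0 -> forall x : R,
  is_derive x (1 : R) (fun t => expR (a * t) * (a * sin (y * t) - y * cos (y * t))
                    / (a ^+ 2 + y ^+ 2))
    (expR (a * x) * sin (y * x)).
Proof.
move=> D0 x; have [de dc ds] := is_derive_exp_trig a y x.
by apply: is_derive_eq; rewrite /GRing.scale/=; field.
Qed.

Lemma cvg_expR_bounded (eps M : R) (g : nat -> R) : 0 < eps -> (forall k, `|g k| <= M) ->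
  expR (- (eps * k%:R)) * g k @[k --> \oo] --> 0.
Proof.
move=> eps0 gM.
have e0 : expR (- (eps * k%:R)) @[k --> \oo] --> (0 : R).
  apply: (@cvg_comp _ _ _ (fun k : nat => eps * k%:R) (fun x => expR (- x)) \oo +oo); last exact: cvgr_expR.
  apply/cvgryPge => A; near=> k.
  rewrite -ler_pdivrMl//; near: k; exact: nbhs_infty_ger.
apply/norm_cvg0P.
have h : expR (- (eps * k%:R)) * M @[k --> \oo] --> 0.
  by rewrite -[X in _ --> X](mul0r M); apply: cvgM => //; exact: cvg_cst.
apply: (squeeze_cvgr _ _ h); last exact: cvg_cst.
apply: nearW => k; rewrite normr_ge0/= normrM ger0_norm ?expR_ge0//.
by rewrite ler_wpM2l// expR_ge0.
Unshelve. all: by end_near. Qed.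

(** The Poisson kernel, from the elementary antiderivatives of the real and
    imaginary parts on the two half-lines. *)
Lemma fourier_expR_abs (eps y : R) : 0 < eps ->
  intR (fun t => (expR (- (eps * `|t|)))%:C * expi (t * y)) =
  (2 * eps / (eps ^+ 2 + y ^+ 2))%:C.
Proof.
move=> eps0.
have D0 : eps ^+ 2 + y ^+ 2 != 0.
  by rewrite gt_eqF// ltr_wpDr ?sqr_ge0// exprn_gt0.
have ND0 : (- eps) ^+ 2 + y ^+ 2 != 0 by rewrite sqrrN.
have cM (c : R) : continuous (fun t : R => c * t) by move=> t; apply: cvgM; [exact: cvg_cst|exact: cvg_id].
have ce (a : R) : continuous (fun t : R => expR (a * t)).
  by move=> t; apply: continuous_cvg; [exact: continuous_expR|exact: cM].
have cc : continuous (fun t : R => cos (y * t)).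
  by move=> t; apply: (@continuous_comp _ _ _ (fun t => y * t) cos); [exact: cM|exact: continuous_cos].
have cs : continuous (fun t : R => sin (y * t)).
  by move=> t; apply: (@continuous_comp _ _ _ (fun t => y * t) sin); [exact: cM|exact: continuous_sin].
have cos1 (t : R) : `|cos t| <= 1 by rewrite ler_norml cos_geN1 cos_le1.
have sin1 (t : R) : `|sin t| <= 1 by rewrite ler_norml sin_geN1 sin_le1.
rewrite /intR /cintegral; apply/eqP; rewrite eq_complex/=; apply/andP; split; apply/eqP.
- rewrite (_ : (fun t => _) = (fun t => expR (- (eps * `|t|)) * cos (y * t))); last first.
    by apply/funext => t; rewrite mul0r subr0 mulrC (mulrC t) mulrC.
  rewrite (@Rintegral_two_sided _ _ _ _ _ _ (tame_expR_abs eps0 cc _) _ _ _ _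
    (is_derive_exp_cos D0) (is_derive_exp_cos ND0)).
  + rewrite !mulr0 expR0 cos0 sin0 !mulr1 mulr0 addr0 !mul1r sqrrN addr0; field.
    by rewrite D0.
  + by move=> t.
  + by move=> t; apply: cvgM; [exact: ce|exact: cc].
  + by move=> t; apply: cvgM; [exact: ce|exact: cc].
  + by move=> t t0; rewrite ler0_norm// mulrN opprK.
  + by move=> t t0; rewrite ger0_norm// mulNr.
  + under eq_fun do rewrite mulrN -mulrA.
    apply: (@cvg_expR_bounded _ ((`|eps| + `|y|) / (eps ^+ 2 + y ^+ 2))) => // k.
    rewrite normrM normfV [X in _ / X]ger0_norm ?addr_ge0 ?sqr_ge0//.
    rewrite ler_wpM2r ?invr_ge0 ?addr_ge0 ?sqr_ge0//.
    by rewrite (le_trans (ler_normD _ _))// lerD// normrM ler_piMr.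
  + under eq_fun do rewrite mulNr -mulrA.
    apply: (@cvg_expR_bounded _ ((`|eps| + `|y|) / (eps ^+ 2 + y ^+ 2))) => // k.
    rewrite normrM normfV sqrrN [X in _ / X]ger0_norm ?addr_ge0 ?sqr_ge0//.
    rewrite ler_wpM2r ?invr_ge0 ?addr_ge0 ?sqr_ge0//.
    by rewrite (le_trans (ler_normD _ _))// lerD// normrM ?normrN ler_piMr.
- rewrite (_ : (fun t => _) = (fun t => expR (- (eps * `|t|)) * sin (y * t))); last first.
    by apply/funext => t; rewrite mul0r addr0 (mulrC t).
  rewrite (@Rintegral_two_sided _ _ _ _ _ _ (tame_expR_abs eps0 cs _) _ _ _ _
    (is_derive_exp_sin D0) (is_derive_exp_sin ND0)).
  + by rewrite !mulr0 expR0 cos0 sin0 !mulr1 !mulr0 !mul1r sqrrN !sub0r subrr.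
  + by move=> t.
  + by move=> t; apply: cvgM; [exact: ce|exact: cs].
  + by move=> t; apply: cvgM; [exact: ce|exact: cs].
  + by move=> t t0; rewrite ler0_norm// mulrN opprK.
  + by move=> t t0; rewrite ger0_norm// mulNr.
  + under eq_fun do rewrite mulrN -mulrA.
    apply: (@cvg_expR_bounded _ ((`|eps| + `|y|) / (eps ^+ 2 + y ^+ 2))) => // k.
    rewrite normrM normfV [X in _ / X]ger0_norm ?addr_ge0 ?sqr_ge0//.
    rewrite ler_wpM2r ?invr_ge0 ?addr_ge0 ?sqr_ge0//.
    by rewrite (le_trans (ler_normB _ _))// lerD// normrM ler_piMr.
  + under eq_fun do rewrite mulNr -mulrA.
    apply: (@cvg_expR_bounded _ ((`|eps| + `|y|) / (eps ^+ 2 + y ^+ 2))) => // k.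
    rewrite normrM normfV sqrrN [X in _ / X]ger0_norm ?addr_ge0 ?sqr_ge0//.
    rewrite ler_wpM2r ?invr_ge0 ?addr_ge0 ?sqr_ge0//.
    by rewrite (le_trans (ler_normB _ _))// lerD// normrM ?normrN ler_piMr.
Qed.

End BaseCase.

Section GoodTheory.
Context {R : realType} {V : normedModType R}.
Variables (I : (V -> R[i]) -> R[i]) (w : V -> R) (n : nat).
Hypothesis spec : integral_spec I w n.
Implicit Types (f g : V -> R[i]).

Lemma weight_ge0 x : 0 <= w x. Proof. exact/ltW/(weight_gt0 spec). Qed.

Lemma weight_decay_pos : exists m, exists2 K : R, 0 <= K &
  forall x, 1 <= K * w x * (1 + `|x|) ^+ m.
Proof.
have [m [K HK]] := weight_decay spec; exists m, K => //.
have := le_trans ler01 (HK 0); rewrite normr0 addr0 expr1n mulr1.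
by rewrite pmulr_lge0// (weight_gt0 spec).
Qed.

Lemma dominated_ge0 M f : dominated w M f -> 0 <= M.
Proof.
move=> /(_ 0) /(le_trans (normc_ge0 _)).
by rewrite pmulr_lge0// (weight_gt0 spec).
Qed.

Lemma goodM f g K : good w f -> ccont g -> (forall x, normc (g x) <= K) ->
  good w (fun x => f x * g x).
Proof.
move=> [cf [M fM]] cg gK; split; first exact: ccontM.
exists (M * K) => x; rewrite Normc.normcM mulrAC.
by apply: ler_pM => //; rewrite ?normc_ge0.
Qed.

Lemma goodMexpi f (h : V -> R) : good w f -> continuous h -> good w (fun x => f x * expi (h x)).
Proof.
move=> gf ch; apply: (goodM gf (ccont_expi ch)) => x; rewrite normc_expi; exact: lexx.
Qed.

Lemma goodZ c f : good w f -> good w (fun x => c * f x).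
Proof.
move=> gf; under eq_fun do rewrite mulrC.
by apply: (@goodM _ _ (normc c)) => // x; exact: clim_cst.
Qed.

Lemma goodD f g : good w f -> good w g -> good w (fun x => f x + g x).
Proof.
move=> [cf [M fM]] [cg [K gK]]; split; first exact: ccontD.
exists (M + K) => x; rewrite mulrDl (le_trans (le_normcD _ _))//.
exact: lerD.
Qed.

Lemma good0 : good w (fun=> 0).
Proof.
split; first exact: ccont_cst.
by exists 0 => x; rewrite Normc.normc0 mul0r.
Qed.

Lemma int0 : I (fun=> 0) = 0.
Proof.
rewrite -[RHS](mul0r (I (fun=> 0))) -(intZ spec _ good0).
by congr I; apply/funext => x; rewrite mul0r.
Qed.

Lemma good_sum (J : Type) (s : seq J) (F : J -> V -> R[i]) :
  (forall j, good w (F j)) -> good w (fun x => \sum_(j <- s) F j x).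
Proof.
move=> gF; elim: s => [|a s IH].
  under eq_fun do rewrite big_nil; exact: good0.
by under eq_fun do rewrite big_cons; exact: goodD.
Qed.

Lemma int_sum (J : Type) (s : seq J) (F : J -> V -> R[i]) :
  (forall j, good w (F j)) -> I (fun x => \sum_(j <- s) F j x) = \sum_(j <- s) I (F j).
Proof.
move=> gF; elim: s => [|a s IH].
  by under eq_fun do rewrite big_nil; rewrite big_nil int0.
under eq_fun do rewrite big_cons.
by rewrite (intD spec)// ?big_cons ?IH//; exact: good_sum.
Qed.

Lemma intB f g : good w f -> good w g -> I (fun x => f x - g x) = I f - I g.
Proof.
move=> gf gg; under eq_fun do rewrite -[- g _]mulN1r.
by rewrite (intD spec) ?(intZ spec)// ?mulN1r//; exact: goodZ.
Qed.

Lemma int_bound_gt0 : exists2 K, 0 < K &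
  forall f M, ccont f -> dominated w M f -> normc (I f) <= K * M.
Proof.
have [K HK] := int_bound spec; exists (`|K| + 1) => [|f M cf fM].
  by rewrite ltr_wpDl.
apply: le_trans (HK _ _ cf fM) _; rewrite ler_wpM2r//; first exact: dominated_ge0 fM.
by rewrite (le_trans (ler_norm _))// lerDl.
Qed.

Lemma int_param_cont (U : normedModType R) (F : U * V -> R[i]) M : ccont F ->
  (forall z, normc (F z) <= M * w z.2) -> ccont (fun t => I (fun y => F (t, y))).
Proof.
move=> cF FM; apply: ccont_seq => u p up.
apply: (int_dct spec (M := M)).
- move=> k y; apply: clim_comp (cF _); exact: continuous_pairr.
- move=> y; apply: clim_comp (cF _); exact: continuous_pairr.
- by move=> k y; exact: (FM (u k, y)).
- by move=> y; apply: clim_comp (cF _); exact: cvg_pairl.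
Qed.

End GoodTheory.

(** Joint continuity, from the bilinear estimate [pair_le]. *)
Lemma continuous_pair_of (R : realType) (V : normedModType R) (p : V -> V -> R) :
  pairing_spec p -> continuous (fun z : V * V => p z.1 z.2).
Proof.
move=> sp; have [K [K0 pK]] := pair_le sp => -[a b].
apply/cvgrPdistC_le => e e0.
pose B := `|a| + `|b| + 1.
have B1 : 0 < B by rewrite /B ltr_wpDl ?addr_ge0.
pose r := Num.min 1 (e / (2 * (K * B + 1))).
have KB : 0 <= K * B by rewrite mulr_ge0 ?(ltW B1).
have KB1 : 0 < K * B + 1 by rewrite ltr_wpDl.
have r0 : 0 < r by rewrite /r lt_min ltr01/= divr_gt0// mulr_gt0.
near=> z.
have z1 : `|z.1 - a| <= r.
  near: z; apply: (@cvgr_distC_le _ _ _ _ _ (fun z : V * V => z.1) a _ _ r0); exact: cvg_fst.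
have z2 : `|z.2 - b| <= r.
  near: z; apply: (@cvgr_distC_le _ _ _ _ _ (fun z : V * V => z.2) b _ _ r0); exact: cvg_snd.
have r1 : r <= 1 by rewrite /r ge_min lexx.
have re : (K * B + 1) * r <= e / 2.
  rewrite mulrC -ler_pdivlMr// /r ge_min; apply/orP; right.
  by rewrite invfM mulrA.
have -> : p z.1 z.2 - p (a, b).1 (a, b).2 = p z.1 (z.2 - b) + p b (z.1 - a).
  rewrite /= -[- b]scaleN1r -[- a]scaleN1r !(pairDr sp) !(pairZr sp) !mulN1r.
  rewrite [p b z.1](pairC sp) [p b a](pairC sp); ring.
have hz : `|z.1| <= B.
  rewrite -[z.1](subrK a) (le_trans (ler_normD _ _))// /B.
  have := normr_ge0 b; lra.
have h1 : `|p z.1 (z.2 - b)| <= K * B * r.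
  apply: le_trans (pK _ _) _; apply: ler_pM => //; first by rewrite mulr_ge0.
  by rewrite ler_wpM2l.
have h2 : `|p b (z.1 - a)| <= K * B * r.
  apply: le_trans (pK _ _) _; apply: ler_pM => //; first by rewrite mulr_ge0.
  rewrite ler_wpM2l// /B; have := normr_ge0 a; lra.
apply: le_trans (ler_normD _ _) _.
nra.
Unshelve. all: by end_near. Qed.

Section PairTheory.
Context {R : realType} {V : normedModType R} (p : V -> V -> R) (sp : pairing_spec p).

Lemma pairDl x y z : p (x + y) z = p x z + p y z.
Proof. by rewrite !(pairC sp _ z) (pairDr sp). Qed.

Lemma pairZl s x y : p (s *: x) y = s * p x y.
Proof. by rewrite !(pairC sp _ y) (pairZr sp). Qed.

Lemma pairNr x y : p x (- y) = - p x y.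
Proof. by rewrite -scaleN1r (pairZr sp) mulN1r. Qed.

Lemma pairBr x y z : p x (y - z) = p x y - p x z.
Proof. by rewrite (pairDr sp) pairNr. Qed.

Lemma pair0r x : p x 0 = 0.
Proof. by rewrite -(scale0r x) (pairZr sp) mul0r. Qed.

Lemma continuous_pairing (T : topologicalType) (f g : T -> V) :
  continuous f -> continuous g -> continuous (fun x => p (f x) (g x)).
Proof.
move=> cf cg x.
apply: (@continuous_comp _ _ _ (fun x => (f x, g x)) (fun z => p z.1 z.2)); last exact: continuous_pair_of.
by apply: (@cvg_pair _ _ _ (nbhs x)); [exact: cf|exact: cg].
Qed.

Lemma continuous_pairing_cst (x : V) : continuous (p x).
Proof. by apply: continuous_pairing => y; [exact: cvg_cst|exact: cvg_id]. Qed.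

Lemma continuous_pairing_cstl (x : V) : continuous (p ^~ x).
Proof. by apply: continuous_pairing => y; [exact: cvg_id|exact: cvg_cst]. Qed.

End PairTheory.

Section InversionOnTheLine.
Context {R : realType}.

(** Abel summation: the inversion integral is the limit of the integrals damped
    by [expR (- (eps * `|eta|))], which Fubini turns into convolutions of [f] with
    Poisson kernels. Rescaling by [eps] turns such a convolution into the
    integral of [f (eps *: s + x)] against [2 * wR s], which tends to
    [2 * pi * f x]. *)
Lemma fourier_inversion_R : fourier_inversion (@intR R) wR pairR (2 * pi).
Proof.
have spec := @integral_spec_R R.
move=> f gf gff x; have [cf [M fM]] := gf; have [cff [N ffN]] := gff.
pose eps (k : nat) : R := k.+1%:R^-1.
have eps0 k : 0 < eps k by rewrite invr_gt0.
have eps_lim : eps k @[k --> \oo] --> (0 : R) by exact: cvg_harmonic.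
pose kap (e t : R) : R := expR (- (e * `|t|)).
have ckap e : continuous (kap e : R^o -> R).
  move=> t; apply: continuous_cvg; first exact: continuous_expR.
  by apply: cvgN; apply: cvgM; [exact: cvg_cst|exact: norm_continuous].
have kap1 e t : 0 < e -> normc (kap e t)%:C <= 1.
  move=> e0; rewrite normc_real ger0_norm ?expR_ge0// expR_le1 oppr_le0 mulr_ge0//.
  exact: ltW.
have kapw e : 0 < e -> good wR (fun t => (kap e t)%:C).
  move=> e0; split; first exact/ccont_real.
  have [|t|_ [K HK]] := @tame_expR_abs _ e (cst 1) e0 _ _.
  - by move=> t; exact: cvg_cst.
  - by rewrite normr1.
  by exists K => t; rewrite normc_real; have := HK t; rewrite mulr1.
pose fh := fourier intR pairR f.
pose A k := intR (fun eta => fh eta * expi (pairR eta x) * (kap (eps k) eta)%:C).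
have gfhe : good wR (fun eta => fh eta * expi (pairR eta x)).
  by apply: goodMexpi => //; exact: continuous_pairing_cstl pairing_spec_R x.
have limA : clim \oo A (intR (fun eta => fh eta * expi (pairR eta x))).
  apply: (int_dct spec (M := N)).
  - by move=> k; apply: ccontM; [case: gfhe|exact/ccont_real].
  - by case: gfhe.
  - move=> k t; rewrite !Normc.normcM normc_expi mulr1.
    by rewrite (le_trans _ (ffN t))// ler_piMr ?normc_ge0 ?kap1.
  - move=> t; rewrite -[X in clim _ _ X]mulr1; apply: climM; first exact: clim_cst.
    rewrite -[1]/((1 : R)%:C); apply: clim_real.
    rewrite /kap -[X in _ --> X](@expR0 R); apply: continuous_cvg; first exact: continuous_expR.
    rewrite -oppr0; apply: cvgN; rewrite -[X in _ --> X](mul0r `|t|).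
    by apply: cvgM => //; exact: cvg_cst.
have AE k : A k = intR (fun s => f (eps k *: s + x) * (2 * wR s)%:C).
  rewrite /A /fh /fourier.
  pose F (z : R^o * R^o) := f z.2 * expi (- pairR z.1 z.2) * expi (pairR z.1 x) * (kap (eps k) z.1)%:C.
  have cz1 : continuous (fun z : R^o * R^o => z.1) by move=> z; exact: cvg_fst.
  have cz2 : continuous (fun z : R^o * R^o => z.2) by move=> z; exact: cvg_snd.
  have cF : ccont F.
    apply: ccontM; last by apply: ccont_real => z; apply: (continuous_comp (cz1 z)); exact: ckap.
    apply: ccontM; last first.
      by apply: ccont_expi; apply: (continuous_pairing pairing_spec_R) => // z; exact: cvg_cst.
    apply: ccontM; first exact: ccont_comp.
    apply: ccont_expi => z; apply: cvgN.
    by apply: (continuous_pairing pairing_spec_R).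
  have [_ [K kapK]] := kapw _ (eps0 k).
  have FM (z : R^o * R^o) : normc (F z) <= K * M * wR z.1 * wR z.2.
    rewrite !Normc.normcM !normc_expi !mulr1 mulrC.
    rewrite (_ : K * M * wR z.1 * wR z.2 = (K * wR z.1) * (M * wR z.2)); last by ring.
    by apply: ler_pM; rewrite ?normc_ge0.
  transitivity (intR (fun eta => intR (fun y => F (eta, y)))).
    congr intR; apply/funext => eta.
    rewrite -mulrA mulrC -(intZ spec); last first.
      apply: goodMexpi => // y; apply: cvgN; exact: continuous_pairing_cst pairing_spec_R eta y.
    by congr intR; apply/funext => y; rewrite /F/=; ring.
  rewrite (fubini_R cF FM).
  have kE y : intR (fun eta => F (eta, y)) =
      f y * (2 * eps k / (eps k ^+ 2 + (y - x) ^+ 2))%:C.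
    transitivity (f y * intR (fun t => (expR (- (eps k * `|t|)))%:C * expi (t * (x - y)))).
      rewrite -(intZ spec); last first.
        apply: goodMexpi; first exact: kapw.
        by move=> t; apply: cvgM; [exact: cvg_id|exact: cvg_cst].
      congr intR; apply/funext => eta; rewrite /F/= -!mulrA; congr (_ * _).
      rewrite mulrA -expiD mulrC; congr (_ * expi _); rewrite /pairR; ring.
    rewrite fourier_expR_abs//; congr (_ * (_ / _)%:C).
    by congr (_ + _); ring.
  under eq_fun do rewrite kE.
  have D0 y : 0 < eps k ^+ 2 + y ^+ 2 by rewrite ltr_wpDr ?sqr_ge0// exprn_gt0.
  have ek0 : eps k != 0 by rewrite gt_eqF.
  have kerE y : 2 * eps k / (eps k ^+ 2 + y ^+ 2) <= 2 * eps k * (1 + (eps k ^+ 2)^-1) * wR y.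
    rewrite -[leRHS]mulrA ler_wpM2l//; first by rewrite mulr_ge0// ltW.
    rewrite /wR ler_pdivlMr ?oneDsqr_gt0// mulrC ler_pdivrMr ?D0//.
    rewrite /oneDsqr (_ : _ * _ = 1 + y ^+ 2 + (eps k ^+ 2 + y ^+ 2 / eps k ^+ 2)); last by field.
    by rewrite lerDl; apply: addr_ge0; [exact: sqr_ge0|apply: divr_ge0; exact: sqr_ge0].
  have cker c : ccont (fun y : R^o => (2 * eps k / (eps k ^+ 2 + (y - c) ^+ 2))%:C).
    apply: ccont_real => y; apply: cvgM; first exact: cvg_cst.
    apply: cvgV; first by rewrite gt_eqF.
    apply: cvgD; first exact: cvg_cst.
    apply: (@continuous_comp _ _ _ (fun y : R => y - c) (fun z => z ^+ 2)).
      by apply: cvgB; [exact: cvg_id|exact: cvg_cst].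
    exact: exprn_continuous.
  have ker0 y : 0 <= 2 * eps k / (eps k ^+ 2 + y ^+ 2).
    by rewrite divr_ge0 ?mulr_ge0// ltW.
  have kerb y : normc (2 * eps k / (eps k ^+ 2 + y ^+ 2))%:C <= 2 / eps k.
    rewrite normc_real ger0_norm// ler_pdivrMr//.
    rewrite (_ : _ * (_ + _) = 2 * eps k + 2 * (y ^+ 2 / eps k)); last by field.
    by rewrite lerDl mulr_ge0// divr_ge0 ?sqr_ge0// ltW.
  have gker : good wR (fun y : R^o => (2 * eps k / (eps k ^+ 2 + y ^+ 2))%:C).
    split; first by have := cker 0; under eq_fun do rewrite subr0.
    by exists (2 * eps k * (1 + (eps k ^+ 2)^-1)) => y; rewrite normc_real ger0_norm.
  have g1 : good wR (fun y : R^o => f y * (2 * eps k / (eps k ^+ 2 + (y - x) ^+ 2))%:C).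
    by apply: (goodM gf) => // y; exact: kerb.
  have fM' y : normc (f y) <= M.
    rewrite (le_trans (fM y))// ler_piMr ?wR_le1//.
    exact: (dominated_ge0 spec fM).
  have cshift (c : R) : continuous (fun y : R => c * y + x).
    move=> y; apply: cvgD; last exact: cvg_cst.
    by apply: cvgM; [exact: cvg_cst|exact: cvg_id].
  have g2 : good wR (fun y : R^o => f (y + x) * (2 * eps k / (eps k ^+ 2 + y ^+ 2))%:C).
    under eq_fun do rewrite mulrC.
    apply: (goodM gker) => [|y]; last exact: fM'.
    apply: ccont_comp cf => y.
    by apply: cvgD; [exact: cvg_id|exact: cvg_cst].
  have := int_shift spec (a := x) (f := fun y => f y * (2 * eps k / (eps k ^+ 2 + (y - x) ^+ 2))%:C) g1.
  under eq_fun do rewrite addrK.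
  move=> /(_ g2) <-.
  have g3 : good wR (fun s : R^o => f (eps k *: s + x) *
     (2 * eps k / (eps k ^+ 2 + (eps k *: s) ^+ 2))%:C).
    have -> : (fun s : R^o => f (eps k *: s + x) *
       (2 * eps k / (eps k ^+ 2 + (eps k *: s) ^+ 2))%:C) =
       (fun s => (2 / eps k * wR s)%:C * f (eps k *: s + x)).
      apply/funext => s; rewrite mulrC; congr (_%:C * _).
      rewrite /wR /oneDsqr /GRing.scale/=; field.
      by rewrite ek0 gt_eqF ?(gt_eqF (D0 _))//; exact: oneDsqr_gt0.
    apply: (@goodM _ _ wR _ _ M) => [||s].
    - split.
        apply: ccont_real => s; apply: cvgM; first exact: cvg_cst.
        exact: continuous_oneDsqrV.
      exists (2 / eps k) => s; rewrite normc_real ger0_norm ?lexx//.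
      by rewrite mulr_ge0 ?divr_ge0// ltW ?wR_gt0.
    - by apply: ccont_comp cf => s; exact: cshift.
    - exact: fM'.
  rewrite (int_scale spec (eps0 k) g2 g3) expr1 -(intZ spec _ g3).
  congr intR; apply/funext => s; rewrite mulrCA -rmorphM/=; congr (_ * _%:C).
  rewrite /wR /oneDsqr /GRing.scale/=; field.
  by rewrite gt_eqF ?(gt_eqF (D0 _))//; exact: oneDsqr_gt0.
have limA2 : clim \oo A (intR (fun s => f x * (2 * wR s)%:C)).
  apply: (clim_ext AE).
  have fM' y : normc (f y) <= M.
    rewrite (le_trans (fM y))// ler_piMr ?wR_le1//.
    exact: (dominated_ge0 spec fM).
  have cw : ccont (fun s : R^o => (2 * wR s)%:C).
    apply: ccont_real => s; apply: cvgM; first exact: cvg_cst.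
    exact: continuous_oneDsqrV.
  apply: (int_dct spec (M := M * 2)).
  - move=> k; apply: ccontM => //; apply: ccont_comp cf => s.
    apply: cvgD; last exact: cvg_cst.
    by apply: cvgM; [exact: cvg_cst|exact: cvg_id].
  - by apply: ccontM => // s; exact: clim_cst.
  - move=> k s; have w0 : 0 <= 2 * wR s by apply/ltW/mulr_gt0 => //; exact: wR_gt0.
    by rewrite Normc.normcM normc_real ger0_norm// -mulrA ler_wpM2r.
  - move=> s; apply: climM; last exact: clim_cst.
    apply: (ccont_seqP (u := fun k => eps k *: s + x) cf).
    rewrite -[X in _ --> X]add0r; apply: cvgD; last exact: cvg_cst.
    rewrite -[X in _ --> X](mul0r s); apply: cvgM => //; exact: cvg_cst.
have := clim_unique limA limA2; rewrite -/fh => ->.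
have gw : good wR (fun s : R^o => (wR s)%:C).
  split; first by apply: ccont_real => s; exact: continuous_oneDsqrV.
  by exists 1 => s; rewrite mul1r normc_real ger0_norm// ltW ?wR_gt0.
transitivity (intR (fun s : R^o => (f x * 2%:C) * (wR s)%:C)).
  by congr intR; apply/funext => s; rewrite -mulrA rmorphM.
rewrite (intZ spec)// (_ : intR _ = pi%:C).
  by rewrite rmorphM/= -mulrA mulrC.
rewrite /intR /cintegral/=; apply/eqP; rewrite eq_complex/=; apply/andP; split; apply/eqP.
  by rewrite /Rintegral integral_oneDsqrV.
by rewrite /Rintegral integral0.
Qed.

End InversionOnTheLine.

(** * Products and linear changes of coordinates *)

Section NormProduct.
Context {R : realType} {V1 V2 : normedModType R}.
Implicit Types z : V1 * V2.

Lemma norm_fst_le z : `|z.1| <= `|z|.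
Proof. by rewrite prod_normE le_max lexx. Qed.

Lemma norm_snd_le z : `|z.2| <= `|z|.
Proof. by rewrite prod_normE le_max lexx orbT. Qed.

Lemma norm_pair_le z (e : R) : `|z.1| <= e -> `|z.2| <= e -> `|z| <= e.
Proof. by move=> h1 h2; rewrite prod_normE ge_max h1. Qed.

End NormProduct.

Lemma dominated_lim (R : realType) (V : normedModType R) (w : V -> R) M
    (f_ : nat -> V -> R[i]) f :
  (forall k, dominated w M (f_ k)) -> (forall x, clim \oo (f_ ^~ x) (f x)) ->
  dominated w M f.
Proof.
move=> fM fl x; apply/ler_addgt0Pl => e e0.
have H : normc (f_ k x - f x) @[k --> \oo] --> (0 : R).
  by apply: clim_norm; exact: fl.
have [N _ /(_ N (leqnn N)) /= h] := cvgr_lt _ H _ e0.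
rewrite -[f x](subrK (f_ N x)) (le_trans (le_normcD _ _))// lerD//.
by rewrite -normcN opprB ltW.
exact: fM.
Qed.

Lemma continuous_pair (T U W : topologicalType) (f : T -> U) (g : T -> W) :
  continuous f -> continuous g -> continuous (fun x => (f x, g x)).
Proof. by move=> cf cg x; apply: (@cvg_pair _ _ _ (nbhs x)); [exact: cf|exact: cg]. Qed.

Lemma continuous_fst (T U : topologicalType) : continuous (fst : T * U -> T).
Proof. by move=> x; exact: cvg_fst. Qed.

Lemma continuous_snd (T U : topologicalType) : continuous (snd : T * U -> U).
Proof. by move=> x; exact: cvg_snd. Qed.

Lemma continuous_comp_fun (T U W : topologicalType) (f : T -> U) (g : U -> W) :
  continuous f -> continuous g -> continuous (fun x => g (f x)).
Proof. by move=> cf cg x; apply: (@continuous_comp _ _ _ f g); [exact: cf|exact: cg]. Qed.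

Lemma continuous_cst_fun (T U : topologicalType) (c : U) : continuous (fun _ : T => c).
Proof. by move=> x; exact: cvg_cst. Qed.

Lemma fubiniC (R : realType) (V1 V2 : normedModType R)
  (I1 : (V1 -> R[i]) -> R[i]) (I2 : (V2 -> R[i]) -> R[i]) w1 w2 :
  fubini I1 w1 I2 w2 -> fubini I2 w2 I1 w1.
Proof.
move=> H f M cf fM.
rewrite (H (fun z => f (z.2, z.1)) M)//.
- apply: (ccont_comp (u := fun z : V1 * V2 => (z.2, z.1))) cf => z.
  by apply: (@cvg_pair _ _ _ (nbhs z)); [exact: cvg_snd|exact: cvg_fst].
- by move=> z; rewrite mulrAC; exact: (fM (z.2, z.1)).
Qed.

Section Product.
Context {R : realType} {V1 V2 : normedModType R}.
Local Notation C := R[i].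
Variables (I1 : (V1 -> C) -> C) (w1 : V1 -> R) (n1 : nat) (p1 : V1 -> V1 -> R).
Variables (I2 : (V2 -> C) -> C) (w2 : V2 -> R) (n2 : nat) (p2 : V2 -> V2 -> R).
Hypotheses (s1 : integral_spec I1 w1 n1) (s2 : integral_spec I2 w2 n2).
Hypotheses (sp1 : pairing_spec p1) (sp2 : pairing_spec p2).

Definition int_prod (f : V1 * V2 -> C) : C := I1 (fun x => I2 (fun y => f (x, y))).
Definition weight_prod (z : V1 * V2) : R := w1 z.1 * w2 z.2.
Definition pair_prod (z z' : V1 * V2) : R := p1 z.1 z'.1 + p2 z.2 z'.2.

Lemma slice_cont (f : V1 * V2 -> C) x : ccont f -> ccont (fun y => f (x, y)).
Proof. by apply: ccont_comp; exact: continuous_pairr. Qed.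

Lemma slicel_cont (f : V1 * V2 -> C) y : ccont f -> ccont (fun x => f (x, y)).
Proof. by apply: ccont_comp; exact: continuous_pairl. Qed.

Lemma slice_dominated (f : V1 * V2 -> C) M x : dominated weight_prod M f ->
  dominated w2 (M * w1 x) (fun y => f (x, y)).
Proof. by move=> fM y; rewrite -mulrA; exact: (fM (x, y)). Qed.

Lemma slice_good (f : V1 * V2 -> C) x : good weight_prod f -> good w2 (fun y => f (x, y)).
Proof.
move=> [cf [M fM]]; split; first exact: slice_cont.
by exists (M * w1 x); exact: slice_dominated.
Qed.

Lemma slicel_good (f : V1 * V2 -> C) y : good weight_prod f -> good w1 (fun x => f (x, y)).
Proof.
move=> [cf [M fM]]; split; first exact: slicel_cont.
by exists (M * w2 y) => x; rewrite mulrAC -mulrA; exact: (fM (x, y)).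
Qed.

Lemma weight_prod_gt0 z : 0 < weight_prod z.
Proof. by rewrite mulr_gt0// ?(weight_gt0 s1)// (weight_gt0 s2). Qed.

Lemma dominated_prod_ge0 M f : dominated weight_prod M f -> 0 <= M.
Proof.
move=> /(_ 0) /(le_trans (normc_ge0 _)).
by rewrite pmulr_lge0// weight_prod_gt0.
Qed.

Lemma inner_cont (f : V1 * V2 -> C) M : ccont f -> dominated weight_prod M f ->
  ccont (fun x => I2 (fun y => f (x, y))).
Proof.
move=> cf fM; apply: (int_param_cont s2 (M := M) cf) => z.
rewrite (le_trans (fM z))// ler_wpM2l//; first exact: dominated_prod_ge0 fM.
by rewrite ler_piMl ?(weight_le1 s1)// (weight_ge0 s2).
Qed.

Lemma inner_dominated : exists2 K, 0 < K & forall (f : V1 * V2 -> C) M, ccont f ->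
  dominated weight_prod M f -> dominated w1 (K * M) (fun x => I2 (fun y => f (x, y))).
Proof.
have [K K0 HK] := int_bound_gt0 s2; exists K => // f M cf fM x.
by rewrite -mulrA; apply: HK; [exact: slice_cont|exact: slice_dominated].
Qed.

Lemma inner_good (f : V1 * V2 -> C) : good weight_prod f ->
  good w1 (fun x => I2 (fun y => f (x, y))).
Proof.
move=> [cf [M fM]]; have [K _ HK] := inner_dominated.
by split; [exact: inner_cont fM|exists (K * M); exact: HK].
Qed.

(** Each property of the iterated integral comes from applying the same property
    to the inner and to the outer integral. *)
Lemma integral_spec_prod : integral_spec int_prod weight_prod (n1 + n2).
Proof.
split.
- exact: weight_prod_gt0.
- move=> z; rewrite /weight_prod -[leRHS]mulr1.
  by apply: ler_pM; rewrite ?(weight_le1 s1) ?(weight_le1 s2) ?(weight_ge0 s1) ?(weight_ge0 s2).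
- move=> z; apply: cvgM.
    by apply: (@continuous_comp _ _ _ fst w1); [exact: cvg_fst|exact: (weight_cont s1)].
  by apply: (@continuous_comp _ _ _ snd w2); [exact: cvg_snd|exact: (weight_cont s2)].
- have [m1 [K1 K10 H1]] := weight_decay_pos s1; have [m2 [K2 K20 H2]] := weight_decay_pos s2.
  exists (m1 + m2)%N, (K1 * K2) => -[x y]; rewrite /weight_prod/=.
  rewrite (_ : _ * _ = (K1 * w1 x * (1 + `|(x, y)|) ^+ m1) *
    (K2 * w2 y * (1 + `|(x, y)|) ^+ m2)); last by rewrite exprD; ring.
  have h1 : 1 <= K1 * w1 x * (1 + `|(x, y)|) ^+ m1.
    apply: le_trans (H1 x) _; rewrite ler_wpM2l ?mulr_ge0 ?(weight_ge0 s1)//.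
    rewrite lerXn2r ?nnegrE ?addr_ge0// lerD2l; exact: (norm_fst_le (x, y)).
  have h2 : 1 <= K2 * w2 y * (1 + `|(x, y)|) ^+ m2.
    apply: le_trans (H2 y) _; rewrite ler_wpM2l ?mulr_ge0 ?(weight_ge0 s2)//.
    rewrite lerXn2r ?nnegrE ?addr_ge0// lerD2l; exact: (norm_snd_le (x, y)).
  by rewrite (le_trans h1)// ler_peMr// (le_trans ler01 h1).
- move=> f g gf gg; rewrite /int_prod -(intD s1); try exact: inner_good.
  by congr I1; apply/funext => x; rewrite (intD s2)//; exact: slice_good.
- move=> c f gf; rewrite /int_prod -(intZ s1); last exact: inner_good.
  by congr I1; apply/funext => x; rewrite (intZ s2)//; exact: slice_good.
- have [K1 K10 H1] := int_bound_gt0 s1; have [K2 K20 H2] := inner_dominated.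
  exists (K1 * K2) => f M cf fM; rewrite -mulrA; apply: H1; last exact: H2.
  exact: inner_cont fM.
- move=> f_ f M cf_ cf fM_ fl.
  have fM := dominated_lim fM_ fl.
  have [K2 K20 H2] := inner_dominated.
  apply: (int_dct s1 (M := K2 * M)).
  + by move=> k; exact: inner_cont (fM_ k).
  + exact: inner_cont fM.
  + by move=> k; exact: H2.
  + move=> x; apply: (int_dct s2 (M := M * w1 x)).
    * by move=> k; exact: slice_cont.
    * exact: slice_cont.
    * by move=> k; exact: slice_dominated.
    * by move=> y; exact: fl.
- move=> [a b] f gf gfa; rewrite /int_prod.
  have inner x : I2 (fun y => f ((x, y) + (a, b))) = I2 (fun y => f (x + a, y)).
    apply: (int_shift s2 (a := b) (f := fun y => f (x + a, y))).
      exact: slice_good.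
    exact: (slice_good x gfa).
  under eq_fun do rewrite inner.
  rewrite (int_shift s1 (a := a) (f := fun x => I2 (fun y => f (x, y))))//.
    exact: inner_good.
  by have := inner_good gfa; under eq_fun do rewrite inner.
- move=> c f c0 gf gfc; rewrite /int_prod.
  have gs x : good w2 (fun y => f (x, c *: y)).
    have := slice_good (c^-1 *: x) gfc.
    rewrite (_ : (fun y => _) = (fun y => f (x, c *: y)))//.
    apply/funext => y; congr f; rewrite /GRing.scale/=.
    by congr pair; rewrite scalerA divff ?scale1r// gt_eqF.
  have inner x : I2 (fun y => f (x, y)) = (c ^+ n2)%:C * I2 (fun y => f (x, c *: y)).
    by apply: (int_scale s2) => //; exact: slice_good.
  have gin := inner_good gfc.
  rewrite (int_scale s1 c0 (inner_good gf)); last first.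
    under eq_fun do rewrite inner; exact: goodZ.
  under eq_fun do rewrite inner.
  by rewrite (intZ s1)// mulrA -rmorphM/= -exprD.
Qed.

Lemma pairing_spec_prod : pairing_spec pair_prod.
Proof.
split.
- by move=> x y; rewrite /pair_prod (pairC sp1) (pairC sp2).
- by move=> x y z; rewrite /pair_prod (pairDr sp1) (pairDr sp2) addrACA.
- by move=> s x y; rewrite /pair_prod (pairZr sp1) (pairZr sp2) mulrDr.
- have [K1 [K10 H1]] := pair_le sp1; have [K2 [K20 H2]] := pair_le sp2.
  exists (K1 + K2); split; first exact: addr_ge0.
  move=> x y; rewrite mulrDl mulrDl (le_trans (ler_normD _ _))//.
  apply: lerD; [apply: le_trans (H1 _ _) _|apply: le_trans (H2 _ _) _].
  + apply: ler_pM; rewrite ?mulr_ge0//; last exact: norm_fst_le.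
    by rewrite ler_wpM2l//; exact: norm_fst_le.
  + apply: ler_pM; rewrite ?mulr_ge0//; last exact: norm_snd_le.
    by rewrite ler_wpM2l//; exact: norm_snd_le.
- have [v1 H1] := pair_coercive sp1; have [v2 H2] := pair_coercive sp2.
  exists ([seq (v, 0) | v <- v1] ++ [seq (0, v) | v <- v2]) => z.
  rewrite big_cat/= !big_map /pair_prod/=.
  under eq_bigr do rewrite (pair0r sp2) addr0.
  under [X in _ <= _ + X]eq_bigr do rewrite (pair0r sp1) add0r.
  apply: norm_pair_le.
  + by rewrite (le_trans (H1 _))// lerDl sumr_ge0.
  + by rewrite (le_trans (H2 _))// lerDr sumr_ge0.
Qed.

Lemma partial_fourier_good (f : V1 * V2 -> C) e2 : good weight_prod f ->
  good w1 (fun x => fourier I2 p2 (fun y => f (x, y)) e2).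
Proof.
move=> gf; apply: (@inner_good (fun z => f z * expi (- p2 e2 z.2))).
apply: goodMexpi => // z; apply: cvgN.
by apply: (@continuous_comp _ _ _ snd (p2 e2)); [exact: cvg_snd|exact: continuous_pairing_cst].
Qed.

Lemma fourier_prodE (f : V1 * V2 -> C) e1 e2 : good weight_prod f ->
  fourier int_prod pair_prod f (e1, e2) =
  fourier I1 p1 (fun x => fourier I2 p2 (fun y => f (x, y)) e2) e1.
Proof.
move=> gf; rewrite /fourier /int_prod; congr I1; apply/funext => x.
rewrite mulrC -(intZ s2); last first.
  apply: goodMexpi; first exact: slice_good.
  by move=> y; apply: cvgN; exact: continuous_pairing_cst.
congr I2; apply/funext => y; rewrite /pair_prod/= mulrCA -expiD; congr (_ * expi _).
by rewrite opprD.
Qed.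

(** The transform in both groups of variables is, in the first group, the
    transform of the partial transform, to which inversion applies. *)
Lemma partial_inversion c1 (f : V1 * V2 -> C) x e2 : fourier_inversion I1 w1 p1 c1 ->
  good weight_prod f -> good weight_prod (fourier int_prod pair_prod f) ->
  I1 (fun e1 => fourier int_prod pair_prod f (e1, e2) * expi (p1 e1 x)) =
  c1%:C * fourier I2 p2 (fun y => f (x, y)) e2.
Proof.
move=> inv1 gf gff.
have E : fourier I1 p1 (fun x => fourier I2 p2 (fun y => f (x, y)) e2) =
  (fun e1 => fourier int_prod pair_prod f (e1, e2)).
  by apply/funext => e1; rewrite fourier_prodE.
have := inv1 _ (partial_fourier_good e2 gf); rewrite E => /(_ (slicel_good e2 gff) x) <-.
by [].
Qed.

(** Fubini brings the integral over the first frequency inside, where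
    [partial_inversion] applies; what remains is inversion in the second group.
    The partial transform of [f] is integrable because it is [c1^-1] times
    that inner integral. *)
Lemma fourier_inversion_prod c1 c2 : fubini I1 w1 I2 w2 ->
  fourier_inversion I1 w1 p1 c1 -> fourier_inversion I2 w2 p2 c2 -> c1 != 0 ->
  fourier_inversion int_prod weight_prod pair_prod (c1 * c2).
Proof.
move=> fub inv1 inv2 c10 f gf gff [x1 x2].
have [cf [M fM]] := gf; have [cff [N ffN]] := gff.
pose F2 x eta := fourier I2 p2 (fun y => f (x, y)) eta.
have gH : good weight_prod (fun z => fourier int_prod pair_prod f z * expi (p1 z.1 x1)).
  apply: goodMexpi => // z.
  apply: (@continuous_comp _ _ _ fst (p1 ^~ x1)); first exact: cvg_fst.
  exact: continuous_pairing_cstl.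
have cp2l : continuous (fun z : V1 * V2 => p2 z.2 x2).
  move=> z; apply: (@continuous_comp _ _ _ snd (p2 ^~ x2)); first exact: cvg_snd.
  exact: continuous_pairing_cstl.
transitivity (I1 (fun e1 => I2 (fun e2 =>
   fourier int_prod pair_prod f (e1, e2) * expi (p1 e1 x1) * expi (p2 e2 x2)))).
  rewrite /int_prod; congr I1; apply/funext => e1; congr I2; apply/funext => e2.
  by rewrite /pair_prod/= expiD mulrA.
rewrite (fub (fun z => fourier int_prod pair_prod f z * expi (p1 z.1 x1) * expi (p2 z.2 x2)) N); last 2 first.
- by apply: ccontM; [case: gH|exact: ccont_expi].
- by move=> z; rewrite !Normc.normcM !normc_expi !mulr1 -mulrA; exact: ffN.
have innerE e2 : I1 (fun e1 => fourier int_prod pair_prod f (e1, e2) * expi (p1 e1 x1)) =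
    c1%:C * F2 x1 e2 by exact: partial_inversion.
have gin : good w2 (fun e2 => c1%:C * F2 x1 e2).
  have cc : ccont (fun e2 => I1 (fun e1 => fourier int_prod pair_prod f (e1, e2) * expi (p1 e1 x1))).
    apply: (int_param_cont s1 (M := N) (F := fun z : V2 * V1 =>
      fourier int_prod pair_prod f (z.2, z.1) * expi (p1 z.2 x1))).
      have [cH _] := gH; apply: (ccont_comp (u := fun z : V2 * V1 => (z.2, z.1))) cH => z.
      by apply: (@cvg_pair _ _ _ (nbhs z)); [exact: cvg_snd|exact: cvg_fst].
    move=> z; rewrite Normc.normcM normc_expi mulr1.
    rewrite (le_trans (ffN (z.2, z.1)))// ler_wpM2l//; first exact: dominated_prod_ge0 ffN.
    by rewrite /weight_prod ler_piMr ?(weight_le1 s2)// (weight_ge0 s1).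
  split; first by under eq_fun do rewrite -innerE.
  have [K1 K10 HK] := int_bound_gt0 s1; exists (K1 * N) => e2; rewrite -innerE -mulrA.
  apply: HK; first by have [cH _] := gH; exact: slicel_cont cH.
  move=> e1; rewrite Normc.normcM normc_expi mulr1 mulrAC -mulrA; exact: (ffN (e1, e2)).
transitivity (I2 (fun e2 => c1%:C * (F2 x1 e2 * expi (p2 e2 x2)))).
  congr I2; apply/funext => e2; rewrite mulrA -innerE mulrC -(intZ s1); last exact: slicel_good gH.
  by congr I1; apply/funext => e1; rewrite /= mulrC.
have c1C : (c1%:C : C) != 0 by rewrite eq_complex/= eqxx andbT.
have gF2' : good w2 (F2 x1).
  have := goodZ (c1%:C)^-1 gin.
  by under eq_fun do rewrite mulKf//.
rewrite (intZ s2); last by apply: goodMexpi => //; exact: continuous_pairing_cstl.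
rewrite inv2//; last exact: slice_good.
by rewrite mulrA -rmorphM.
Qed.

(** Exchanging an integral with an iterated integral, one variable at a time. *)
Lemma fubini_prodl (V3 : normedModType R) (I3 : (V3 -> C) -> C) (w3 : V3 -> R) n3 :
  integral_spec I3 w3 n3 -> fubini I1 w1 I3 w3 -> fubini I2 w2 I3 w3 ->
  fubini int_prod weight_prod I3 w3.
Proof.
move=> s3 f13 f23 f M cf fM; rewrite /int_prod.
have M0 : 0 <= M.
  have := le_trans (normc_ge0 _) (fM 0).
  by rewrite pmulr_lge0 ?(weight_gt0 s3)// pmulr_lge0// weight_prod_gt0.
have inner x : I2 (fun y => I3 (fun t => f ((x, y), t))) =
               I3 (fun t => I2 (fun y => f ((x, y), t))).
  apply: (f23 (fun z => f ((x, z.1), z.2)) (M * w1 x)).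
    apply: (ccont_comp (u := fun z : V2 * V3 => ((x, z.1), z.2))) cf.
    apply: (continuous_pair (f := fun z : V2 * V3 => (x, z.1))); last exact: continuous_snd.
    exact: (continuous_pair (@continuous_cst_fun _ _ x) (@continuous_fst _ _)).
  by move=> z; have := fM ((x, z.1), z.2); rewrite /weight_prod/= !mulrA.
under eq_fun do rewrite inner.
have [K2 K20 HK] := int_bound_gt0 s2.
have cre : continuous (fun z : (V1 * V3) * V2 => ((z.1.1, z.2), z.1.2) : (V1 * V2) * V3).
  apply: (continuous_pair (f := fun z : (V1 * V3) * V2 => (z.1.1, z.2))); last first.
    exact: (continuous_comp_fun (@continuous_fst _ _) (@continuous_snd _ _)).
  exact: (continuous_pair (continuous_comp_fun (@continuous_fst _ _) (@continuous_fst _ _))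
    (@continuous_snd _ _)).
apply: (f13 (fun z => I2 (fun y => f ((z.1, y), z.2))) (K2 * M)).
  apply: (int_param_cont s2 (M := M) (F := fun z : (V1 * V3) * V2 => f ((z.1.1, z.2), z.1.2))).
    exact: ccont_comp cre cf.
  move=> z; rewrite (le_trans (fM _))// /weight_prod/=.
  rewrite -mulrA ler_wpM2l// mulrAC ler_piMl ?(weight_ge0 s2)//.
  rewrite -[leRHS]mulr1; apply: ler_pM;
    by rewrite ?(weight_ge0 s1) ?(weight_ge0 s3) ?(weight_le1 s1) ?(weight_le1 s3).
move=> z; rewrite -!mulrA; apply: HK.
  apply: (ccont_comp (u := fun y : V2 => (z, y)) _ (ccont_comp cre cf)).
  exact: continuous_pairr.
move=> y; rewrite (le_trans (fM _))// /weight_prod/= le_eqVlt; apply/orP; left; apply/eqP; ring.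
Qed.

End Product.

(** Change of coordinates by a linear isometry [psi] with inverse [phi]. *)
Section Transport.
Context {R : realType} {V1 V2 : normedModType R}.
Local Notation C := R[i].
Variables (psi : V1 -> V2) (phi : V2 -> V1).
Hypotheses (psiK : cancel psi phi) (phiK : cancel phi psi).
Hypotheses (psiD : {morph psi : x y / x + y}) (psiZ : forall c, {morph psi : x / c *: x}).
Hypotheses (phiD : {morph phi : x y / x + y}) (phiZ : forall c, {morph phi : x / c *: x}).
Hypotheses (psi_norm : forall x, `|psi x| <= `|x|) (phi_norm : forall y, `|phi y| <= `|y|).
Variables (I : (V1 -> C) -> C) (w : V1 -> R) (n : nat) (p : V1 -> V1 -> R).

Definition int_transport (f : V2 -> C) : C := I (f \o psi).
Definition weight_transport : V2 -> R := w \o phi.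
Definition pair_transport (y y' : V2) : R := p (phi y) (phi y').

Lemma contraction_continuous (U W : normedModType R) (h : U -> W) :
  {morph h : x y / x + y} -> (forall c, {morph h : x / c *: x}) ->
  (forall x, `|h x| <= `|x|) -> continuous h.
Proof.
move=> hD hZ hn x; apply/cvgrPdistC_le => e e0.
near=> y; have -> : h y - h x = h (y - x) by rewrite -[- x]scaleN1r hD hZ scaleN1r.
rewrite (le_trans (hn _))//; near: y.
Unshelve. all: by end_near. Qed.

Let cpsi : continuous psi. Proof. exact: contraction_continuous. Qed.
Let cphi : continuous phi. Proof. exact: contraction_continuous. Qed.

Lemma good_transport f : good weight_transport f -> good w (f \o psi).
Proof.
move=> [cf [M fM]]; split; first exact: ccont_comp.
by exists M => x; have := fM (psi x); rewrite /weight_transport/= psiK.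
Qed.

Lemma integral_spec_transport : integral_spec I w n ->
  integral_spec int_transport weight_transport n.
Proof.
move=> s; split.
- by move=> x; exact: (weight_gt0 s).
- by move=> x; exact: (weight_le1 s).
- by move=> x; apply: (@continuous_comp _ _ _ phi w); [exact: cphi|exact: (weight_cont s)].
- have [m [K K0 H]] := weight_decay_pos s; exists m, K => x; rewrite (le_trans (H (phi x)))//.
  rewrite ler_wpM2l ?mulr_ge0 ?(weight_ge0 s)// lerXn2r ?nnegrE ?addr_ge0//.
  by rewrite lerD2l.
- by move=> f g gf gg; rewrite /int_transport -(intD s)//; exact: good_transport.
- by move=> c f gf; rewrite /int_transport -(intZ s)//; exact: good_transport.
- have [K HK] := int_bound s; exists K => f M cf fM; apply: HK; first exact: ccont_comp.
  by move=> x; have := fM (psi x); rewrite /weight_transport/= psiK.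
- move=> f_ f M cf_ cf fM fl; apply: (int_dct s (M := M)).
  + by move=> k; exact: ccont_comp.
  + exact: ccont_comp.
  + by move=> k x; have := fM k (psi x); rewrite /weight_transport/= psiK.
  + by move=> x; exact: fl.
- move=> a f gf gfa; rewrite /int_transport -(int_shift s (a := phi a) (f := f \o psi)).
  + by congr I; apply/funext => x; rewrite /= psiD phiK.
  + exact: good_transport.
  + have := good_transport gfa.
    rewrite (_ : _ \o psi = (fun x => (f \o psi) (x + phi a)))//.
    by apply/funext => x; rewrite /= psiD phiK.
- move=> c f c0 gf gfc.
  have E : (fun x => f (c *: x)) \o psi = (fun x => (f \o psi) (c *: x)).
    by apply/funext => x; rewrite /= psiZ.
  rewrite /int_transport E (int_scale s c0)//; first exact: good_transport.
  by rewrite -E; exact: good_transport.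
Qed.

Lemma pairing_spec_transport : pairing_spec p -> pairing_spec pair_transport.
Proof.
move=> sp; split.
- by move=> x y; exact: (pairC sp).
- by move=> x y z; rewrite /pair_transport phiD (pairDr sp).
- by move=> c x y; rewrite /pair_transport phiZ (pairZr sp).
- have [K [K0 H]] := pair_le sp; exists K; split => // x y; rewrite (le_trans (H _ _))//.
  by apply: ler_pM; rewrite ?mulr_ge0// ler_wpM2l.
- have [vs H] := pair_coercive sp; exists (map psi vs) => x.
  rewrite big_map -[x in leLHS]phiK (le_trans (psi_norm _))// (le_trans (H _))//.
  by apply: ler_sum => v _; rewrite /pair_transport psiK.
Qed.

Lemma fourier_inversion_transport c : fourier_inversion I w p c ->
  fourier_inversion int_transport weight_transport pair_transport c.
Proof.
move=> inv f gf gff x.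
have E : fourier int_transport pair_transport f \o psi = fourier I p (f \o psi).
  apply/funext => eta; rewrite /fourier /int_transport/=; congr I.
  by apply/funext => y; rewrite /= /pair_transport !psiK.
have := inv _ (good_transport gf) _ (phi x); rewrite /= phiK => <-; last first.
  by rewrite -E; exact: good_transport.
by rewrite -E; congr I; apply/funext => eta; rewrite /= /pair_transport psiK.
Qed.

Lemma fubini_transport (V3 : normedModType R) (I3 : (V3 -> C) -> C) (w3 : V3 -> R) :
  fubini I w I3 w3 -> fubini int_transport weight_transport I3 w3.
Proof.
move=> H f M cf fM; rewrite /int_transport.
apply: (H (fun z => f (psi z.1, z.2)) M).
  apply: (ccont_comp (u := fun z : V1 * V3 => (psi z.1, z.2))) cf.
  exact: (continuous_pair (continuous_comp_fun (@continuous_fst _ _) cpsi) (@continuous_snd _ _)).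
by move=> z; have := fM (psi z.1, z.2); rewrite /weight_transport/= psiK.
Qed.

End Transport.

(** * The integral over the space of row vectors *)

Section RowVectors.
Context {R : realType}.

Lemma row_entry_le n (x : 'rV[R]_n) j : `|x 0 j| <= `|x|.
Proof.
rewrite [leRHS]/Num.Def.normr/= mx_normrE; apply/bigmax_geP; right => /=.
by exists (0, j).
Qed.

Lemma row_norm_le n (x : 'rV[R]_n) e : 0 <= e -> (forall j, `|x 0 j| <= e) -> `|x| <= e.
Proof.
move=> e0 H; rewrite [leLHS]/Num.Def.normr/= mx_normrE (bigmax_le _ e0)//= => -[i j] _ /=.
by rewrite ord1.
Qed.

(** A row vector of length [n.+1] is a pair of a real number and a row vector of
    length [n], for the supremum norms: this reduces row vectors to products. *)
Section Step.
Variable n : nat.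

Definition row_cons (z : R^o * 'rV[R]_n) : 'rV[R]_n.+1 :=
  row_mx (z.1%:M : 'rV[R]_1) z.2 : 'rV[R]_(1 + n).
Definition row_uncons (x : 'rV[R]_n.+1) : R^o * 'rV[R]_n :=
  (x 0 0, rsubmx (x : 'rV[R]_(1 + n))).

Lemma row_cons0 z : row_cons z 0 0 = z.1.
Proof.
have := row_mxEl (z.1%:M : 'rV[R]_1) z.2 0 0; rewrite [RHS]mxE eqxx mulr1n => <-.
by rewrite /row_cons; congr (fun_of_matrix _ _ _); exact/val_inj.
Qed.

Lemma row_consS z (j : 'I_n) : row_cons z 0 (lift 0 j) = z.2 0 j.
Proof.
rewrite -(row_mxEr (z.1%:M : 'rV[R]_1) z.2 0 j) /row_cons.
by congr (fun_of_matrix _ _ _); exact/val_inj.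
Qed.

Lemma row_unconsS x (j : 'I_n) : (row_uncons x).2 0 j = x 0 (lift 0 j).
Proof. by rewrite mxE; congr (x _ _); exact/val_inj. Qed.

Lemma row_consK : cancel row_cons row_uncons.
Proof.
case=> t y; congr pair; first exact: (row_cons0 (t, y)).
by rewrite /row_cons row_mxKr.
Qed.

Lemma row_unconsK : cancel row_uncons row_cons.
Proof.
move=> x; apply/rowP => j; have [k ->|->] := unliftP 0 j.
  by rewrite row_consS row_unconsS.
by rewrite row_cons0.
Qed.

Lemma row_unconsD : {morph row_uncons : x y / x + y}.
Proof. by move=> x y; congr pair; [rewrite mxE|apply/rowP => j; rewrite !mxE]. Qed.

Lemma row_unconsZ c : {morph row_uncons : x / c *: x}.
Proof. by move=> x; congr pair; [rewrite mxE|apply/rowP => j; rewrite !mxE]. Qed.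

Lemma row_consD : {morph row_cons : x y / x + y}.
Proof. by move=> x y; apply: (can_inj row_unconsK); rewrite row_unconsD !row_consK. Qed.

Lemma row_consZ c : {morph row_cons : x / c *: x}.
Proof. by move=> x; apply: (can_inj row_unconsK); rewrite row_unconsZ !row_consK. Qed.

Lemma row_cons_norm z : `|row_cons z| <= `|z|.
Proof.
apply: row_norm_le => // j; have [k ->|->] := unliftP 0 j.
  by rewrite row_consS (le_trans (row_entry_le _ _))// norm_snd_le.
by rewrite row_cons0 norm_fst_le.
Qed.

Lemma row_uncons_norm x : `|row_uncons x| <= `|x|.
Proof.
apply: norm_pair_le; first exact: row_entry_le.
by apply: row_norm_le => // j; rewrite row_unconsS row_entry_le.
Qed.

Lemma dotrV_uncons : @dotrV R n.+1 = pair_transport row_uncons (pair_prod pairR (@dotrV R n)).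
Proof.
apply/funext => x; apply/funext => y; rewrite /dotrV big_ord_recl.
congr (_ + _); apply: eq_bigr => j _; by rewrite !row_unconsS.
Qed.

End Step.

Fixpoint weight_rV (n : nat) : 'rV[R]_n -> R :=
  match n with
  | 0 => fun=> 1
  | n'.+1 => weight_transport (@row_uncons n') (weight_prod wR (@weight_rV n'))
  end.

Lemma integral_rVS n : @integral_rV R n.+1 =
  int_transport (@row_cons n) (int_prod (@intR R) (@integral_rV R n)).
Proof. by []. Qed.

Lemma rV0_eq0 (x : 'rV[R]_0) : x = 0.
Proof. by apply/rowP => -[]. Qed.

Lemma integral_spec_rV n : integral_spec (@integral_rV R n) (@weight_rV n) n.
Proof.
elim: n => [|n IH].
  split => //=.
  - exact: continuous_cst_fun.
  - by exists 0%N, 1 => x; rewrite expr0 !mulr1.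
  - by exists 1 => f M cf fM; rewrite mul1r; have := fM 0; rewrite /= mulr1.
  - by move=> a f _ _; rewrite (rV0_eq0 (0 + a)).
  - by move=> c f c0 _ _; rewrite expr0 mul1r scaler0.
rewrite integral_rVS; apply: integral_spec_transport (integral_spec_prod (@integral_spec_R R) IH).
- exact: row_consK.
- exact: row_unconsK.
- exact: row_consD.
- exact: row_consZ.
- exact: row_unconsD.
- exact: row_unconsZ.
- exact: row_cons_norm.
- exact: row_uncons_norm.
Qed.

Lemma pairing_spec_dotrV n : pairing_spec (@dotrV R n).
Proof.
elim: n => [|n IH].
  have d0 (x y : 'rV[R]_0) : dotrV x y = 0 by rewrite /dotrV big_ord0.
  split=> //.
  - by move=> x y; rewrite !d0.
  - by move=> x y z; rewrite !d0 addr0.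
  - by move=> c x y; rewrite !d0 mulr0.
  - by exists 0; split => // x y; rewrite d0 normr0 !mul0r.
  - by exists [::] => x; rewrite big_nil (rV0_eq0 x) normr0.
rewrite dotrV_uncons; apply: pairing_spec_transport (pairing_spec_prod (@pairing_spec_R R) IH).
- exact: row_consK.
- exact: row_unconsK.
- exact: row_unconsD.
- exact: row_unconsZ.
- exact: row_cons_norm.
- exact: row_uncons_norm.
Qed.

Lemma fubini_rV_R n : fubini (@integral_rV R n) (@weight_rV n) (@intR R) wR.
Proof.
elim: n => [|n IH].
  by move=> f M cf fM.
rewrite integral_rVS.
apply: fubini_transport.
- exact: row_consK.
- exact: row_consD.
- exact: row_consZ.
- exact: row_cons_norm.
- apply: fubini_prodl.
  + exact: integral_spec_R.
  + exact: integral_spec_rV.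
  + exact: integral_spec_R.
  + exact: fubini_R.
  + exact: IH.
Qed.

Lemma fubini_rV n m : fubini (@integral_rV R n) (@weight_rV n) (@integral_rV R m) (@weight_rV m).
Proof.
elim: n => [|n IH].
  by move=> f M cf fM.
rewrite integral_rVS.
apply: fubini_transport.
- exact: row_consK.
- exact: row_consD.
- exact: row_consZ.
- exact: row_cons_norm.
- apply: fubini_prodl.
  + exact: integral_spec_R.
  + exact: integral_spec_rV.
  + exact: integral_spec_rV.
  + by apply: fubiniC; exact: fubini_rV_R.
  + exact: IH.
Qed.

Lemma fourier_inversion_rV n :
  fourier_inversion (@integral_rV R n) (@weight_rV n) (@dotrV R n) ((2 * pi) ^+ n).
Proof.
elim: n => [|n IH].
  move=> f gf gff x; rewrite /fourier/= expr0 mul1r (rV0_eq0 x).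
  by rewrite /dotrV big_ord0 oppr0 expi0 !mulr1.
rewrite dotrV_uncons integral_rVS exprS; apply: fourier_inversion_transport.
- exact: row_consK.
- exact: row_unconsK.
- exact: row_consD.
- exact: row_consZ.
- exact: row_cons_norm.
- apply: fourier_inversion_prod => //.
  + exact: integral_spec_R.
  + exact: integral_spec_rV.
  + exact: pairing_spec_R.
  + exact: pairing_spec_dotrV.
  + by apply: fubiniC; exact: fubini_rV_R.
  + exact: fourier_inversion_R.
  + by rewrite mulf_neq0// ?pnatr_eq0// gt_eqF// pi_gt0.
Qed.

End RowVectors.

(** Phase space carries the product of two such integrals. *)
Section PhaseSpace.
Context {R : realType} {d : nat}.

Definition int_phase : ('rV[R]_d * 'rV[R]_d -> R[i]) -> R[i] :=
  int_prod (@integral_rV R d) (@integral_rV R d).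
Definition weight_phase : 'rV[R]_d * 'rV[R]_d -> R :=
  weight_prod (@weight_rV R d) (@weight_rV R d).
Definition dot_phase : 'rV[R]_d * 'rV[R]_d -> 'rV[R]_d * 'rV[R]_d -> R :=
  pair_prod (@dotrV R d) (@dotrV R d).

Lemma integral_spec_phase : integral_spec int_phase weight_phase (d + d).
Proof. by apply: integral_spec_prod; exact: integral_spec_rV. Qed.

Lemma pairing_spec_phase : pairing_spec dot_phase.
Proof. by apply: pairing_spec_prod; exact: pairing_spec_dotrV. Qed.

Lemma fubini_phase : fubini int_phase weight_phase int_phase weight_phase.
Proof.
have h : fubini (@integral_rV R d) (@weight_rV R d) int_phase weight_phase.
  apply: fubiniC; apply: fubini_prodl; try exact: integral_spec_rV; exact: fubini_rV.
by apply: fubini_prodl => //; try exact: integral_spec_rV; exact: integral_spec_phase.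
Qed.

Lemma fourier_inversion_phase :
  fourier_inversion int_phase weight_phase dot_phase ((2 * pi) ^+ d * (2 * pi) ^+ d).
Proof.
apply: fourier_inversion_prod; try exact: integral_spec_rV; try exact: pairing_spec_dotrV;
  try exact: fourier_inversion_rV; first exact: fubini_rV.
by rewrite expf_neq0// mulf_neq0// ?pnatr_eq0// gt_eqF// pi_gt0.
Qed.

End PhaseSpace.

(** * Directional derivatives of complex-valued functions *)

Section Deriv.
Context {R : realType} {V : normedModType R}.
Local Notation C := R[i].
Implicit Types (f g : V -> C) (v x : V) (l : C).

(** Existence and value of the derivative in one relation, as a limit of complex
    difference quotients. *)
Definition has_cderive v f x l :=
  clim (0^' : set_system R) (fun h : R => (h^-1)%:C * (f (h *: v + x) - f x)) l.

Lemma Re_realM (r : R) (z : C) : complex.Re (r%:C * z) = r * complex.Re z.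
Proof. by rewrite complexReM /= mul0r subr0. Qed.

Lemma Im_realM (r : R) (z : C) : complex.Im (r%:C * z) = r * complex.Im z.
Proof. by rewrite complexImM /= mul0r addr0. Qed.

Lemma has_cderive_derivable v f x l : has_cderive v f x l ->
  [/\ derivable (re_part f) x v, derivable (im_part f) x v & cderive v f x = l].
Proof.
move=> [hr hi].
have hr' : (fun h : R => h^-1 *: (re_part f (h *: v + x) - re_part f x)) @ 0^' --> complex.Re l.
  by move: hr; under eq_fun do rewrite Re_realM raddfB.
have hi' : (fun h : R => h^-1 *: (im_part f (h *: v + x) - im_part f x)) @ 0^' --> complex.Im l.
  by move: hi; under eq_fun do rewrite Im_realM raddfB.
split; [by apply/cvg_ex; eexists; exact: hr'|by apply/cvg_ex; eexists; exact: hi'|].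
rewrite /cderive /derive (cvg_lim _ hr')// (cvg_lim _ hi')//.
by case: (l).
Qed.

Lemma derivable_has_cderive v f x : derivable (re_part f) x v ->
  derivable (im_part f) x v -> has_cderive v f x (cderive v f x).
Proof.
move=> dr di; split => /=.
- under eq_fun do rewrite Re_realM raddfB; exact: dr.
- under eq_fun do rewrite Im_realM raddfB; exact: di.
Qed.

Lemma has_cderive_val v f x l : has_cderive v f x l -> cderive v f x = l.
Proof. by case/has_cderive_derivable. Qed.

Lemma has_cderive_fun v f g : (forall x, has_cderive v f x (g x)) -> cderive v f = g.
Proof. by move=> H; apply/funext => x; exact: has_cderive_val. Qed.

Lemma has_cderiveD v f g x l m : has_cderive v f x l -> has_cderive v g x m ->
  has_cderive v (fun y => f y + g y) x (l + m).
Proof.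
move=> hf hg; apply: clim_ext (climD hf hg) => h.
by rewrite -mulrDr opprD addrACA.
Qed.

Lemma has_cderiveZ v c f x l : has_cderive v f x l ->
  has_cderive v (fun y => c * f y) x (c * l).
Proof.
move=> hf; apply: clim_ext (climZ c hf) => h.
by rewrite -mulrBr mulrCA.
Qed.

Lemma has_cderive_cst v c x : has_cderive v (fun=> c) x 0.
Proof. by apply: clim_ext (clim_cst 0) => h; rewrite subrr mulr0. Qed.

Lemma has_cderive_continuous v f x l : has_cderive v f x l ->
  clim (0^' : set_system R) (fun h : R => f (h *: v + x)) (f x).
Proof.
move=> hf.
have h0 : clim (0^' : set_system R) (fun h : R => h%:C) 0.
  by apply: clim_real; exact: nbhs_dnbhs.
have := climD (climM h0 hf) (clim_cst (f x)).
rewrite mul0r add0r => H.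
have E : \forall h \near (0^' : set_system R),
   f (h *: v + x) = h%:C * ((h^-1)%:C * (f (h *: v + x) - f x)) + f x.
  near=> h; rewrite mulrA -rmorphM/= divff; first by rewrite mul1r subrK.
  by near: h; exact: nbhs_dnbhs_neq.
case: H => H1 H2; split.
- by apply: cvg_trans H1; apply: near_eq_cvg; near=> h; rewrite [in RHS](near E h).
- by apply: cvg_trans H2; apply: near_eq_cvg; near=> h; rewrite [in RHS](near E h).
Unshelve. all: by end_near. Qed.

Lemma has_cderiveM v f g x l m : has_cderive v f x l -> has_cderive v g x m ->
  has_cderive v (fun y => f y * g y) x (l * g x + f x * m).
Proof.
move=> hf hg.
apply: clim_ext (climD (climM hf (has_cderive_continuous hg)) (climM (clim_cst (f x)) hg)) => h.
ring.
Qed.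

Lemma has_cderive_affine v f x l : (forall h : R, f (h *: v + x) = f x + h%:C * l) ->
  has_cderive v f x l.
Proof.
move=> fa.
have E : \forall h \near (0^' : set_system R), (h^-1)%:C * (f (h *: v + x) - f x) = l.
  near=> h; rewrite fa addrC addKr mulrA -rmorphM/= mulVf ?mul1r//.
  by near: h; exact: nbhs_dnbhs_neq.
split; apply: cvg_near_cst; near=> h; by rewrite (near E h).
Unshelve. all: by end_near. Qed.

Lemma has_cderive_expi v (r : V -> R) x (s : R) : (forall h : R, r (h *: v + x) = r x + h * s) ->
  has_cderive v (fun y => expi (r y)) x ('i * s%:C * expi (r x)).
Proof.
move=> ra.
have dl : is_derive (0 : R) (1 : R) (fun h : R => r x + h * s) s.
  by apply: is_derive_eq; rewrite /GRing.scale/=; ring.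
have E0 : r x + 0 * s = r x by rewrite mul0r addr0.
have dc : is_derive (0 : R) (1 : R) (fun h : R => cos (r x + h * s)) (- sin (r x) * s).
  have := @is_derive1_comp R cos (fun h : R => r x + h * s) 0 (- sin (r x)) s.
  by rewrite /= E0 => /(_ (is_derive_cos _) dl).
have ds : is_derive (0 : R) (1 : R) (fun h : R => sin (r x + h * s)) (cos (r x) * s).
  have := @is_derive1_comp R sin (fun h : R => r x + h * s) 0 (cos (r x)) s.
  by rewrite /= E0 => /(_ (is_derive_sin _) dl).
have aux (q : R -> R) (l : R) : is_derive (0 : R) (1 : R) q l ->
    h^-1 * (q h - q 0) @[h --> (0^' : set_system R)] --> l.
  move=> [dq <-]; have := dq; rewrite /derivable => dq'.
  have -> : (fun h : R => h^-1 * (q h - q 0)) =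
    (fun h : R => h^-1 *: (q (h *: 1 + 0) - q 0)).
    by apply/funext => h; rewrite addr0 /GRing.scale/= mulr1.
  exact: dq'.
split.
- under eq_fun do rewrite Re_realM raddfB/= ra.
  have := aux _ _ dc; rewrite mul0r addr0.
  by rewrite (_ : complex.Re _ = - sin (r x) * s)//=; ring.
- under eq_fun do rewrite Im_realM raddfB/= ra.
  have := aux _ _ ds; rewrite mul0r addr0.
  by rewrite (_ : complex.Im _ = cos (r x) * s)//=; ring.
Qed.

(** The factor 2 comes from applying the mean value theorem to the real and
    imaginary parts separately. *)
Lemma cmean_value v f f' x (h M : R) :
  (forall s : R, has_cderive v f (s *: v + x) (f' (s *: v + x))) ->
  (forall s : R, `|s| <= `|h| -> normc (f' (s *: v + x)) <= M) ->
  normc (f (h *: v + x) - f x) <= 2 * M * `|h|.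
Proof.
move=> df fM.
have aux (q : C -> R) (qB : {morph q : z1 z2 / z1 - z2}) (qr : forall (r : R) z, q (r%:C * z) = r * q z)
   (qn : forall z, `|q z| <= normc z)
   (qd : forall y l, has_cderive v f y l ->
     q ((t^-1)%:C * (f (t *: v + y) - f y)) @[t --> (0^' : set_system R)] --> q l) :
   `|q (f (h *: v + x)) - q (f x)| <= M * `|h|.
  pose Q (s : R) := q (f (s *: v + x)).
  have dQ (s : R) : is_derive s (1 : R) Q (q (f' (s *: v + x))).
    have H : (fun t : R => t^-1 *: (Q (t *: 1 + s) - Q s)) @ 0^' --> q (f' (s *: v + x)).
      have := qd _ _ (df s).
      rewrite (_ : (fun t : R => _) = (fun t : R => t^-1 *: (Q (t *: 1 + s) - Q s)))//.
      apply/funext => t; rewrite qr qB /Q; congr (_ * (q (f _) - _)).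
      by rewrite addrA -scalerDl /GRing.scale/= mulr1.
    by apply: DeriveDef; [apply/cvg_ex; eexists; exact: H|exact: cvg_lim H].
  have cQ : continuous Q.
    by move=> s; apply/differentiable_continuous/derivable1_diffP; exact: ex_derive.
  have -> : q (f (h *: v + x)) - q (f x) = Q h - Q 0.
    by rewrite /Q scale0r add0r.
  have [h0|h0] := leP 0 h.
    have [c /[!in_itv]/= /andP[c0 ch] ->] :=
      @MVT_segment R Q _ 0 h h0 (fun s _ => dQ s) (continuous_subspaceT cQ).
    rewrite subr0 normrM ler_wpM2r// (le_trans (qn _))// fM//.
    by rewrite !ger0_norm.
  have [c /[!in_itv]/= /andP[c0 ch] E] :=
    @MVT_segment R Q _ h 0 (ltW h0) (fun s _ => dQ s) (continuous_subspaceT cQ).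
  rewrite distrC E sub0r normrM normrN ler_wpM2r// (le_trans (qn _))// fM//.
  by rewrite !ler0_norm ?lerN2// ltW.
apply: le_trans (normc_le_ReIm _) _; rewrite !raddfB/=.
rewrite (_ : 2 * M * `|h| = M * `|h| + M * `|h|); last by ring.
apply: lerD; apply: aux.
- exact: raddfB.
- exact: Re_realM.
- exact: normr_Re_le.
- by move=> y l [].
- exact: raddfB.
- exact: Im_realM.
- exact: normr_Im_le.
- by move=> y l [].
Qed.

End Deriv.

Section SchwartzFunctions.
Context {R : realType} {V : normedModType R}.
Local Notation C := R[i].
Implicit Types (f g : V -> C) (v x : V).

Definition rapid f := forall m, exists M : R, forall x, (1 + `|x|) ^+ m * normc (f x) <= M.

(** The seminorms with [`|x| ^+ m] and those with [(1 + `|x|) ^+ m] define the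
    same class; the latter are easier to combine. *)
Lemma schwartzP f : schwartz f <->
  forall vs, [/\ ccont (iter_cderive vs f), rapid (iter_cderive vs f) &
   forall v x, has_cderive v (iter_cderive vs f) x (iter_cderive (v :: vs) f x)].
Proof.
split=> [[sf df] vs|H].
  have [cr ci dd] := sf vs; split.
  - by move=> x; split; [exact: cr|exact: ci].
  - move=> m; have [M1 H1] := df vs m; have [M0 H0] := df vs 0%N.
    exists (2 ^+ m * (M0 + M1)) => x.
    have h1 : `|x| ^+ m * normc (iter_cderive vs f x) <= M1.
      by have := H1 x; rewrite -[`|iter_cderive vs f x|]/((normc _)%:C) -rmorphM lecR.
    have h0 : normc (iter_cderive vs f x) <= M0.
      by have := H0 x; rewrite expr0 mul1r -[`|iter_cderive vs f x|]/((normc _)%:C) lecR.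
    apply: (@le_trans _ _ (2 ^+ m * (1 + `|x| ^+ m) * normc (iter_cderive vs f x))).
      rewrite ler_wpM2r ?normc_ge0//.
      have [x1|x1] := leP `|x| 1.
        apply: (@le_trans _ _ (2 ^+ m)).
          rewrite lerXn2r ?nnegrE ?addr_ge0//; lra.
        by rewrite ler_peMr ?exprn_ge0// lerDl exprn_ge0.
      apply: (@le_trans _ _ (2 ^+ m * `|x| ^+ m)).
        rewrite -exprMn lerXn2r ?nnegrE ?addr_ge0 ?mulr_ge0//; lra.
      by rewrite ler_wpM2l ?exprn_ge0// lerDr.
    by rewrite -mulrA ler_wpM2l ?exprn_ge0// mulrDl mul1r lerD.
  - by move=> v x; have [d1 d2] := dd v x; exact: derivable_has_cderive.
split=> vs; have [cc rr dd] := H vs.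
  split.
  - by move=> x; have [] := cc x.
  - by move=> x; have [] := cc x.
  - by move=> v x; have [] := has_cderive_derivable (dd v x).
move=> m; have [M HM] := rr m; exists M => x.
rewrite -[`|iter_cderive vs f x|]/((normc _)%:C) -rmorphM lecR (le_trans _ (HM x))//.
by rewrite ler_wpM2r ?normc_ge0// lerXn2r ?nnegrE ?addr_ge0// lerDr.
Qed.

(** Schwartz functions are the largest class of continuous rapidly decreasing
    functions stable under directional derivatives, so a function is Schwartz as
    soon as it belongs to some such class. *)
Lemma schwartz_coind (P : (V -> C) -> Prop) :
  (forall f, P f -> [/\ ccont f, rapid f &
     forall v, exists2 g, P g & forall x, has_cderive v f x (g x)]) ->
  forall f, P f -> schwartz f.
Proof.
move=> HP f Pf.
have Pi vs : P (iter_cderive vs f).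
  elim: vs => [//|v vs IH] /=; have [_ _ /(_ v) [g Pg dg]] := HP _ IH.
  by rewrite (has_cderive_fun dg).
apply/schwartzP => vs; have [cc rr dd] := HP _ (Pi vs); split => // v x.
by have [g _ dg] := dd v; rewrite /= (has_cderive_fun dg).
Qed.

Lemma iter_cderive_rcons vs v f : iter_cderive (rcons vs v) f = iter_cderive vs (cderive v f).
Proof. by rewrite /iter_cderive foldr_rcons. Qed.

Lemma iter_cderive_cat vs ws f : iter_cderive (vs ++ ws) f = iter_cderive vs (iter_cderive ws f).
Proof. by rewrite /iter_cderive foldr_cat. Qed.

Lemma schwartz_iter vs f : schwartz f -> schwartz (iter_cderive vs f).
Proof.
move=> /schwartzP H; apply/schwartzP => ws.
have Ec us : iter_cderive us (iter_cderive vs f) = iter_cderive (us ++ vs) f.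
  by rewrite iter_cderive_cat.
have [h1 h2 h3] := H (ws ++ vs); split; rewrite ?Ec// => v x.
rewrite (Ec (v :: ws)); exact: h3.
Qed.

Lemma schwartz_cderive v f : schwartz f -> schwartz (cderive v f).
Proof. exact: (@schwartz_iter [:: v]). Qed.

Lemma schwartz_cont f : schwartz f -> ccont f.
Proof. by move=> /schwartzP /(_ [::]) []. Qed.

Lemma schwartz_rapid f : schwartz f -> rapid f.
Proof. by move=> /schwartzP /(_ [::]) []. Qed.

Lemma schwartz_has_cderive f v x : schwartz f -> has_cderive v f x (cderive v f x).
Proof. by move=> /schwartzP /(_ [::]) []. Qed.

Lemma rapidD f g : rapid f -> rapid g -> rapid (fun x => f x + g x).
Proof.
move=> rf rg m; have [M HM] := rf m; have [N HN] := rg m; exists (M + N) => x.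
apply: le_trans (_ : _ <= (1 + `|x|) ^+ m * (normc (f x) + normc (g x))) _.
  by rewrite ler_wpM2l ?exprn_ge0 ?addr_ge0// le_normcD.
by rewrite mulrDr lerD.
Qed.

Lemma rapidZ c f : rapid f -> rapid (fun x => c * f x).
Proof.
move=> rf m; have [M HM] := rf m; exists (normc c * M) => x.
by rewrite Normc.normcM mulrCA ler_wpM2l ?normc_ge0.
Qed.

Lemma rapid0 : rapid (fun=> 0).
Proof. by move=> m; exists 0 => x; rewrite Normc.normc0 mulr0. Qed.

Lemma rapid_pos f m : rapid f -> exists2 M : R, 0 <= M &
  forall x, (1 + `|x|) ^+ m * normc (f x) <= M.
Proof.
move=> /(_ m) [M HM]; exists M => //; apply: le_trans (HM 0).
by rewrite mulr_ge0 ?normc_ge0// exprn_ge0 ?addr_ge0.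
Qed.

Lemma rapid_bounded f : rapid f -> exists2 M, 0 <= M & forall x, normc (f x) <= M.
Proof.
move=> /(rapid_pos 0) [M M0 HM]; exists M => // x.
by have := HM x; rewrite expr0 mul1r.
Qed.

Lemma rapidM_lin (l f : V -> C) K : (forall x, normc (l x) <= K * (1 + `|x|)) ->
  rapid f -> rapid (fun x => l x * f x).
Proof.
move=> lK rf m; have [M HM] := rf m.+1; exists (K * M) => x.
have K0 : 0 <= K by have := le_trans (normc_ge0 _) (lK 0); rewrite normr0 addr0 mulr1.
apply: le_trans (_ : _ <= K * ((1 + `|x|) ^+ m.+1 * normc (f x))) _; last first.
  by rewrite ler_wpM2l.
rewrite Normc.normcM exprS mulrCA (_ : K * _ = (K * (1 + `|x|)) * ((1 + `|x|) ^+ m * normc (f x))); last by ring.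
by rewrite ler_wpM2r ?mulr_ge0 ?exprn_ge0 ?addr_ge0 ?normc_ge0.
Qed.

Lemma schwartz_lin a b f g : schwartz f -> schwartz g ->
  schwartz (fun x => a * f x + b * g x).
Proof.
move=> sf sg; apply: (@schwartz_coind (fun h => exists f g,
  [/\ schwartz f, schwartz g & h = fun x => a * f x + b * g x])); last by exists f, g.
move=> _ [f' [g' [sf' sg' ->]]]; split.
- by apply: ccontD; apply: ccontM; [exact: ccont_cst|exact: schwartz_cont|exact: ccont_cst|exact: schwartz_cont].
- by apply: rapidD; apply: rapidZ; exact: schwartz_rapid.
- move=> v; exists (fun x => a * cderive v f' x + b * cderive v g' x).
    by exists (cderive v f'), (cderive v g'); split => //; exact: schwartz_cderive.
  by move=> x; apply: has_cderiveD; apply: has_cderiveZ; exact: schwartz_has_cderive.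
Qed.

Lemma schwartz0 : schwartz (fun _ : V => 0 : C).
Proof.
apply: (@schwartz_coind (fun h => h = fun=> 0)) => // _ ->; split.
- exact: ccont_cst.
- exact: rapid0.
- by move=> v; exists (fun=> 0) => // x; exact: has_cderive_cst.
Qed.

Lemma schwartzD f g : schwartz f -> schwartz g -> schwartz (fun x => f x + g x).
Proof.
by move=> sf sg; have := schwartz_lin 1 1 sf sg; under eq_fun do rewrite !mul1r.
Qed.

Lemma schwartzZ c f : schwartz f -> schwartz (fun x => c * f x).
Proof.
move=> sf; have := schwartz_lin c 0 sf sf.
by under eq_fun do rewrite mul0r addr0.
Qed.

Lemma schwartzB f g : schwartz f -> schwartz g -> schwartz (fun x => f x - g x).
Proof.
by move=> sf sg; have := schwartz_lin 1 (-1) sf sg; under eq_fun do rewrite mul1r mulN1r.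
Qed.

Lemma schwartz_sum (J : Type) (s : seq J) (P : pred J) (F : J -> V -> C) :
  (forall j, schwartz (F j)) -> schwartz (fun x => \sum_(j <- s | P j) F j x).
Proof.
move=> sF; elim: s => [|a s IH].
  under eq_fun do rewrite big_nil; exact: schwartz0.
under eq_fun do rewrite big_cons; case: (P a) => //; exact: schwartzD.
Qed.

Lemma iter_cderive0 vs : iter_cderive vs (fun _ : V => 0 : C) = fun=> 0.
Proof.
elim: vs => [//|v vs IH] /=; rewrite IH; apply: has_cderive_fun => x.
exact: has_cderive_cst.
Qed.

Lemma iter_cderiveD vs f g : schwartz f -> schwartz g ->
  iter_cderive vs (fun x => f x + g x) = fun x => iter_cderive vs f x + iter_cderive vs g x.
Proof.
move=> sf sg; elim: vs => [//|v vs IH] /=; rewrite IH; apply: has_cderive_fun => x.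
by apply: has_cderiveD; apply: schwartz_has_cderive; exact: schwartz_iter.
Qed.

Lemma iter_cderiveZ vs c f : schwartz f ->
  iter_cderive vs (fun x => c * f x) = fun x => c * iter_cderive vs f x.
Proof.
move=> sf; elim: vs => [//|v vs IH] /=; rewrite IH; apply: has_cderive_fun => x.
by apply: has_cderiveZ; apply: schwartz_has_cderive; exact: schwartz_iter.
Qed.

Lemma iter_cderive_sum vs (J : Type) (s : seq J) (P : pred J) (F : J -> V -> C) :
  (forall j, schwartz (F j)) ->
  iter_cderive vs (fun x => \sum_(j <- s | P j) F j x) =
  fun x => \sum_(j <- s | P j) iter_cderive vs (F j) x.
Proof.
move=> sF; elim: s => [|a s IH].
  under eq_fun do rewrite big_nil; rewrite iter_cderive0.
  by apply/funext => x; rewrite big_nil.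
under eq_fun do rewrite big_cons; under [RHS]eq_fun do rewrite big_cons.
case: (P a) => //; rewrite iter_cderiveD// ?IH//; exact: schwartz_sum.
Qed.

(** The derivative of [l * f] is [l * f'] plus a Schwartz function, since the
    directional derivatives of [l] are constant; hence the class of the sums
    [l * f + g] is stable. *)
Lemma schwartzM_lin (l : V -> C) (dl : V -> C) K f : ccont l ->
  (forall x, normc (l x) <= K * (1 + `|x|)) ->
  (forall v (h : R) x, l (h *: v + x) = l x + h%:C * dl v) ->
  schwartz f -> schwartz (fun x => l x * f x).
Proof.
move=> cl lK la sf; apply: (@schwartz_coind (fun h => exists f g,
  [/\ schwartz f, schwartz g & h = fun x => l x * f x + g x])); last first.
  exists f, (fun=> 0); split => //; first exact: schwartz0.
  by apply/funext => x; rewrite addr0.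
move=> _ [f' [g' [sf' sg' ->]]]; split.
- by apply: ccontD; [apply: ccontM => //|]; exact: schwartz_cont.
- by apply: rapidD; [apply: rapidM_lin lK _|]; exact: schwartz_rapid.
- move=> v; exists (fun x => l x * cderive v f' x + (dl v * f' x + cderive v g' x)).
    exists (cderive v f'), (fun x => dl v * f' x + cderive v g' x); split => //.
      exact: schwartz_cderive.
    apply: schwartzD; [exact: schwartzZ|exact: schwartz_cderive].
  move=> x; rewrite addrA [l x * _ + _]addrC.
  apply: has_cderiveD; last exact: schwartz_has_cderive.
  apply: has_cderiveM; last exact: schwartz_has_cderive.
  exact: has_cderive_affine.
Qed.

End SchwartzFunctions.

Lemma has_cderive_comp_affine (R : realType) (X Y : normedModType R) (L : X -> Y) (v : X) (u : Y)
    (f : Y -> R[i]) x m :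
  (forall h : R, L (h *: v + x) = h *: u + L x) ->
  has_cderive u f (L x) m -> has_cderive v (f \o L) x m.
Proof. by move=> HL; apply: clim_ext => h /=; rewrite HL. Qed.

(** * Oscillatory integrals depending on a parameter *)

Lemma cvg_dnbhs_seq (R : realType) (h : nat -> R) : (forall k, h k != 0) ->
  h k @[k --> \oo] --> (0 : R) -> h k @[k --> \oo] --> ((0 : R)^' : set_system R).
Proof.
move=> h0 hl B HB; have HB' : nbhs (0 : R) [set y : R | y != 0 -> B y] := HB.
have [N _ HN] := hl _ HB'; exists N => // k Nk.
exact: HN k Nk (h0 k).
Qed.

Section Oscillatory.
Context {R : realType} {E X : normedModType R}.
Local Notation C := R[i].
Variables (I : (E -> C) -> C) (w : E -> R) (n : nat) (p : X -> X -> R).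
Hypotheses (s : integral_spec I w n) (sp : pairing_spec p).
Variables (A : E -> X) (KA : R).
Hypotheses (cA : continuous A) (HA : forall eta, `|A eta| <= KA * (1 + `|eta|)).
Implicit Types (G : E -> X -> C).

(** Amplitudes: smooth in the second variable, with all derivatives jointly
    continuous and rapidly decreasing in both variables. *)
Definition amplitude G := forall vs : seq X,
  [/\ ccont (fun z : E * X => iter_cderive vs (G z.1) z.2),
      forall eta v x, has_cderive v (iter_cderive vs (G eta)) x
                        (iter_cderive (v :: vs) (G eta) x) &
      forall m, exists M : R, forall eta x,
        ((1 + `|eta|) * (1 + `|x|)) ^+ m * normc (iter_cderive vs (G eta) x) <= M].

Definition osc_int G : X -> C := fun x => I (fun eta => G eta x * expi (p (A eta) x)).

(** The amplitude of the derivative of [osc_int G]: the phase is linear, so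
    differentiating the exponential multiplies it by a frequency. *)
Definition osc_deriv v G : E -> X -> C := fun eta x =>
  cderive v (G eta) x + 'i * (p (A eta) v)%:C * G eta x.

Lemma iter_osc_deriv vs v G eta : amplitude G ->
  iter_cderive vs (osc_deriv v G eta) = fun x =>
    iter_cderive (rcons vs v) (G eta) x + 'i * (p (A eta) v)%:C * iter_cderive vs (G eta) x.
Proof.
move=> aG; elim: vs => [//|u vs IH] /=; rewrite IH; apply: has_cderive_fun => x.
apply: has_cderiveD; first by have [_ + _] := aG (rcons vs v); exact.
by apply: has_cderiveZ; have [_ + _] := aG vs; exact.
Qed.

Lemma amplitude_osc_deriv v G : amplitude G -> amplitude (osc_deriv v G).
Proof.
move=> aG vs; have [c1 d1 b1] := aG (rcons vs v); have [c0 d0 b0] := aG vs; split.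
- under eq_fun do rewrite iter_osc_deriv//; apply: ccontD => //.
  apply: ccontM => //; apply: ccontM; first exact: ccont_cst.
  apply: ccont_real; apply: (continuous_pairing sp); last exact: continuous_cst_fun.
  exact: (continuous_comp_fun (@continuous_fst _ _) cA).
- move=> eta u x; rewrite /= iter_osc_deriv//.
  rewrite (has_cderive_fun (g := fun x => iter_cderive (u :: rcons vs v) (G eta) x +
    'i * (p (A eta) v)%:C * iter_cderive (u :: vs) (G eta) x)).
    by apply: has_cderiveD; [exact: d1|apply: has_cderiveZ; exact: d0].
  by move=> y; apply: has_cderiveD; [exact: d1|apply: has_cderiveZ; exact: d0].
- move=> m; have [M1 H1] := b1 m; have [M0 H0] := b0 m.+1.
  have [K [K0 HK]] := pair_le sp.
  have KA0 : 0 <= KA by have := le_trans (normr_ge0 _) (HA 0); rewrite normr0 addr0 mulr1.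
  exists (M1 + K * KA * `|v| * M0) => eta x; rewrite iter_osc_deriv//.
  set a := iter_cderive _ _ _; set b := iter_cderive _ _ _.
  apply: le_trans (_ : _ <= ((1 + `|eta|) * (1 + `|x|)) ^+ m *
     (normc a + K * KA * `|v| * (1 + `|eta|) * normc b)) _.
    rewrite ler_wpM2l ?exprn_ge0 ?mulr_ge0 ?addr_ge0//.
    rewrite (le_trans (le_normcD _ _))// lerD2l !Normc.normcM normc_i mul1r normc_real.
    rewrite ler_wpM2r ?normc_ge0// (le_trans (HK _ _))//.
    rewrite [leRHS](_ : _ = K * (KA * (1 + `|eta|)) * `|v|); last by ring.
    by rewrite ler_wpM2r// ler_wpM2l.
  rewrite mulrDr lerD ?H1//.
  apply: le_trans (_ : _ <= K * KA * `|v| * (((1 + `|eta|) * (1 + `|x|)) ^+ m.+1 * normc b)) _.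
    rewrite exprS [leLHS](_ : _ = K * KA * `|v| * ((1 + `|eta|) * ((1 + `|eta|) * (1 + `|x|)) ^+ m * normc b)); last by ring.
    rewrite ler_wpM2l ?mulr_ge0// ler_wpM2r ?normc_ge0// ler_wpM2r ?exprn_ge0 ?mulr_ge0 ?addr_ge0//.
    by rewrite ler_peMr ?addr_ge0// lerDl.
  by rewrite ler_wpM2l ?mulr_ge0.
Qed.

(** Rapid decrease in [eta] beats the polynomial decay of the weight. *)
Lemma amplitude_dominated G m : amplitude G -> exists2 M, 0 <= M &
  forall x eta, normc (G eta x) <= M * (1 + `|x|) ^- m * w eta.
Proof.
move=> aG; have [_ _ b] := aG [::]; have [k [K K0 HK]] := weight_decay_pos s.
have [M HM] := b (k + m)%N.
have M0 : 0 <= M.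
  apply: le_trans (HM 0 0).
  by rewrite mulr_ge0 ?normc_ge0// exprn_ge0// mulr_ge0 ?addr_ge0.
exists (K * M) => [|x eta]; first exact: mulr_ge0.
have x0 : 0 < 1 + `|x| by rewrite ltr_pwDl.
have e0 : 0 < 1 + `|eta| by rewrite ltr_pwDl.
rewrite mulrAC ler_pdivlMr ?exprn_gt0//.
have h : (1 + `|eta|) ^+ k * (normc (G eta x) * (1 + `|x|) ^+ m) <= M.
  apply: le_trans (HM eta x); rewrite exprMn mulrC [leRHS]mulrC -mulrA.
  rewrite ler_wpM2l ?normc_ge0// !exprD.
  rewrite [leRHS](_ : _ = ((1 + `|x|) ^+ m * (1 + `|eta|) ^+ k) * ((1 + `|eta|) ^+ m * (1 + `|x|) ^+ k)); last by ring.
  have p1 (t : R) j : 0 <= t -> 1 <= (1 + t) ^+ j by move=> t0; rewrite exprn_ege1// lerDl.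
  have q1 (t : R) j : 0 <= t -> 0 <= (1 + t) ^+ j by move=> t0; rewrite exprn_ge0// addr_ge0.
  rewrite ler_peMr ?mulr_ge0 ?q1//.
  by rewrite (le_trans (p1 `|eta| m _))// ler_peMr ?p1 ?q1.
have := HK eta; have wt := weight_ge0 s eta.
set a := normc _ * _ in h *; have a0 : 0 <= a by rewrite mulr_ge0 ?normc_ge0 ?exprn_ge0// ltW.
move=> h1; rewrite -[a]mul1r.
apply: (@le_trans _ _ (K * w eta * (1 + `|eta|) ^+ k * a)); first by rewrite ler_wpM2r.
rewrite [leLHS](_ : _ = K * w eta * ((1 + `|eta|) ^+ k * a)); last by ring.
rewrite [leRHS](_ : _ = K * w eta * M); last by ring.
by rewrite ler_wpM2l// mulr_ge0.
Qed.

Lemma amplitude_cont G : amplitude G -> ccont (fun z : E * X => G z.1 z.2).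
Proof. by move=> /(_ [::]) []. Qed.

Lemma continuous_phase : continuous (fun z : E * X => p (A z.1) z.2).
Proof.
apply: (continuous_pairing sp); last exact: continuous_snd.
exact: (continuous_comp_fun (@continuous_fst _ _) cA).
Qed.

Lemma osc_integrand_good G x : amplitude G -> good w (fun eta => G eta x * expi (p (A eta) x)).
Proof.
move=> aG; have [M M0 HM] := amplitude_dominated 0 aG.
apply: goodMexpi.
  split; first exact: slicel_cont (amplitude_cont aG).
  by exists M => eta; have := HM x eta; rewrite expr0 invr1 mulr1.
move=> eta; apply: (@continuous_comp _ _ _ (fun eta => (eta, x)) (fun z => p (A z.1) z.2)).
  exact: continuous_pairl.
exact: continuous_phase.
Qed.

Lemma osc_int_cont G : amplitude G -> ccont (osc_int G).
Proof.
move=> aG; have [M M0 HM] := amplitude_dominated 0 aG.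
have sw : continuous (fun z : X * E => (z.2, z.1)).
  exact: (continuous_pair (@continuous_snd _ _) (@continuous_fst _ _)).
apply: (int_param_cont s (M := M) (F := fun z : X * E => G z.2 z.1 * expi (p (A z.2) z.1))).
- apply: ccontM; first exact: ccont_comp sw (amplitude_cont aG).
  exact: ccont_expi (continuous_comp_fun sw continuous_phase).
- move=> z; rewrite Normc.normcM normc_expi mulr1.
  by have := HM z.1 z.2; rewrite expr0 invr1 mulr1.
Qed.

Lemma osc_int_rapid G : amplitude G -> rapid (osc_int G).
Proof.
move=> aG m; have [M M0 HM] := amplitude_dominated m aG.
have [K K0 HK] := int_bound_gt0 s; exists (K * M) => x.
have x0 : 0 < 1 + `|x| by rewrite ltr_pwDl.
rewrite mulrC -ler_pdivlMr ?exprn_gt0// -mulrA; apply: HK.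
  by have [] := osc_integrand_good x aG.
by move=> eta; rewrite Normc.normcM normc_expi mulr1.
Qed.

(** Differentiation under the integral sign, by dominated convergence and the
    mean value inequality. *)
Lemma osc_int_has_cderive G v x : amplitude G ->
  has_cderive v (osc_int G) x (osc_int (osc_deriv v G) x).
Proof.
move=> aG; have aG' := amplitude_osc_deriv v aG.
have [M M0 HM] := amplitude_dominated 0 aG'.
pose F eta y := G eta y * expi (p (A eta) y).
pose F' eta y := osc_deriv v G eta y * expi (p (A eta) y).
have dF eta y : has_cderive v (F eta) y (F' eta y).
  have [_ dG _] := aG [::].
  have := has_cderiveM (dG eta v y) (has_cderive_expi (r := p (A eta)) (v := v) (x := y)
    (s := p (A eta) v) _).
  rewrite (_ : _ + _ = F' eta y); last by rewrite /F' /osc_deriv/=; ring.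
  by apply => h; rewrite (pairDr sp) (pairZr sp) addrC.
apply: clim_within_seq => h h0 hlim.
apply: (clim_ext (g := fun k => I (fun eta => (h k)^-1%:C * (F eta (h k *: v + x) - F eta x)))).
  move=> k /=; rewrite /osc_int -(intB s); try exact: osc_integrand_good.
  rewrite -(intZ s)//; have := goodZ (-1) (osc_integrand_good x aG).
  move=> /(goodD (osc_integrand_good (h k *: v + x) aG)).
  by under eq_fun do rewrite mulN1r.
apply: (int_dct s (M := 2 * M)).
- move=> k; apply: ccontM; first exact: ccont_cst.
  have [c1 _] := osc_integrand_good (h k *: v + x) aG.
  have [c2 _] := goodZ (-1) (osc_integrand_good x aG).
  by have := ccontD c1 c2; under eq_fun do rewrite mulN1r.
- by have [] := osc_integrand_good x aG'.
- move=> k eta; rewrite Normc.normcM normc_real normfV mulrC.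
  have hk : 0 < `|h k| by rewrite normr_gt0; exact: h0.
  rewrite ler_pdivrMr// -[2 * M * _]mulrA; apply: (cmean_value (f' := F' eta)) => [t|t _].
    exact: dF.
  rewrite Normc.normcM normc_expi mulr1.
  by have := HM (t *: v + x) eta; rewrite expr0 invr1 mulr1.
- move=> eta; have := dF eta x; rewrite /has_cderive => H.
  exact: (clim_comp (cvg_dnbhs_seq h0 hlim) H).
Qed.

Lemma osc_int_schwartz G : amplitude G -> schwartz (osc_int G).
Proof.
move=> aG; apply: (@schwartz_coind _ _ (fun f => exists2 G, amplitude G & f = osc_int G)); last by exists G.
move=> _ [G' aG' ->]; split; [exact: osc_int_cont|exact: osc_int_rapid|].
move=> v; exists (osc_int (osc_deriv v G')).
  by exists (osc_deriv v G') => //; exact: amplitude_osc_deriv.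
by move=> x; exact: osc_int_has_cderive.
Qed.

(** The growth condition says that the decay of [h] in [eta] and of [f] in
    [L eta x] together control both variables. *)
Lemma amplitude_affine (Y : normedModType R) (h : E -> C) (f : Y -> C)
    (L : E -> X -> Y) (l : X -> Y) :
  ccont h -> schwartz f -> continuous (fun z : E * X => L z.1 z.2) ->
  (forall eta (t : R) v x, L eta (t *: v + x) = t *: l v + L eta x) ->
  (forall m, exists k K, 0 <= K /\ forall eta x,
     ((1 + `|eta|) * (1 + `|x|)) ^+ m * normc (h eta) <= K * (1 + `|L eta x|) ^+ k) ->
  amplitude (fun eta x => h eta * f (L eta x)).
Proof.
move=> ch sf cL HL HK vs; have /schwartzP Hf := sf.
have IE us eta : iter_cderive us (fun x => h eta * f (L eta x)) =
    fun x => h eta * iter_cderive (map l us) f (L eta x).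
  elim: us => [//|u us IH] /=; rewrite IH; apply: has_cderive_fun => x.
  apply: has_cderiveZ; apply: (has_cderive_comp_affine (L := L eta) (u := l u)) => //.
  by have [_ _] := Hf (map l us); exact.
have [cf rf df] := Hf (map l vs); split.
- under eq_fun do rewrite IE; apply: ccontM; last exact: ccont_comp cL cf.
  by apply: ccont_comp ch; exact: continuous_fst.
- move=> eta v x; rewrite !IE/=; apply: has_cderiveZ.
  by apply: (has_cderive_comp_affine (L := L eta) (u := l v)) => //; exact: df.
- move=> m; have [k [K [K0 H]]] := HK m; have [M HM] := rf k; exists (K * M) => eta x.
  rewrite IE Normc.normcM mulrA.
  apply: le_trans (_ : _ <= K * (1 + `|L eta x|) ^+ k * normc (iter_cderive (map l vs) f (L eta x))) _.
    by rewrite ler_wpM2r ?normc_ge0.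
  by rewrite -mulrA ler_wpM2l.
Qed.

End Oscillatory.

(** * The Fourier transform of Schwartz functions *)

Section SchwartzFourier.
Context {R : realType} {V : normedModType R}.
Local Notation C := R[i].
Variables (I : (V -> C) -> C) (w : V -> R) (n : nat) (p : V -> V -> R) (c : R).
Hypotheses (s : integral_spec I w n) (sp : pairing_spec p).
Hypotheses (inv : fourier_inversion I w p c) (c0 : c != 0).
Implicit Types (f g : V -> C) (v x eta : V).

(** The weight decays only polynomially. *)
Lemma rapid_decay f m : rapid f -> exists2 M, 0 <= M &
  forall x, (1 + `|x|) ^+ m * normc (f x) <= M * w x.
Proof.
move=> rf; have [k [K K0 HK]] := weight_decay_pos s.
have [M M0 HM] := rapid_pos (k + m) rf.
exists (K * M) => [|x]; first exact: mulr_ge0.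
set a := _ * normc _.
have a0 : 0 <= a by rewrite mulr_ge0 ?normc_ge0// exprn_ge0// addr_ge0.
have h : (1 + `|x|) ^+ k * a <= M by apply: le_trans (HM x); rewrite exprD -mulrA.
rewrite -[a]mul1r.
apply: (@le_trans _ _ (K * w x * (1 + `|x|) ^+ k * a)); first by rewrite ler_wpM2r.
rewrite [leLHS](_ : _ = K * w x * ((1 + `|x|) ^+ k * a)); last by ring.
rewrite [leRHS](_ : _ = K * w x * M); last by ring.
by rewrite ler_wpM2l// mulr_ge0// (weight_ge0 s).
Qed.

Lemma rapid_good f : ccont f -> rapid f -> good w f.
Proof.
move=> cf rf; split => //; have [M M0 HM] := rapid_decay 0 rf.
by exists M => x; have := HM x; rewrite expr0 mul1r.
Qed.

Lemma schwartz_good f : schwartz f -> good w f.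
Proof. by move=> sf; apply: rapid_good; [exact: schwartz_cont|exact: schwartz_rapid]. Qed.

(** The difference quotients have integral 0 by translation invariance, and
    dominated convergence passes to the derivative. *)
Lemma int_cderive0 v f f' : ccont f -> rapid f -> ccont f' -> rapid f' ->
  (forall x, has_cderive v f x (f' x)) -> I f' = 0.
Proof.
move=> cf rf cf' rf' df.
have gf := rapid_good cf rf.
have cshift a : continuous (fun x : V => x + a).
  by move=> x; apply: cvgD; [exact: cvg_id|exact: cvg_cst].
have rshift a : rapid (fun x => f (x + a)).
  move=> m; have [M HM] := rf m; exists ((1 + `|a|) ^+ m * M) => x.
  apply: le_trans (_ : _ <= (1 + `|a|) ^+ m * ((1 + `|x + a|) ^+ m * normc (f (x + a)))) _.
    rewrite mulrA ler_wpM2r ?normc_ge0// -exprMn lerXn2r ?nnegrE ?mulr_ge0 ?addr_ge0//.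
    have : `|x| <= `|x + a| + `|a| by rewrite -{1}(addrK a x) ler_normB.
    have := normr_ge0 a; have := normr_ge0 (x + a); nra.
  by rewrite ler_wpM2l// exprn_ge0// addr_ge0.
have gshift a : good w (fun x => f (x + a)).
  by apply: rapid_good => //; exact: ccont_comp.
have [k [K K0 HK]] := weight_decay_pos s.
have [M M0 HM] := rapid_pos k rf'.
pose h (j : nat) : R := j.+1%:R^-1.
have h0 j : 0 < h j by rewrite invr_gt0.
have h1 j : h j <= 1 by rewrite invf_le1// ler1n.
have hlim : h j @[j --> \oo] --> (0 : R) by exact: cvg_harmonic.
pose q j x := (h j)^-1%:C * (f (h j *: v + x) - f x).
have cq j : ccont (q j).
  apply: ccontM; first exact: ccont_cst.
  have [c1 _] := gshift (h j *: v); have [c2 _] := goodZ (-1) gf.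
  by have := ccontD c1 c2; under eq_fun do rewrite mulN1r [_ + h j *: v]addrC.
have Iq j : I (q j) = 0.
  rewrite /q (intZ s); last first.
    have := goodD (gshift (h j *: v)) (goodZ (-1) gf).
    by under eq_fun do rewrite mulN1r [_ + h j *: v]addrC.
  under eq_fun do rewrite [h j *: v + _]addrC.
  by rewrite (intB s)// (int_shift s)// subrr mulr0.
have Ilim : clim \oo (fun j => I (q j)) (I f').
  apply: (int_dct s (M := 2 * ((1 + `|v|) ^+ k * M * K))) => // [j x|x].
    rewrite /q Normc.normcM normc_real normfV mulrC [`|h j|]gtr0_norm// ler_pdivrMr//.
    have HH := @cmean_value R V v f f' x (h j) ((1 + `|v|) ^+ k * M * K * w x) (fun t => df _).
    rewrite gtr0_norm// in HH.
    rewrite [leRHS](_ : _ = 2 * ((1 + `|v|) ^+ k * M * K * w x) * h j); last by ring.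
    apply: HH => t tj; have t1 : `|t| <= 1 by rewrite (le_trans tj).
    set y := t *: v + x.
    have H2 : (1 + `|x|) ^+ k <= (1 + `|v|) ^+ k * (1 + `|y|) ^+ k.
      rewrite -exprMn lerXn2r ?nnegrE ?mulr_ge0 ?addr_ge0//.
      have : `|x| <= `|y| + `|t *: v| by rewrite -{1}(addKr (t *: v) x) addrC ler_normB.
      rewrite normrZ; have := normr_ge0 v; have := normr_ge0 y; nra.
    have a0 := normc_ge0 (f' y).
    have kw0 : 0 <= K * w x by rewrite mulr_ge0// (weight_ge0 s).
    have v0 : 0 <= (1 + `|v|) ^+ k by rewrite exprn_ge0// addr_ge0.
    rewrite -[leLHS]mul1r.
    apply: (@le_trans _ _ (K * w x * ((1 + `|v|) ^+ k * (1 + `|y|) ^+ k) * normc (f' y))).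
      by rewrite ler_wpM2r// (le_trans (HK x))// ler_wpM2l.
    rewrite [leLHS](_ : _ = K * w x * (1 + `|v|) ^+ k * ((1 + `|y|) ^+ k * normc (f' y))); last by ring.
    rewrite [leRHS](_ : _ = K * w x * (1 + `|v|) ^+ k * M); last by ring.
    by rewrite ler_wpM2l// mulr_ge0.
  apply: (clim_comp (cvg_dnbhs_seq _ hlim) (df x)) => j.
  by rewrite gt_eqF.
apply: (clim_unique Ilim).
by apply: (clim_ext Iq); exact: clim_cst.
Qed.

Definition ft f : V -> C := fun eta => (c^-1)%:C * fourier I p f eta.

Lemma ftD f g eta : schwartz f -> schwartz g ->
  ft (fun x => f x + g x) eta = ft f eta + ft g eta.
Proof.
move=> sf sg; rewrite /ft -mulrDr /fourier -(intD s).
- by congr (_ * I _); apply/funext => x; rewrite mulrDl.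
- apply: goodMexpi; first exact: schwartz_good.
  by move=> x; apply: cvgN; exact: (continuous_pairing_cst sp).
- apply: goodMexpi; first exact: schwartz_good.
  by move=> x; apply: cvgN; exact: (continuous_pairing_cst sp).
Qed.

Lemma ftZ a f eta : schwartz f -> ft (fun x => a * f x) eta = a * ft f eta.
Proof.
move=> sf; rewrite /ft mulrCA; congr (_ * _); rewrite /fourier -(intZ s).
- by congr I; apply/funext => x; rewrite mulrA.
- apply: goodMexpi; first exact: schwartz_good.
  by move=> x; apply: cvgN; exact: (continuous_pairing_cst sp).
Qed.

Lemma ft_cont f : schwartz f -> ccont (ft f).
Proof.
move=> sf; apply: ccontM; first exact: ccont_cst.
have [cf [M fM]] := schwartz_good sf.
apply: (int_param_cont s (M := M) (F := fun z : V * V => f z.2 * expi (- p z.1 z.2))).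
- apply: ccontM; first by apply: ccont_comp cf; exact: continuous_snd.
  by apply: ccont_expi => z; apply: cvgN; exact: continuous_pair_of.
- by move=> z; rewrite Normc.normcM normc_expi mulr1.
Qed.

(** Integration by parts: the derivative of [f x * expi (- p eta x)] has
    integral 0. *)
Lemma ft_cderive v f eta : schwartz f -> ft (cderive v f) eta = 'i * (p eta v)%:C * ft f eta.
Proof.
move=> sf; rewrite /ft mulrCA; congr (_ * _).
have cpN : continuous (fun x => - p eta x).
  by move=> x; apply: cvgN; exact: (continuous_pairing_cst sp).
have rM g : rapid g -> rapid (fun x => g x * expi (- p eta x)).
  by move=> rg m; have [M HM] := rg m; exists M => x; rewrite Normc.normcM normc_expi mulr1.
have sdf := schwartz_cderive v sf.
have E : I (fun x => (cderive v f x + - ('i * (p eta v)%:C) * f x) * expi (- p eta x)) = 0.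
  apply: (@int_cderive0 v (fun x => f x * expi (- p eta x))).
  - by apply: ccontM; [exact: schwartz_cont|exact: ccont_expi].
  - by apply: rM; exact: schwartz_rapid.
  - apply: ccontM; last exact: ccont_expi.
    by apply: ccontD; [|apply: ccontM; first exact: ccont_cst]; exact: schwartz_cont.
  - by apply: rM; apply: rapidD; [|apply: rapidZ]; exact: schwartz_rapid.
  - move=> x; have := has_cderiveM (schwartz_has_cderive v x sf)
      (has_cderive_expi (r := fun x => - p eta x) (v := v) (x := x) (s := - p eta v) _).
    rewrite (_ : _ + _ = (cderive v f x + - ('i * (p eta v)%:C) * f x) * expi (- p eta x)); last first.
      by rewrite rmorphN/=; ring.
    by apply => h; rewrite (pairDr sp) (pairZr sp) opprD mulrN addrC.
apply/eqP; rewrite -subr_eq0 -E /fourier -(intZ s) -?(intB s); last first.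
- apply: goodMexpi => //; exact: schwartz_good.
- by apply: goodZ; apply: goodMexpi => //; exact: schwartz_good.
- by apply: goodMexpi => //; exact: schwartz_good.
by apply/eqP; congr I; apply/funext => x; ring.
Qed.

Lemma ft_bounded f : schwartz f -> exists M, forall eta, normc (ft f eta) <= M.
Proof.
move=> sf; have [cf [M fM]] := schwartz_good sf; have [K K0 HK] := int_bound_gt0 s.
exists (normc (c^-1)%:C * (K * M)) => eta; rewrite Normc.normcM ler_wpM2l ?normc_ge0//.
apply: HK.
  apply: ccontM => //; apply: ccont_expi => x; apply: cvgN.
  exact: (continuous_pairing_cst sp).
by move=> x; rewrite Normc.normcM normc_expi mulr1.
Qed.

(** By [pair_coercive], a power of [`|eta|] is bounded by products of the
    [p eta v], which turn into derivatives of [f]. *)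
Lemma ft_rapid f : schwartz f -> rapid (ft f).
Proof.
move=> sf m; elim: m f sf => [|m IH] f sf.
  by have [M HM] := ft_bounded sf; exists M => x; rewrite expr0 mul1r.
have [vs Hvs] := pair_coercive sp.
have [M HM] := IH f sf.
have HN v : {N | forall eta, (1 + `|eta|) ^+ m * normc (ft (cderive v f) eta) <= N}.
  by apply: cid; apply: IH; exact: schwartz_cderive.
exists (M + \sum_(v <- vs) sval (HN v)) => eta.
rewrite exprSr -mulrA mulrDl mul1r mulrDr lerD//.
apply: le_trans (_ : _ <= (1 + `|eta|) ^+ m * (\sum_(v <- vs) `|p eta v| * normc (ft f eta))) _.
  by rewrite ler_wpM2l ?exprn_ge0 ?addr_ge0// -mulr_suml ler_wpM2r ?normc_ge0.
rewrite mulr_sumr; apply: ler_sum => v _; case: (HN v) => N /= HNv.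
apply: le_trans (HNv eta); rewrite ft_cderive// !Normc.normcM normc_i mul1r.
by rewrite normc_real.
Qed.

Lemma ft_good f : schwartz f -> good w (ft f).
Proof. by move=> sf; apply: rapid_good; [exact: ft_cont|exact: ft_rapid]. Qed.

Lemma ft_inv f x : schwartz f -> I (fun eta => ft f eta * expi (p eta x)) = f x.
Proof.
move=> sf; have gf := schwartz_good sf.
have cC : (c%:C : C) != 0 by rewrite eq_complex/= eqxx andbT.
have gF : good w (fourier I p f).
  have := goodZ c%:C (ft_good sf); rewrite (_ : (fun x => _) = fourier I p f)//.
  by apply/funext => eta; rewrite /ft mulrA -rmorphM/= divff// mul1r.
have := inv gf gF x => E.
rewrite (_ : (fun eta => _) = (fun eta => (c^-1)%:C * (fourier I p f eta * expi (p eta x)))).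
  rewrite (intZ s); first by rewrite E mulrA -rmorphM/= mulVf// mul1r.
  by apply: goodMexpi => //; exact: (continuous_pairing_cstl sp).
by apply/funext => eta; rewrite /ft mulrA.
Qed.

Lemma ft_inj f g : schwartz f -> schwartz g -> ft f =1 ft g -> f = g.
Proof.
move=> sf sg E; apply/funext => x; rewrite -(ft_inv x sf) -(ft_inv x sg).
by congr I; apply/funext => eta; rewrite E.
Qed.

(** Directional derivatives of Schwartz functions commute and depend linearly
    on the direction, because they are multipliers on the Fourier side. *)
Lemma cderiveC u v f : schwartz f -> cderive u (cderive v f) = cderive v (cderive u f).
Proof.
move=> sf; apply: ft_inj; try (by do 2 apply: schwartz_cderive).
move=> eta; rewrite (ft_cderive u eta (schwartz_cderive v sf)) (ft_cderive v eta sf).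
rewrite (ft_cderive v eta (schwartz_cderive u sf)) (ft_cderive u eta sf).
exact: mulrCA.
Qed.

Lemma cderive_dirD u v f : schwartz f ->
  cderive (u + v) f = fun x => cderive u f x + cderive v f x.
Proof.
move=> sf; apply: ft_inj; first exact: schwartz_cderive.
  by apply: schwartzD; exact: schwartz_cderive.
move=> eta; rewrite ftD ?ft_cderive//; try exact: schwartz_cderive.
by rewrite (pairDr sp) rmorphD/=; ring.
Qed.

Lemma cderive_dirZ (a : R) v f : schwartz f ->
  cderive (a *: v) f = fun x => a%:C * cderive v f x.
Proof.
move=> sf; apply: ft_inj; first exact: schwartz_cderive.
  by apply: schwartzZ; exact: schwartz_cderive.
move=> eta; rewrite ftZ ?ft_cderive//; try exact: schwartz_cderive.
by rewrite (pairZr sp) rmorphM/=; ring.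
Qed.

End SchwartzFourier.

Section ContinuityRules.
Context {R : realType}.

Lemma continuous_addf (T : topologicalType) (V : normedModType R) (f g : T -> V) :
  continuous f -> continuous g -> continuous (fun x => f x + g x).
Proof. by move=> cf cg x; apply: cvgD; [exact: cf|exact: cg]. Qed.

Lemma continuous_oppf (T : topologicalType) (V : normedModType R) (f : T -> V) :
  continuous f -> continuous (fun x => - f x).
Proof. by move=> cf x; apply: cvgN; exact: cf. Qed.

Lemma continuous_scalef (T : topologicalType) (V : normedModType R) (a : R) (f : T -> V) :
  continuous f -> continuous (fun x => a *: f x).
Proof. by move=> cf x; apply: cvgZ; [exact: cvg_cst|exact: cf]. Qed.

Lemma continuous_mulf (T : topologicalType) (f g : T -> R) :
  continuous f -> continuous g -> continuous (fun x => f x * g x).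
Proof. by move=> cf cg x; apply: cvgM; [exact: cf|exact: cg]. Qed.

Lemma continuous_fstf (T U W : topologicalType) (f : T -> U * W) :
  continuous f -> continuous (fun x => (f x).1).
Proof. by move=> cf; apply: (continuous_comp_fun cf); exact: continuous_fst. Qed.

Lemma continuous_sndf (T U W : topologicalType) (f : T -> U * W) :
  continuous f -> continuous (fun x => (f x).2).
Proof. by move=> cf; apply: (continuous_comp_fun cf); exact: continuous_snd. Qed.

Lemma continuous_idf (T : topologicalType) : continuous (fun x : T => x).
Proof. by move=> x; exact: cvg_id. Qed.

Lemma continuous_dotrV (T : topologicalType) d (f g : T -> 'rV[R]_d) :
  continuous f -> continuous g -> continuous (fun x => dotrV (f x) (g x)).
Proof. exact: (continuous_pairing (pairing_spec_dotrV d)). Qed.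

Lemma ccont_app (T U : topologicalType) (u : T -> U) (g : U -> R[i]) :
  ccont g -> continuous u -> ccont (fun x => g (u x)).
Proof. by move=> cg cu; exact: ccont_comp. Qed.

End ContinuityRules.

(* Continuity of a function built from projections, affine operations and the
   pairing, by recursion on its expression. *)
Ltac cont := match goal with
  | |- continuous (fun x => x) => exact: continuous_idf
  | |- continuous (fun x => (@?f x, @?g x)) => apply: (@continuous_pair _ _ _ f g); cont
  | |- continuous (fun x => fst (@?f x)) => apply: (@continuous_fstf _ _ _ f); cont
  | |- continuous (fun x => snd (@?f x)) => apply: (@continuous_sndf _ _ _ f); cont
  | |- continuous (fun x => dotrV (@?f x) (@?g x)) => apply: (@continuous_dotrV _ _ _ f g); cont
  | |- continuous (fun x => ?a *: @?f x) => apply: (@continuous_scalef _ _ _ a f); cont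
  | |- continuous (fun x => - @?f x) => apply: (@continuous_oppf _ _ _ f); cont
  | |- continuous (fun x => @?f x + @?g x) => apply: (@continuous_addf _ _ _ f g); cont
  | |- continuous (fun x => @?f x * @?g x) => apply: (@continuous_mulf _ _ f g); cont
  | |- continuous (fun x => ?a) => exact: continuous_cst_fun
  | |- continuous fst => exact: continuous_fst
  | |- continuous snd => exact: continuous_snd
  | |- continuous (dotrV _) => exact: (continuous_pairing_cst (pairing_spec_dotrV _))
  end.

Lemma rapid_comp (R : realType) (X Y : normedModType R) (L : X -> Y) (f : Y -> R[i]) (K : R) :
  (forall x, 1 + `|x| <= K * (1 + `|L x|)) -> rapid f -> rapid (fun x => f (L x)).
Proof.
move=> HL rf m; have [M HM] := rf m; exists (K ^+ m * M) => x.
have K0 : 0 <= K.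
  have := le_trans (addr_ge0 ler01 (normr_ge0 0)) (HL 0).
  by rewrite pmulr_lge0// ltr_pwDl.
apply: (@le_trans _ _ (K ^+ m * ((1 + `|L x|) ^+ m * normc (f (L x))))).
  rewrite mulrA ler_wpM2r ?normc_ge0// -exprMn lerXn2r ?nnegrE ?mulr_ge0 ?addr_ge0//.
by rewrite ler_wpM2l// exprn_ge0.
Qed.

(** * Weyl quantization of Schwartz symbols *)

Section ShiftAmplitude.
Context {R : realType} {E X : normedModType R}.
Local Notation C := R[i].

(** The amplitudes behind both Weyl operators and Moyal products: a rapidly
    decreasing function times a translate of a Schwartz function. *)
Lemma amplitude_shift (h : E -> C) (f : X -> C) (B : E -> X) (KB : R) :
  ccont h -> rapid h -> schwartz f -> continuous B ->
  (forall eta, `|B eta| <= KB * (1 + `|eta|)) ->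
  amplitude (fun eta x => h eta * f (B eta + x)).
Proof.
move=> ch rh sf cB HB.
have KB0 : 0 <= KB by have := le_trans (normr_ge0 _) (HB 0); rewrite normr0 addr0 mulr1.
apply: (amplitude_affine (L := fun eta x => B eta + x) (l := id)) => //.
- apply: continuous_addf; last exact: continuous_snd.
  exact: continuous_comp_fun (@continuous_fst _ _) cB.
- by move=> eta t v x; rewrite addrCA.
- move=> m; have [M M0 HM] := rapid_pos (m + m) rh.
  exists m, ((1 + KB) ^+ m * M); split => [|eta x].
    by rewrite mulr_ge0// exprn_ge0// addr_ge0.
  have e0 : 0 <= 1 + `|eta| by rewrite addr_ge0.
  have b0 : 0 <= 1 + `|B eta + x| by rewrite addr_ge0.
  have H : 1 + `|x| <= (1 + KB) * (1 + `|eta|) * (1 + `|B eta + x|).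
    have h1 : `|x| <= `|B eta + x| + `|B eta| by rewrite -{1}(addKr (B eta) x) addrC ler_normB.
    have h2 := HB eta; have := normr_ge0 eta; have := normr_ge0 (B eta + x).
    set a := `|B eta + x| in h1 *; set b := `|eta| in h2 *; move=> a0 b0'.
    have : 0 <= KB * (1 + b) * a by rewrite !mulr_ge0// addr_ge0.
    have : 0 <= b * a by rewrite mulr_ge0.
    nra.
  apply: (@le_trans _ _ (((1 + `|eta|) * ((1 + KB) * (1 + `|eta|) * (1 + `|B eta + x|))) ^+ m * normc (h eta))).
    rewrite ler_wpM2r ?normc_ge0// lerXn2r ?nnegrE ?mulr_ge0 ?addr_ge0//.
    by rewrite ler_wpM2l.
  rewrite !exprMn.
  rewrite [leLHS](_ : _ = (1 + KB) ^+ m * ((1 + `|eta|) ^+ (m + m) * normc (h eta)) * (1 + `|B eta + x|) ^+ m); last by rewrite exprD; ring.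
  by rewrite ler_wpM2r ?exprn_ge0// ler_wpM2l// exprn_ge0// addr_ge0.
Qed.

End ShiftAmplitude.

Section WeylCalculus.
Context {R : realType} {d : nat}.
Local Notation C := R[i].
Local Notation W := 'rV[R]_d.
Local Notation V := ('rV[R]_d * 'rV[R]_d)%type.
Local Notation IV := (@int_phase R d).
Local Notation IW := (@integral_rV R d).
Local Notation wV := (@weight_phase R d).
Local Notation wW := (@weight_rV R d).
Local Notation twopi := ((2 * pi : R) ^+ d).
Implicit Types (f g : V -> C) (phi : W -> C) (hbar t : R).

(** The normalization puts the constant of the inversion formula on the
    transform, so that [f] is exactly the superposition of plane waves with
    density [fhat f]. *)
Definition fhat : (V -> C) -> V -> C := ft IV dot_phase (twopi * twopi).

Lemma twopi_neq0 : twopi != 0.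
Proof. by rewrite expf_neq0// mulf_neq0// ?pnatr_eq0// gt_eqF// pi_gt0. Qed.

Lemma twopi2_neq0 : twopi * twopi != 0.
Proof. by rewrite mulf_neq0// twopi_neq0. Qed.

Let sV := @integral_spec_phase R d.
Let sW := @integral_spec_rV R d.
Let spV := @pairing_spec_phase R d.
Let spW := @pairing_spec_dotrV R d.
Let invV := @fourier_inversion_phase R d.
Let invW := @fourier_inversion_rV R d.

Lemma fhat_cont f : schwartz f -> ccont (fhat f).
Proof. exact: (ft_cont _ sV spV). Qed.

Lemma fhat_rapid f : schwartz f -> rapid (fhat f).
Proof. exact: (ft_rapid _ sV spV). Qed.

Lemma fhat_inv f u : schwartz f -> IV (fun eta => fhat f eta * expi (dot_phase eta u)) = f u.
Proof. exact: (ft_inv sV spV invV twopi2_neq0). Qed.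

Lemma fhat_cderive v f eta : schwartz f ->
  fhat (cderive v f) eta = 'i * (dot_phase eta v)%:C * fhat f eta.
Proof. exact: (ft_cderive _ sV spV). Qed.

Lemma fourier_phase_good f : schwartz f -> good wV (fourier IV dot_phase f).
Proof.
move=> sf; have := goodZ (twopi * twopi)%:C (rapid_good sV (fhat_cont sf) (fhat_rapid sf)).
rewrite (_ : (fun x => _) = fourier IV dot_phase f)//; apply/funext => eta.
by rewrite /fhat /ft mulrA -rmorphM/= divff ?twopi2_neq0// mul1r.
Qed.

Lemma fhat_partial f (x b : W) : schwartz f ->
  IW (fun xi => f (x, xi) * expi (- dotrV b xi)) =
  twopi%:C * IW (fun a => fhat f (a, b) * expi (dotrV a x)).
Proof.
move=> sf; have gf := schwartz_good sV sf; have gF := fourier_phase_good sf.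
have E := partial_inversion sW sW spW x b invW gf gF.
have -> : (fun a => fhat f (a, b) * expi (dotrV a x)) =
  (fun a => ((twopi * twopi)^-1)%:C * (fourier IV dot_phase f (a, b) * expi (dotrV a x))).
  by apply/funext => a; rewrite mulrA.
rewrite (intZ sW); last first.
  apply: goodMexpi; first exact: slicel_good gF.
  exact: (continuous_pairing_cstl spW).
rewrite E !mulrA -!rmorphM/= (_ : twopi * _ * _ = 1) ?mul1r//.
by rewrite invfM; field; exact: twopi_neq0.
Qed.

(** Quantization of the plane wave with frequency [eta = (a, b)], a translation
    by [hbar *: b] followed by a modulation, superposed with density [fhat f]. *)
Definition weyl_osc hbar f phi : W -> C :=
  osc_int IV (@dotrV R d) fst
   (fun eta x => fhat f eta * expi (hbar / 2 * dotrV eta.1 eta.2) * phi (hbar *: eta.2 + x)).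

Lemma normc_scale_snd hbar (eta : V) : `|hbar *: eta.2| <= `|hbar| * (1 + `|eta|).
Proof.
rewrite normrZ ler_wpM2l// (le_trans (norm_snd_le eta))//.
by rewrite lerDr.
Qed.

Lemma amplitude_weyl hbar f phi : schwartz f -> schwartz phi ->
  amplitude (fun (eta : V) x =>
    fhat f eta * expi (hbar / 2 * dotrV eta.1 eta.2) * phi (hbar *: eta.2 + x)).
Proof.
move=> sf sphi.
apply: (amplitude_shift (h := fun eta => fhat f eta * expi (hbar / 2 * dotrV eta.1 eta.2))
  (B := fun eta : V => hbar *: eta.2) (KB := `|hbar|)) => //.
- by apply: ccontM; [exact: fhat_cont|apply: ccont_expi; cont].
- move=> m; have [M HM] := fhat_rapid sf m; exists M => eta.
  by rewrite Normc.normcM normc_expi mulr1.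
- cont.
- exact: normc_scale_snd.
Qed.

Let cfst : continuous (fst : V -> W). Proof. exact: continuous_fst. Qed.
Let Hfst (eta : V) : `|eta.1| <= 1 * (1 + `|eta|).
Proof. by rewrite mul1r (le_trans (norm_fst_le eta))// lerDr. Qed.

Lemma weyl_osc_schwartz hbar f phi : schwartz f -> schwartz phi -> schwartz (weyl_osc hbar f phi).
Proof.
move=> sf sphi; apply: (osc_int_schwartz sV spW cfst Hfst).
exact: amplitude_weyl.
Qed.

Lemma weight_rV_decay : exists k, exists2 K, 0 <= K &
  forall x : W, (1 + `|x|) ^- k <= K * wW x.
Proof.
have [k [K K0 HK]] := weight_decay_pos sW; exists k, K => // x.
have x0 : 0 < (1 + `|x|) ^+ k by rewrite exprn_gt0// ltr_pwDl.
by rewrite -[leLHS]mul1r ler_pdivrMr.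
Qed.

Lemma schwartz_phase_shift_le f (c : W) : schwartz f -> exists2 M, 0 <= M &
  forall (x xi : W), normc (f (x, xi + c)) <= M * wW xi.
Proof.
move=> sf; have [k [K K0 HK]] := weight_rV_decay.
have [M M0 HM] := rapid_pos k (schwartz_rapid sf).
have c0 : 0 <= (1 + `|c|) ^+ k by rewrite exprn_ge0// addr_ge0.
exists ((1 + `|c|) ^+ k * M * K) => [|x xi]; first by rewrite !mulr_ge0.
have xi0 : 0 < (1 + `|xi|) ^+ k by rewrite exprn_gt0// ltr_pwDl.
rewrite [leRHS](_ : _ = (1 + `|c|) ^+ k * M * (K * wW xi)); last by ring.
apply: (@le_trans _ _ ((1 + `|c|) ^+ k * M * (1 + `|xi|) ^- k)); last first.
  by rewrite ler_wpM2l// mulr_ge0.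
rewrite ler_pdivlMr// mulrC.
apply: (@le_trans _ _ ((1 + `|c|) ^+ k * ((1 + `|(x, xi + c)|) ^+ k * normc (f (x, xi + c))))); last first.
  by rewrite ler_wpM2l.
rewrite mulrA ler_wpM2r ?normc_ge0// -exprMn lerXn2r ?nnegrE ?mulr_ge0 ?addr_ge0//.
have h1 : `|xi| <= `|xi + c| + `|c| by rewrite -{1}(addrK c xi) ler_normB.
have h2 := norm_snd_le (x, xi + c); rewrite /= in h2.
have := normr_ge0 c; have := normr_ge0 (x, xi + c); nra.
Qed.

Lemma schwartz_phase_le (f : V -> C) : schwartz f -> exists2 M, 0 <= M &
  forall (x xi : W), normc (f (x, xi)) <= M * wW xi.
Proof.
move=> sf; have [M M0 HM] := schwartz_phase_shift_le 0 sf.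
by exists M => // x xi; rewrite -[xi in (x, xi)]addr0.
Qed.

Lemma schwartz_row_le (phi : W -> C) : schwartz phi -> exists2 M, 0 <= M &
  forall x : W, normc (phi x) <= M * wW x.
Proof.
move=> sphi; have [_ [M HM]] := schwartz_good sW sphi.
by exists M => //; exact: (dominated_ge0 sW HM).
Qed.

(** The integrand of the Weyl formula, as a function of [(xi, y)]. *)
Definition weyl_integrand hbar f phi (x : W) (z : V) : C :=
  f (2^-1 *: (x + z.2), z.1) * expi (dotrV z.1 (x - z.2) / hbar) * phi z.2.

Lemma weylE hbar f phi x : weyl hbar f phi x =
  (((2 * pi * hbar) ^+ d)^-1)%:C * IV (weyl_integrand hbar f phi x).
Proof. by []. Qed.

Lemma weyl_integrand_good hbar f phi x : schwartz f -> schwartz phi ->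
  good wV (weyl_integrand hbar f phi x).
Proof.
move=> sf sphi; split.
  apply: ccontM; last by apply: (ccont_app (schwartz_cont sphi)); cont.
  apply: ccontM; last by apply: ccont_expi; cont.
  by apply: (ccont_app (schwartz_cont sf)); cont.
have [M M0 HM] := schwartz_phase_le sf; have [N N0 HN] := schwartz_row_le sphi.
exists (M * N) => z; rewrite !Normc.normcM normc_expi mulr1.
rewrite [leRHS](_ : _ = (M * wW z.1) * (N * wW z.2)); last by rewrite /weight_phase /weight_prod; ring.
by apply: ler_pM; rewrite ?normc_ge0.
Qed.

(** The integral kernel, up to normalization. *)
Definition weyl_kernel (hbar : R) (g : V -> C) (x y : W) : C :=
  IW (fun xi => g (2^-1 *: (x + y), xi) * expi (dotrV xi (x - y) / hbar)).

Lemma weyl_kernelE (hbar : R) (g : V -> C) (phi : W -> C) (x : W) : schwartz g -> schwartz phi ->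
  weyl hbar g phi x =
  (((2 * pi * hbar) ^+ d)^-1)%:C * IW (fun y => phi y * weyl_kernel hbar g x y).
Proof.
move=> sg sphi; rewrite weylE; have [cI [M HM]] := weyl_integrand_good hbar x sg sphi.
congr (_ * _); rewrite /int_phase /int_prod.
rewrite (fubini_rV (f := weyl_integrand hbar g phi x) cI (M := M)); last first.
  by move=> z; rewrite -mulrA; exact: HM.
congr IW; apply/funext => y; rewrite -(intZ sW).
  by congr IW; apply/funext => xi; rewrite /weyl_integrand/= mulrC.
apply: goodMexpi; last by cont.
exact: (slice_good _ (schwartz_good sV sg)).
Qed.

(** By partial Fourier inversion the kernel is the transform of [fhat f] in the
    first frequency only, evaluated at second frequency [(y - x) / hbar]; the
    change of variables [y = hbar *: b + x] makes that the second frequency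
    [b]. *)
Lemma weyl_oscE hbar f phi x : 0 < hbar -> schwartz f -> schwartz phi ->
  weyl hbar f phi x = weyl_osc hbar f phi x.
Proof.
move=> h0 sf sphi; rewrite weyl_kernelE//.
have hn0 : hbar != 0 by rewrite gt_eqF.
pose kap := weyl_kernel hbar f x; rewrite -/kap.
have gkap0 y : good wW (fun xi => f (2^-1 *: (x + y), xi) * expi (dotrV xi (x - y) / hbar)).
  apply: goodMexpi; last by cont.
  exact: (slice_good _ (schwartz_good sV sf)).
have [Mf Mf0 HMf] := schwartz_phase_le sf.
have ckap : ccont kap.
  apply: (int_param_cont sW (M := Mf) (F := fun z : W * W =>
     f (2^-1 *: (x + z.1), z.2) * expi (dotrV z.2 (x - z.1) / hbar))).
    apply: ccontM; last by apply: ccont_expi; cont.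
    by apply: (ccont_app (schwartz_cont sf)); cont.
  by move=> z; rewrite Normc.normcM normc_expi mulr1.
have [K K0 HK] := int_bound_gt0 sW.
have bkap y : normc (kap y) <= K * Mf.
  apply: HK; first by have [] := gkap0 y.
  by move=> xi; rewrite Normc.normcM normc_expi mulr1.
have kapE y : kap y = twopi%:C * IW (fun a => fhat f (a, hbar^-1 *: (y - x)) * expi (dotrV a (2^-1 *: (x + y)))).
  rewrite -fhat_partial//; congr IW; apply/funext => xi; congr (_ * expi _).
  by rewrite (pairZl spW) (pairC spW (y - x)) !(pairBr spW); ring.
have gphi (a : R) : 0 < a -> good wW (fun y => phi (a *: y + x)).
  move=> a0; apply: (rapid_good sW); first by apply: (ccont_app (schwartz_cont sphi)); cont.
  apply: (rapid_comp (K := 1 + a^-1 + a^-1 * `|x|)) (schwartz_rapid sphi) => y.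
  have : `|y| <= a^-1 * (`|a *: y + x| + `|x|).
    rewrite ler_pdivlMl// -[X in X * _]gtr0_norm// -normrZ -{1}(addrK x (a *: y)).
    exact: ler_normB.
  have := normr_ge0 x; have := normr_ge0 (a *: y + x).
  set u := `|a *: y + x|; set v := `|x|; have : 0 < a^-1 by rewrite invr_gt0.
  set b := a^-1 => b0 u0 v0; have : 0 <= b * v * u by rewrite !mulr_ge0// ltW.
  have := mulr_ge0 (ltW b0) v0; nra.
have gk (a : R) : 0 < a -> good wW (fun y => phi (a *: y + x) * kap (a *: y + x)).
  move=> a0; apply: (goodM (K := K * Mf)); first exact: gphi.
    by apply: (ccont_app ckap); cont.
  by move=> y; exact: bkap.
have g0 : good wW (fun y => phi y * kap y) by apply: (goodM (K := K * Mf)) => //; exact: (schwartz_good sW).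
have g1 : good wW (fun y => phi (y + x) * kap (y + x)).
  by have := gk 1 ltr01; under eq_fun do rewrite scale1r.
rewrite -(int_shift sW (a := x) g0 g1).
rewrite (int_scale sW h0 g1 (gk hbar h0)) mulrA -rmorphM/=.
rewrite -(intZ sW); last exact: gk.
rewrite /weyl_osc /osc_int /int_phase /int_prod.
pose F (z : W * W) := fhat f (z.1, z.2) * expi (hbar / 2 * dotrV z.1 z.2) *
   phi (hbar *: z.2 + x) * expi (dotrV z.1 x).
have cF : ccont F.
  apply: ccontM; last by apply: ccont_expi; cont.
  apply: ccontM; last by apply: (ccont_app (schwartz_cont sphi)); cont.
  apply: ccontM; last by apply: ccont_expi; cont.
  by apply: (ccont_app (fhat_cont sf)); cont.
have [Mp Mp0 HMp] := rapid_bounded (schwartz_rapid sphi).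
have [_ [Mh HMh]] := rapid_good sV (fhat_cont sf) (fhat_rapid sf).
have FM z : normc (F z) <= (Mh * Mp) * wW z.1 * wW z.2.
  have := HMh (z.1, z.2); rewrite /F; move: (fhat f _) => A hA.
  rewrite !Normc.normcM !normc_expi !mulr1.
  rewrite [leRHS](_ : _ = (Mh * wV (z.1, z.2)) * Mp); last by rewrite /weight_phase /weight_prod/=; ring.
  by apply: ler_pM; rewrite ?normc_ge0.
rewrite (fubini_rV cF FM); congr IW; apply/funext => b.
rewrite kapE (_ : hbar^-1 *: (hbar *: b + x - x) = b); last first.
  by rewrite addrK scalerA mulVf// scale1r.
have cE (k : R) (P S : C) : k%:C * (P * (twopi%:C * S)) = (k * twopi)%:C * (P * S).
  by rewrite rmorphM/=; ring.
rewrite cE (_ : _ * hbar ^+ d * twopi = 1) ?mul1r; last first.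
  rewrite -mulrA -exprMn [hbar * _]mulrC mulVf// expf_neq0// mulf_neq0//.
  by rewrite mulf_neq0// ?pnatr_eq0// gt_eqF// pi_gt0.
rewrite -(intZ sW); last first.
  apply: goodMexpi; last by cont.
  exact: (slicel_good b (rapid_good sV (fhat_cont sf) (fhat_rapid sf))).
congr IW; apply/funext => a; rewrite /F/= mulrC mulrAC.
have -> : dotrV a (2^-1 *: (x + (hbar *: b + x))) = hbar / 2 * dotrV a b + dotrV a x.
  by rewrite (pairZr spW) !(pairDr spW) (pairZr spW); field.
rewrite expiD; move: (fhat f _) => A; ring.
Qed.

End WeylCalculus.

(** * Moyal products *)

Section Moyal.
Context {R : realType} {d : nat}.
Local Notation C := R[i].
Local Notation W := 'rV[R]_d.
Local Notation V := ('rV[R]_d * 'rV[R]_d)%type.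
Local Notation IV := (@int_phase R d).
Local Notation wV := (@weight_phase R d).
Local Notation wW := (@weight_rV R d).
Implicit Types (f g : V -> C) (phi : W -> C) (hbar t : R).

Let sV := @integral_spec_phase R d.
Let sW := @integral_spec_rV R d.
Let spV := @pairing_spec_phase R d.

(** The direction in which a plane wave of frequency [eta] translates symbols:
    the Hamiltonian vector field of the linear form [dot_phase eta], which is the
    reason why the limit below is a Poisson bracket. *)
Definition symp (eta : V) : V := (eta.2, - eta.1).

Lemma symp_cont : continuous symp.
Proof. rewrite /symp; cont. Qed.

Lemma symp_norm eta : `|symp eta| <= `|eta|.
Proof. by apply: norm_pair_le; rewrite /= ?normrN ?norm_fst_le ?norm_snd_le. Qed.

(** For [t = hbar / 2] this is the Moyal product of [f] and [g]: the symbol [f]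
    is written as a superposition of plane waves, which act on [g] by translation. *)
Definition moyal_amp t f g : V -> V -> C := fun eta u => fhat f eta * g (t *: symp eta + u).
Definition moyal t f g : V -> C := osc_int IV (@dot_phase R d) id (moyal_amp t f g).

Lemma amplitude_moyal t f g : schwartz f -> schwartz g -> amplitude (moyal_amp t f g).
Proof.
move=> sf sg; apply: (amplitude_shift (B := fun eta => t *: symp eta) (KB := `|t|)) => //.
- exact: fhat_cont.
- exact: fhat_rapid.
- exact: continuous_scalef symp_cont.
- by move=> eta; rewrite normrZ ler_wpM2l// (le_trans (symp_norm eta))// lerDr.
Qed.

Let cid' : continuous (id : V -> V). Proof. exact: continuous_idf. Qed.
Let Hid (eta : V) : `|id eta| <= 1 * (1 + `|eta|).
Proof. by rewrite mul1r lerDr. Qed.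

Lemma moyal_schwartz t f g : schwartz f -> schwartz g -> schwartz (moyal t f g).
Proof.
by move=> sf sg; apply: (osc_int_schwartz sV spV cid' Hid); exact: amplitude_moyal.
Qed.

Lemma moyal_good t f g u : schwartz f -> schwartz g ->
  good wV (fun eta => moyal_amp t f g eta u * expi (dot_phase eta u)).
Proof.
by move=> sf sg; apply: (osc_integrand_good sV spV cid'); exact: amplitude_moyal.
Qed.

(** A derivative falls either on [g] or on the plane wave, and in the latter case
    it multiplies the density by a frequency, which differentiates [f]. *)
Lemma cderive_moyal t f g v : schwartz f -> schwartz g ->
  cderive v (moyal t f g) = fun u => moyal t (cderive v f) g u + moyal t f (cderive v g) u.
Proof.
move=> sf sg; apply: has_cderive_fun => u.
have := osc_int_has_cderive sV spV cid' Hid v u (amplitude_moyal t sf sg).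
rewrite (_ : osc_int _ _ _ _ u = moyal t (cderive v f) g u + moyal t f (cderive v g) u)//.
have [sf' sg'] := (schwartz_cderive v sf, schwartz_cderive v sg).
rewrite /moyal /osc_int -(intD sV); [|exact: moyal_good|exact: moyal_good].
congr IV; apply/funext => eta; rewrite /osc_deriv /moyal_amp fhat_cderive// -mulrDl.
congr (_ * _); rewrite addrC; congr (_ + _); first by rewrite mulrA.
apply: has_cderive_val; apply: has_cderiveZ.
apply: (has_cderive_comp_affine (L := fun u => t *: symp eta + u) (u := v)).
  by move=> h; rewrite addrCA.
exact: schwartz_has_cderive.
Qed.

Lemma schwartz_row_shift_le phi (c : W) : schwartz phi -> exists2 M, 0 <= M &
  forall y : W, normc (phi (y + c)) <= M * wW y.
Proof.
move=> sphi; have rs : rapid (fun y => phi (y + c)).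
  apply: (rapid_comp (K := 1 + `|c|)) (schwartz_rapid sphi) => y.
  have h1 : `|y| <= `|y + c| + `|c| by rewrite -{1}(addrK c y) ler_normB.
  have := normr_ge0 c; have := normr_ge0 (y + c); nra.
have [M M0 HM] := rapid_decay sW 0 rs.
by exists M => // y; have := HM y; rewrite expr0 mul1r.
Qed.

(** Domination of the integrands that arise from the Weyl formula by
    translations of the variables [(xi, y)]. *)
Lemma weyl_type_good f phi (L : V -> V) (r : V -> R) (c1 c2 : W) :
  schwartz f -> schwartz phi -> continuous L -> (forall z, (L z).2 = z.1 + c1) ->
  continuous r -> good wV (fun z => f (L z) * expi (r z) * phi (z.2 + c2)).
Proof.
move=> sf sphi cL HL cr; split.
  apply: ccontM; last by apply: (ccont_app (schwartz_cont sphi)); cont.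
  by apply: ccontM; [exact: (ccont_app (schwartz_cont sf))|exact: ccont_expi].
have [M M0 HM] := schwartz_phase_shift_le c1 sf.
have [N N0 HN] := schwartz_row_shift_le c2 sphi.
exists (M * N) => z; rewrite !Normc.normcM normc_expi mulr1.
rewrite [leRHS](_ : _ = (M * wW z.1) * (N * wW z.2)); last by rewrite /weight_phase /weight_prod; ring.
apply: ler_pM; rewrite ?normc_ge0//.
by rewrite (surjective_pairing (L z)) HL; exact: HM.
Qed.

Lemma weyl_schwartz hbar f phi : 0 < hbar -> schwartz f -> schwartz phi ->
  schwartz (weyl hbar f phi).
Proof.
move=> h0 sf sphi; rewrite (_ : weyl hbar f phi = weyl_osc hbar f phi).
  exact: weyl_osc_schwartz.
by apply/funext => x; exact: weyl_oscE.
Qed.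

(** Fubini brings the superposition of plane waves outside. The summand [0] in
    the argument of [phi] is the form in which the integrand is an instance of
    [weyl_type_good]. *)
Lemma weyl_moyal hbar t f g phi x : 0 < hbar -> schwartz f -> schwartz g -> schwartz phi ->
  weyl hbar (moyal t f g) phi x = IV (fun eta => fhat f eta *
    ((((2 * pi * hbar) ^+ d)^-1)%:C * IV (fun z =>
       g (t *: symp eta + (2^-1 *: (x + z.2), z.1)) *
       expi (dot_phase eta (2^-1 *: (x + z.2), z.1) + dotrV z.1 (x - z.2) / hbar) *
       phi (z.2 + 0)))).
Proof.
move=> h0 sf sg sphi; rewrite weylE.
set k := (_^-1)%:C.
pose q (z : V) : V := (2^-1 *: (x + z.2), z.1).
have cq : continuous q by rewrite /q; cont.
pose F (y : V * V) := moyal_amp t f g y.1 (q y.2) * expi (dot_phase y.1 (q y.2)) *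
   expi (dotrV y.2.1 (x - y.2.2) / hbar) * phi y.2.2.
have aG := amplitude_moyal t sf sg.
have cq2 : continuous (fun y : V * V => q y.2).
  exact: continuous_comp_fun (@continuous_snd _ _) cq.
have cF : ccont F.
  apply: ccontM; last by apply: (ccont_app (schwartz_cont sphi)); cont.
  apply: ccontM; last by apply: ccont_expi; cont.
  apply: ccontM; last first.
    apply: ccont_expi; apply: (continuous_pairing spV) => //; exact: continuous_fst.
  apply: (ccont_app (u := fun y : V * V => (y.1, q y.2)) (amplitude_cont aG)).
  exact: continuous_pair (@continuous_fst _ _) cq2.
have [m [K K0 HK]] := @weight_rV_decay R d.
have [M M0 HM] := amplitude_dominated sV m aG.
have [N N0 HN] := schwartz_row_le sphi.
have FM y : normc (F y) <= (M * K * N) * wV y.1 * wV y.2.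
  rewrite /F; have := HM (q y.2) y.1; move: (moyal_amp t f g y.1 (q y.2)) => A hA.
  rewrite !Normc.normcM !normc_expi !mulr1.
  have wy1 := weight_ge0 sV y.1.
  rewrite [leRHS](_ : _ = (M * (K * wW y.2.1) * wV y.1) * (N * wW y.2.2)); last first.
    by rewrite {2}/weight_phase /weight_prod; ring.
  apply: ler_pM; rewrite ?normc_ge0// (le_trans hA)// ler_wpM2r// ler_wpM2l//.
  apply: le_trans (HK y.2.1); rewrite lef_pV2 ?posrE ?exprn_gt0 ?ltr_pwDl//.
  by rewrite lerXn2r ?nnegrE ?addr_ge0// lerD2l; exact: (norm_snd_le (q y.2)).
transitivity (k * IV (fun z => IV (fun eta => F (eta, z)))).
  congr (_ * _); congr IV; apply/funext => z.
  rewrite /weyl_integrand /moyal /osc_int -mulrA mulrC -(intZ sV); last first.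
    exact: (moyal_good t (q z) sf sg).
  by congr IV; apply/funext => eta; rewrite /F/= /q; move: (moyal_amp _ _ _ _ _) => A; ring.
rewrite -(fubini_phase cF FM) -(intZ sV); last first.
  apply: (inner_good sV sV (f := F)); split; first exact: cF.
  by exists (M * K * N) => y; rewrite /weight_prod mulrA.
congr IV; apply/funext => eta; rewrite mulrCA; congr (_ * _).
rewrite -(intZ sV); last first.
  apply: (@weyl_type_good g phi (fun z => t *: symp eta + q z) _ (- (t *: eta.1)) 0) => //.
  - apply: continuous_addf => //; exact: continuous_cst_fun.
  - by move=> z; rewrite /= /q/= scalerN addrC.
  - apply: continuous_addf; last by cont.
    by apply: (continuous_pairing spV) => //; exact: continuous_cst_fun.
congr IV; apply/funext => z; rewrite /F/= /moyal_amp -/(q z) addr0 expiD.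
by move: (fhat f eta) => A; ring.
Qed.

End Moyal.

(** * Composition of Weyl operators *)

Section Composition.
Context {R : realType} {d : nat}.
Local Notation C := R[i].
Local Notation W := 'rV[R]_d.
Local Notation V := ('rV[R]_d * 'rV[R]_d)%type.
Local Notation IV := (@int_phase R d).
Local Notation wV := (@weight_phase R d).
Local Notation wW := (@weight_rV R d).
Implicit Types (f g : V -> C) (phi : W -> C) (hbar t : R).

Let sV := @integral_spec_phase R d.
Let spV := @pairing_spec_phase R d.
Let spW := @pairing_spec_dotrV R d.

(** The plane wave acts after the operator of [g]: its translation by
    [hbar *: eta.2] moves the output point, and a translation of [xi] by half of
    [hbar *: eta.1] absorbs the modulation. *)
Lemma plane_wave_left hbar g phi (eta : V) x : 0 < hbar -> schwartz g -> schwartz phi ->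
  expi (hbar / 2 * dotrV eta.1 eta.2) * expi (dotrV eta.1 x) *
    IV (weyl_integrand hbar g phi (hbar *: eta.2 + x)) =
  IV (fun z => g ((hbar / 2) *: symp eta + (2^-1 *: (x + z.2), z.1)) *
       expi (dot_phase eta (2^-1 *: (x + z.2), z.1) + dotrV z.1 (x - z.2) / hbar) *
       phi (z.2 + 0)).
Proof.
move=> h0 sg sphi; have hn0 : hbar != 0 by rewrite gt_eqF.
case: eta => a b /=.
set X := hbar *: b + x.
have g0 := weyl_integrand_good hbar X sg sphi.
pose s : V := (- (hbar / 2) *: a, 0).
have gs : good wV (fun z => weyl_integrand hbar g phi X (z + s)).
  apply: (@weyl_type_good _ _ g phi (fun z => (2^-1 *: (X + (z + s).2), (z + s).1))
    (fun z => dotrV (z + s).1 (X - (z + s).2) / hbar) s.1 s.2) => //; cont.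
rewrite -(int_shift sV g0 gs) -(intZ sV) //.
congr IV; apply/funext => z; rewrite /weyl_integrand /s/= addr0.
rewrite mulrA; congr (_ * _); rewrite [LHS]mulrCA; congr (_ * _).
  congr g; rewrite /symp/=; congr pair.
    by apply/rowP => j; rewrite /X/= !mxE; field.
  by apply/rowP => j; rewrite !mxE; ring.
rewrite -!expiD; congr expi.
rewrite /dot_phase /pair_prod/= /X !(pairDl spW) !(pairZl spW) !(pairBr spW) !(pairDr spW) !(pairZr spW) !(pairDr spW).
rewrite (pairC spW z.1 b); field.
exact: hn0.
Qed.

(** The plane wave acts before the operator of [g], so that [y] has to be
    translated as well, and the shift of the symbol changes sign. *)
Lemma plane_wave_right hbar g phi (eta : V) x : 0 < hbar -> schwartz g -> schwartz phi ->
  IV (fun z => g (2^-1 *: (x + z.2), z.1) *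
       expi (dotrV z.1 (x - z.2) / hbar + (hbar / 2 * dotrV eta.1 eta.2 + dotrV eta.1 z.2)) *
       phi (z.2 + hbar *: eta.2)) =
  IV (fun z => g ((- (hbar / 2)) *: symp eta + (2^-1 *: (x + z.2), z.1)) *
       expi (dot_phase eta (2^-1 *: (x + z.2), z.1) + dotrV z.1 (x - z.2) / hbar) *
       phi (z.2 + 0)).
Proof.
move=> h0 sg sphi; have hn0 : hbar != 0 by rewrite gt_eqF.
case: eta => a b /=.
pose H (z : V) := g ((- (hbar / 2)) *: symp (a, b) + (2^-1 *: (x + z.2), z.1)) *
       expi (dot_phase (a, b) (2^-1 *: (x + z.2), z.1) + dotrV z.1 (x - z.2) / hbar) *
       phi (z.2 + 0).
have cq : continuous (fun z : V => (2^-1 *: (x + z.2), z.1)) by cont.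
have gH : good wV H.
  apply: (@weyl_type_good _ _ g phi _ _ (hbar / 2 *: a) 0) => //.
  - apply: continuous_addf => //; exact: continuous_cst_fun.
  - by move=> z; rewrite /= scaleNr scalerN opprK addrC.
  - apply: continuous_addf; last by cont.
    by apply: (continuous_pairing spV) => //; exact: continuous_cst_fun.
pose s : V := (- (hbar / 2) *: a, hbar *: b).
have E z : H (z + s) = g (2^-1 *: (x + z.2), z.1) *
       expi (dotrV z.1 (x - z.2) / hbar + (hbar / 2 * dotrV a b + dotrV a z.2)) *
       phi (z.2 + hbar *: b).
  rewrite /H /s/= addr0; congr (_ * _); congr (_ * _).
    congr g; rewrite /symp/=; congr pair.
      by apply/rowP => j; rewrite !mxE; field.
    by apply/rowP => j; rewrite !mxE; ring.
  congr expi; rewrite /dot_phase /pair_prod/=.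
  rewrite !(pairDl spW) !(pairZl spW) !(pairBr spW) !(pairDr spW) !(pairZr spW) !(pairDr spW) !(pairZr spW).
  rewrite (pairC spW z.1 b) (pairC spW b a); field.
  exact: hn0.
have gs : good wV (fun z => H (z + s)).
  under eq_fun do rewrite E.
  apply: (@weyl_type_good _ _ g phi _ _ 0 (hbar *: b)) => //; last by cont.
  by move=> z; rewrite /= addr0.
rewrite -(int_shift sV gH gs); congr IV; apply/funext => z.
by rewrite E.
Qed.

(** The outer operator is a superposition of plane waves, to each of which
    [plane_wave_left] applies. *)
Lemma weyl_compose hbar f g phi x : 0 < hbar -> schwartz f -> schwartz g -> schwartz phi ->
  weyl hbar f (weyl hbar g phi) x = weyl hbar (moyal (hbar / 2) f g) phi x.
Proof.
move=> h0 sf sg sphi; rewrite weyl_oscE//; last exact: weyl_schwartz.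
rewrite weyl_moyal// /weyl_osc /osc_int; congr IV; apply/funext => eta.
rewrite -plane_wave_left// weylE; move: (fhat f eta) => A; ring.
Qed.

(** Here the inner operator is the superposition, so Fubini is needed before
    [plane_wave_right]. *)
Lemma weyl_compose_rev hbar f g phi x : 0 < hbar -> schwartz f -> schwartz g -> schwartz phi ->
  weyl hbar g (weyl hbar f phi) x = weyl hbar (moyal (- (hbar / 2)) f g) phi x.
Proof.
move=> h0 sf sg sphi; rewrite weyl_moyal// weylE.
set k := (_^-1)%:C.
pose F (y : V * V) := fhat f y.1 * expi (hbar / 2 * dotrV y.1.1 y.1.2) *
   phi (hbar *: y.1.2 + y.2.2) * expi (dotrV y.1.1 y.2.2) *
   (g (2^-1 *: (x + y.2.2), y.2.1) * expi (dotrV y.2.1 (x - y.2.2) / hbar)).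
have cF : ccont F.
  apply: ccontM.
    apply: ccontM; last by apply: ccont_expi; cont.
    apply: ccontM; last by apply: (ccont_app (schwartz_cont sphi)); cont.
    apply: ccontM; last by apply: ccont_expi; cont.
    by apply: (ccont_app (fhat_cont sf)); cont.
  apply: ccontM; last by apply: ccont_expi; cont.
  by apply: (ccont_app (schwartz_cont sg)); cont.
have aG := amplitude_weyl hbar sf sphi.
have [m [K K0 HK]] := @weight_rV_decay R d.
have [M M0 HM] := amplitude_dominated sV m aG.
have [N N0 HN] := schwartz_phase_le sg.
have FM y : normc (F y) <= (M * K * N) * wV y.1 * wV y.2.
  rewrite /F; have := HM y.2.2 y.1; move: (fhat f y.1) => A hA.
  rewrite Normc.normcM [normc (_ * expi (dotrV _ _))]Normc.normcM normc_expi mulr1.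
  rewrite [normc (_ * expi _)]Normc.normcM normc_expi mulr1.
  have wy1 := weight_ge0 sV y.1.
  rewrite [leRHS](_ : _ = (M * (K * wW y.2.2) * wV y.1) * (N * wW y.2.1)); last first.
    by rewrite {2}/weight_phase /weight_prod; ring.
  apply: ler_pM; rewrite ?normc_ge0// (le_trans hA)// ler_wpM2r// ler_wpM2l//.
transitivity (k * IV (fun z => IV (fun eta => F (eta, z)))).
  congr (_ * _); congr IV; apply/funext => z.
  rewrite /weyl_integrand weyl_oscE// /weyl_osc /osc_int -(intZ sV); last first.
    have cfst : continuous (fst : V -> W) by exact: continuous_fst.
    exact: (osc_integrand_good sV spW cfst z.2 aG).
  by congr IV; apply/funext => eta; rewrite /F/=; move: (fhat f _) => A; ring.
rewrite -(fubini_phase cF FM) -(intZ sV); last first.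
  apply: (inner_good sV sV (f := F)); split; first exact: cF.
  by exists (M * K * N) => y; rewrite /weight_prod mulrA.
congr IV; apply/funext => eta; rewrite mulrCA; congr (_ * _).
rewrite -plane_wave_right// -(intZ sV); last first.
  apply: (@weyl_type_good _ _ g phi _ _ 0 (hbar *: eta.2)) => //; try by cont.
  by move=> z; rewrite /= addr0.
congr IV; apply/funext => z; rewrite /F/= !expiD [z.2 + _]addrC.
by move: (fhat f eta) => A; ring.
Qed.

End Composition.

(** * The classical limit of one quantum bracket *)

(* Keeps conversion from unfolding iterated derivatives down to limits. *)
Local Opaque cderive.

Section Taylor.
Context {R : realType} {V : normedModType R}.
Local Notation C := R[i].

(** The mean value inequality, used on [f'] and then on the remainder. *)
Lemma ctaylor1 (v : V) (f f' f'' : V -> C) x (h M : R) :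
  (forall y, has_cderive v f y (f' y)) -> (forall y, has_cderive v f' y (f'' y)) ->
  (forall y, normc (f'' y) <= M) ->
  normc (f (h *: v + x) - f x - h%:C * f' x) <= 4 * M * `|h| ^+ 2.
Proof.
move=> df df' f''M.
have M0 : 0 <= M by exact: le_trans (normc_ge0 _) (f''M x).
pose F (s : R^o) : C := f (s *: v + x) - s%:C * f' x.
have dF (s : R^o) : has_cderive (1 : R^o) F s (f' (s *: v + x) - f' x).
  apply: has_cderiveD.
    apply: (has_cderive_comp_affine (L := fun s : R^o => s *: v + x) (u := v)) => // h'.
    by rewrite scalerDl -addrA /GRing.scale/= mulr1.
  apply: has_cderive_affine => h'.
  by rewrite /GRing.scale/= mulr1 rmorphD/=; ring.
have e1 (s : R) : (s *: (1 : R^o) + 0 : R^o) = s by rewrite addr0 /GRing.scale/= mulr1.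
have : normc (F h - F 0) <= 2 * (2 * M * `|h|) * `|h|.
  rewrite -{1}(e1 h).
  apply: (cmean_value (f' := fun s : R^o => f' (s *: v + x) - f' x)) => [s|s sh]; rewrite e1.
    exact: dF.
  apply: le_trans (_ : _ <= 2 * M * `|s|) _; last by rewrite ler_wpM2l// mulr_ge0.
  exact: (cmean_value (f' := f'')).
rewrite /F scale0r add0r mul0r subr0 [f _ - _ - f _]addrAC => H.
by rewrite (le_trans H)// le_eqVlt; apply/orP; left; apply/eqP; ring.
Qed.

End Taylor.

Section BracketLimit.
Context {R : realType} {d : nat}.
Local Notation C := R[i].
Local Notation W := 'rV[R]_d.
Local Notation V := ('rV[R]_d * 'rV[R]_d)%type.
Local Notation IV := (@int_phase R d).
Implicit Types (f g : V -> C) (phi : W -> C) (hbar t : R).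

Let sV := @integral_spec_phase R d.
Let spV := @pairing_spec_phase R d.
Let invV := @fourier_inversion_phase R d.

Lemma weyl_lin hbar a b f g phi x : schwartz f -> schwartz g -> schwartz phi ->
  weyl hbar (fun u => a * f u + b * g u) phi x = a * weyl hbar f phi x + b * weyl hbar g phi x.
Proof.
move=> sf sg sphi; rewrite !weylE.
have gf := weyl_integrand_good hbar x sf sphi.
have gg := weyl_integrand_good hbar x sg sphi.
have -> : weyl_integrand hbar (fun u => a * f u + b * g u) phi x =
  (fun z => a * weyl_integrand hbar f phi x z + b * weyl_integrand hbar g phi x z).
  by apply/funext => z; rewrite /weyl_integrand; ring.
by rewrite (intD sV) ?(intZ sV)//; try exact: goodZ; ring.
Qed.

Lemma weyl0 hbar phi x : weyl hbar (fun _ : V => 0) phi x = 0.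
Proof.
rewrite weylE (_ : weyl_integrand _ _ _ _ = fun=> 0); first by rewrite (int0 sV) mulr0.
by apply/funext => z; rewrite /weyl_integrand !mul0r.
Qed.

Lemma weyl_sum hbar (J : Type) (s : seq J) (F : J -> V -> C) phi x :
  (forall j, schwartz (F j)) -> schwartz phi ->
  weyl hbar (fun u => \sum_(j <- s) F j u) phi x = \sum_(j <- s) weyl hbar (F j) phi x.
Proof.
move=> sF sphi; elim: s => [|j s IH].
  by under eq_fun do rewrite big_nil; rewrite weyl0 big_nil.
rewrite big_cons -IH; under eq_fun do rewrite big_cons.
have := weyl_lin hbar 1 1 x (sF j) (schwartz_sum s xpredT sF) sphi.
by under eq_fun do rewrite !mul1r; rewrite !mul1r.
Qed.

(** The symbol of the quantum bracket of two Weyl operators. *)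
Definition moyal_bracket hbar f g : V -> C := fun u =>
  ('i * hbar%:C)^-1 * (moyal (hbar / 2) f g u - moyal (- (hbar / 2)) f g u).

Lemma moyal_bracketE hbar f g : moyal_bracket hbar f g = fun u =>
  ('i * hbar%:C)^-1 * moyal (hbar / 2) f g u + - ('i * hbar%:C)^-1 * moyal (- (hbar / 2)) f g u.
Proof. by apply/funext => u; rewrite /moyal_bracket mulrBr mulNr. Qed.

Lemma moyal_bracket_schwartz hbar f g : schwartz f -> schwartz g ->
  schwartz (moyal_bracket hbar f g).
Proof.
by move=> sf sg; rewrite moyal_bracketE; apply: schwartz_lin; exact: moyal_schwartz.
Qed.

Lemma qbracket_weyl hbar f g phi x : 0 < hbar -> schwartz f -> schwartz g -> schwartz phi ->
  qbracket hbar (weyl hbar f) (weyl hbar g) phi x = weyl hbar (moyal_bracket hbar f g) phi x.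
Proof.
move=> h0 sf sg sphi; rewrite moyal_bracketE weyl_lin//; try exact: moyal_schwartz.
by rewrite /qbracket weyl_compose// weyl_compose_rev// mulrBr mulNr.
Qed.

Lemma cderive_moyal_bracket hbar f g v : schwartz f -> schwartz g ->
  cderive v (moyal_bracket hbar f g) =
  fun u => moyal_bracket hbar (cderive v f) g u + moyal_bracket hbar f (cderive v g) u.
Proof.
move=> sf sg; rewrite moyal_bracketE; apply: has_cderive_fun => u.
have D t := schwartz_has_cderive v u (moyal_schwartz t sf sg).
have := has_cderiveD (has_cderiveZ ('i * hbar%:C)^-1 (D (hbar / 2)))
  (has_cderiveZ (- ('i * hbar%:C)^-1) (D (- (hbar / 2)))).
rewrite (cderive_moyal (hbar / 2) v sf sg) (cderive_moyal (- (hbar / 2)) v sf sg).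
congr (has_cderive _ _ _ _); rewrite /moyal_bracket.
move: (moyal _ (cderive v f) g u) (moyal _ f (cderive v g) u).
move: (moyal _ (cderive v f) g u) (moyal _ f (cderive v g) u) => a b a' b'; ring.
Qed.

(** Makes the stability of Schwartz functions under products a special case of
    their stability under Moyal products. *)
Lemma moyal0 f g : schwartz f -> schwartz g -> moyal 0 f g = fun u => f u * g u.
Proof.
move=> sf sg; apply/funext => u; rewrite /moyal /osc_int -(fhat_inv u sf) mulrC -(intZ sV).
  by congr IV; apply/funext => eta; rewrite /moyal_amp scale0r add0r; move: (fhat f eta) => A; ring.
apply: goodMexpi; first exact: (rapid_good sV (fhat_cont sf) (fhat_rapid sf)).
exact: (continuous_pairing_cstl spV).
Qed.

Lemma schwartzM f g : schwartz f -> schwartz g -> schwartz (fun u => f u * g u).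
Proof. by move=> sf sg; rewrite -moyal0//; exact: moyal_schwartz. Qed.

(** The coordinate directions of position and of momentum. *)
Definition ex (j : 'I_d) : V := (delta_mx 0 j, 0).
Definition exi (j : 'I_d) : V := (0, delta_mx 0 j).

Lemma poissonE f g : poisson f g = fun u => \sum_(j < d)
  (cderive (ex j) f u * cderive (exi j) g u - cderive (exi j) f u * cderive (ex j) g u).
Proof. by []. Qed.

(** The coordinates of [symp eta] are the frequencies up to sign, which is how
    the derivative along it becomes a Poisson bracket after Fourier inversion. *)
Lemma symp_basis (eta : V) :
  symp eta = \sum_(j < d) (eta.2 0 j *: ex j + (- eta.1 0 j) *: exi j).
Proof.
have fstD (z z' : V) : (z + z').1 = z.1 + z'.1 by [].
have sndD (z z' : V) : (z + z').2 = z.2 + z'.2 by [].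
have fst_sum (F : 'I_d -> V) : (\sum_j F j).1 = \sum_j (F j).1.
  by elim/big_rec2: _ => // j x y _ <-.
have snd_sum (F : 'I_d -> V) : (\sum_j F j).2 = \sum_j (F j).2.
  by elim/big_rec2: _ => // j x y _ <-.
rewrite [RHS]surjective_pairing fst_sum snd_sum /symp; congr pair.
- rewrite [LHS]row_sum_delta; apply: eq_bigr => j _.
  by rewrite fstD/= scaler0 addr0.
- rewrite [LHS]row_sum_delta; apply: eq_bigr => j _.
  by rewrite sndD/= scaler0 add0r mxE.
Qed.

Local Opaque ex exi.

Lemma cderive_phaseC u v f : schwartz f -> cderive u (cderive v f) = cderive v (cderive u f).
Proof. exact: (cderiveC sV spV invV (@twopi2_neq0 R d)). Qed.

Lemma poisson_schwartz f g : schwartz f -> schwartz g -> schwartz (poisson f g).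
Proof.
move=> sf sg; rewrite poissonE; apply: schwartz_sum => j.
by apply: schwartzB; apply: schwartzM; exact: schwartz_cderive.
Qed.

Lemma cderive_poisson f g v : schwartz f -> schwartz g ->
  cderive v (poisson f g) = fun u => poisson (cderive v f) g u + poisson f (cderive v g) u.
Proof.
move=> sf sg.
have -> : cderive v (poisson f g) = iter_cderive [:: v] (poisson f g) by [].
rewrite !poissonE iter_cderive_sum; last first.
  by move=> j; apply: schwartzB; apply: schwartzM; exact: schwartz_cderive.
apply/funext => u; rewrite -big_split/=; apply: eq_bigr => j _.
have H (F G : V -> C) : schwartz F -> schwartz G ->
    has_cderive v (fun y => F y * G y) u (cderive v F u * G u + F u * cderive v G u).
  by move=> sF sG; apply: has_cderiveM; exact: schwartz_has_cderive.
have h1 := H _ _ (schwartz_cderive (ex j) sf) (schwartz_cderive (exi j) sg).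
have h2 := has_cderiveZ (-1) (H _ _ (schwartz_cderive (exi j) sf) (schwartz_cderive (ex j) sg)).
have := has_cderive_val (has_cderiveD h1 h2).
under eq_fun do rewrite mulN1r.
move=> /= ->.
rewrite (cderive_phaseC v (ex j) sf) (cderive_phaseC v (exi j) sf).
rewrite (cderive_phaseC v (ex j) sg) (cderive_phaseC v (exi j) sg).
by rewrite mulN1r opprD addrACA.
Qed.

Lemma cderive_symp eta g u : schwartz g -> cderive (symp eta) g u =
  \sum_(j < d) ((eta.2 0 j)%:C * cderive (ex j) g u - (eta.1 0 j)%:C * cderive (exi j) g u).
Proof.
move=> sg; rewrite symp_basis.
have dirD v w : cderive (v + w) g u = cderive v g u + cderive w g u.
  by rewrite (cderive_dirD sV spV invV (@twopi2_neq0 R d)).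
have dirZ (a : R) v : cderive (a *: v) g u = a%:C * cderive v g u.
  by rewrite (cderive_dirZ sV spV invV (@twopi2_neq0 R d)).
have dir0 : cderive 0 g u = 0 by rewrite -(scale0r 0) dirZ mul0r.
elim/big_rec2: _ => [//|j x y _ <-].
by rewrite !dirD !dirZ rmorphN mulNr.
Qed.

End BracketLimit.

Section BracketConvergence.
Context {R : realType} {d : nat}.
Local Notation C := R[i].
Local Notation W := 'rV[R]_d.
Local Notation V := ('rV[R]_d * 'rV[R]_d)%type.
Local Notation IV := (@int_phase R d).
Local Notation wV := (@weight_phase R d).

Let sV := @integral_spec_phase R d.
Let spV := @pairing_spec_phase R d.

Lemma dotrV_delta (x : W) (j : 'I_d) : dotrV x (delta_mx 0 j) = x 0 j.
Proof.
rewrite /dotrV (bigD1 j)//= big1 ?addr0; first by rewrite mxE !eqxx mulr1.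
by move=> i ij; rewrite mxE (negbTE ij) mulr0.
Qed.

Lemma dot_phase_ex (eta : V) (j : 'I_d) : dot_phase eta (ex j) = eta.1 0 j.
Proof. by rewrite /dot_phase /pair_prod/= dotrV_delta (pair0r (@pairing_spec_dotrV R d)) addr0. Qed.

Lemma dot_phase_exi (eta : V) (j : 'I_d) : dot_phase eta (exi j) = eta.2 0 j.
Proof. by rewrite /dot_phase /pair_prod/= dotrV_delta (pair0r (@pairing_spec_dotrV R d)) add0r. Qed.

Local Opaque ex exi symp.

(** The mode of convergence in which brackets can be iterated: the uniform bounds
    are those of dominated convergence, and all derivatives are included because
    a bracket loses one. *)
Definition converges (g_ : nat -> V -> C) (g : V -> C) :=
  [/\ forall k, schwartz (g_ k), schwartz g &
    forall vs, (exists M, forall k u, normc (iter_cderive vs (g_ k) u) <= M) /\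
      forall u, clim \oo (fun k => iter_cderive vs (g_ k) u) (iter_cderive vs g u)].

Lemma converges_cst (f : V -> C) : schwartz f -> converges (fun=> f) f.
Proof.
move=> sf; split=> // vs; split; last by move=> u; exact: clim_cst.
have [M _ HM] := rapid_bounded (schwartz_rapid (schwartz_iter vs sf)).
by exists M => _.
Qed.

Lemma converges_cderive (v : V) (g_ : nat -> V -> C) (g : V -> C) : converges g_ g ->
  converges (fun k => cderive v (g_ k)) (cderive v g).
Proof.
move=> [s_ s H]; split; [by move=> k; exact: schwartz_cderive|exact: schwartz_cderive|].
move=> vs; have [[M HM] L] := H (rcons vs v); split.
  by exists M => k u; rewrite -iter_cderive_rcons.
move=> u; rewrite -iter_cderive_rcons; apply: clim_ext (L u) => k.
by rewrite iter_cderive_rcons.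
Qed.

Lemma converges_sum (J : Type) (s : seq J) (P : pred J)
    (G_ : nat -> J -> V -> C) (G : J -> V -> C) :
  (forall j, converges (fun k => G_ k j) (G j)) ->
  converges (fun k u => \sum_(j <- s | P j) G_ k j u) (fun u => \sum_(j <- s | P j) G j u).
Proof.
move=> H; have s_ k j : schwartz (G_ k j) by have [] := H j.
have sG j : schwartz (G j) by have [] := H j.
split=> [k||vs]; [exact: schwartz_sum|exact: schwartz_sum|split].
  have /choice[M HM] j : exists M, forall k u, normc (iter_cderive vs (G_ k j) u) <= M.
    by have [_ _ /(_ vs)[]] := H j.
  exists (\sum_(j <- s | P j) M j) => k u; rewrite iter_cderive_sum//.
  by rewrite (le_trans (normc_sum _ _ _))// ler_sum.
move=> u; rewrite iter_cderive_sum//; under eq_fun do rewrite iter_cderive_sum//.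
by apply: clim_sum => j; have [_ _ /(_ vs)[]] := H j.
Qed.

Lemma convergesZ (c : C) (g_ : nat -> V -> C) (g : V -> C) : converges g_ g ->
  converges (fun k u => c * g_ k u) (fun u => c * g u).
Proof.
move=> [s_ s H]; split=> [k||vs]; [exact: schwartzZ|exact: schwartzZ|split].
  have [[M HM] _] := H vs; exists (normc c * M) => k u.
  by rewrite iter_cderiveZ// Normc.normcM ler_wpM2l// normc_ge0.
move=> u; rewrite iter_cderiveZ//; under eq_fun do rewrite iter_cderiveZ//.
by apply: climZ; have [_] := H vs.
Qed.

Lemma cderive_symp_le (g : V -> C) (a b : 'I_d -> R) (eta u : V) : schwartz g ->
  (forall j, normc (cderive (ex j) g u) <= a j) ->
  (forall j, normc (cderive (exi j) g u) <= b j) ->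
  normc (cderive (symp eta) g u) <= (\sum_j (a j + b j)) * `|eta|.
Proof.
move=> sg ha hb; rewrite cderive_symp// mulr_suml (le_trans (normc_sum _ _ _))//.
apply: ler_sum => j _; rewrite (le_trans (le_normcD _ _))// mulrDl normcN.
by apply: lerD; rewrite Normc.normcM normc_real mulrC ler_pM ?normc_ge0//;
  rewrite (le_trans (row_entry_le _ _))// ?norm_snd_le ?norm_fst_le.
Qed.

(** Along [symp eta] the bounds grow like powers of [`|eta|], which the rapid
    decrease of [fhat f] absorbs. *)
Lemma converges_symp1 (g_ : nat -> V -> C) (g : V -> C) : converges g_ g ->
  exists2 B, 0 <= B & forall k eta u, normc (cderive (symp eta) (g_ k) u) <= B * `|eta|.
Proof.
move=> [s_ s H].
have B (e : 'I_d -> V) : exists a : 'I_d -> R, forall j k u, normc (cderive (e j) (g_ k) u) <= a j.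
  have /choice[a Ha] j : exists a, forall k u, normc (cderive (e j) (g_ k) u) <= a.
    by have [] := H [:: e j].
  by exists a.
have [a Ha] := B ex; have [b Hb] := B exi.
exists (\sum_j (a j + b j)) => [|k eta u]; last first.
  by apply: cderive_symp_le => // j.
apply: sumr_ge0 => j _; apply: addr_ge0.
- exact: le_trans (normc_ge0 _) (Ha j 0%N 0).
- exact: le_trans (normc_ge0 _) (Hb j 0%N 0).
Qed.

Lemma converges_symp2 (g_ : nat -> V -> C) (g : V -> C) : converges g_ g ->
  exists2 B, 0 <= B & forall k eta u,
    normc (cderive (symp eta) (cderive (symp eta) (g_ k)) u) <= B * `|eta| ^+ 2.
Proof.
move=> cg; have s_ k : schwartz (g_ k) by have [] := cg.
have B (e : 'I_d -> V) : exists a : 'I_d -> R, forall j, 0 <= a j /\ forall k eta u,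
    normc (cderive (e j) (cderive (symp eta) (g_ k)) u) <= a j * `|eta|.
  have /choice[a Ha] j : exists a, 0 <= a /\ forall k eta u,
      normc (cderive (e j) (cderive (symp eta) (g_ k)) u) <= a * `|eta|.
    have [a a0 Ha] := converges_symp1 (converges_cderive (e j) cg); exists a; split; first exact: a0.
    by move=> k eta u; rewrite cderive_phaseC//; exact: Ha.
  by exists a.
have [a Ha] := B ex; have [b Hb] := B exi.
exists (\sum_j (a j + b j)) => [|k eta u].
  by apply: sumr_ge0 => j _; rewrite addr_ge0//; [have [] := Ha j|have [] := Hb j].
rewrite expr2 mulrA.
have -> : (\sum_j (a j + b j)) * `|eta| = \sum_j (a j * `|eta| + b j * `|eta|).
  by rewrite mulr_suml; apply: eq_bigr => j _; rewrite mulrDl.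
apply: cderive_symp_le; first exact: schwartz_cderive.
- by move=> j; have [_] := Ha j.
- by move=> j; have [_] := Hb j.
Qed.

Lemma cderive_symp_cont (g : V -> C) (u : V) : schwartz g ->
  ccont (fun eta => cderive (symp eta) g u).
Proof.
move=> sg eta; rewrite cderive_symp//; under eq_fun do rewrite cderive_symp//.
apply: clim_sum => j; apply: climB; apply: climM; try exact: clim_cst; apply: clim_real.
- exact: (continuous_comp_fun (@continuous_snd _ _) (@coord_continuous _ 1 d 0 j)).
- exact: (continuous_comp_fun (@continuous_fst _ _) (@coord_continuous _ 1 d 0 j)).
Qed.

Definition diff_quot (h : R) (g : V -> C) (eta u : V) : C :=
  ('i * h%:C)^-1 * (g ((h / 2) *: symp eta + u) - g ((- (h / 2)) *: symp eta + u)).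

Lemma normc_inv_ih (h : R) : 0 < h -> normc ('i * h%:C)^-1 = h^-1.
Proof.
move=> h0; have n0 : 'i * h%:C != 0 :> C.
  by rewrite mulf_neq0 ?neq0Ci// eq_complex/= eqxx andbT gt_eqF.
have : normc (('i * h%:C)^-1 * ('i * h%:C)) = 1 by rewrite mulVf// Normc.normc1.
rewrite !Normc.normcM normc_i mul1r normc_real (gtr0_norm h0) => /(canRL (mulfK _)) -> //.
  by rewrite div1r.
by rewrite gt_eqF.
Qed.

Lemma diff_quot_cont (h : R) (g : V -> C) (u : V) : schwartz g ->
  ccont (fun eta => diff_quot h g eta u).
Proof.
move=> sg; have H (a : R) : ccont (fun eta => g (a *: symp eta + u)).
  apply: (ccont_app (schwartz_cont sg)); apply: continuous_addf; last exact: continuous_cst_fun.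
  exact: continuous_scalef symp_cont.
by move=> eta; apply: climZ; apply: climB; exact: H.
Qed.

Lemma diff_quot_le (h B : R) (g : V -> C) (eta u : V) : 0 < h -> schwartz g ->
  (forall u, normc (cderive (symp eta) g u) <= B) -> normc (diff_quot h g eta u) <= 2 * B.
Proof.
move=> h0 sg gB; rewrite /diff_quot Normc.normcM normc_inv_ih// ler_pdivrMl//.
have -> : (h / 2) *: symp eta + u = h *: symp eta + ((- (h / 2)) *: symp eta + u).
  by rewrite addrA -scalerDl; congr (_ *: _ + _); field.
apply: le_trans (_ : _ <= 2 * B * `|h|) _; last by rewrite (gtr0_norm h0) mulrC.
apply: (cmean_value (f' := cderive (symp eta) g)) => [s|s _]; last exact: gB.
exact: schwartz_has_cderive.
Qed.

Lemma diff_quot_lim (h B : R) (g : V -> C) (eta u : V) : 0 < h -> schwartz g ->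
  (forall u, normc (cderive (symp eta) (cderive (symp eta) g) u) <= B) ->
  normc (diff_quot h g eta u - - 'i * cderive (symp eta) g u) <= 2 * B * h.
Proof.
move=> h0 sg gB; have d1 y := schwartz_has_cderive (symp eta) y sg.
have d2 y := schwartz_has_cderive (symp eta) y (schwartz_cderive (symp eta) sg).
have := ctaylor1 u (h / 2) d1 d2 gB; have := ctaylor1 u (- (h / 2)) d1 d2 gB.
rewrite rmorphN /diff_quot normrN ger0_norm; last by rewrite divr_ge0// ltW.
move: (g ((- (h / 2)) *: symp eta + u)) (g ((h / 2) *: symp eta + u)) => gm gp.
move: (g u) (cderive (symp eta) g u) => g0 g1 H1 H2.
have hC : h%:C != 0 :> C by rewrite eq_complex/= eqxx andbT gt_eqF.
have iN : (- 'i : C) = ('i)^-1 by rewrite invCi.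
have -> : ('i * h%:C)^-1 * (gp - gm) - - 'i * g1 = ('i * h%:C)^-1 *
   ((gp - g0 - (h / 2)%:C * g1) - (gm - g0 - - (h / 2)%:C * g1)).
  have -> : (h / 2)%:C = h%:C / 2 :> C by rewrite rmorphM/= fmorphV/= rmorph_nat.
  by rewrite iN; field; rewrite hC; exact: neq0Ci.
rewrite Normc.normcM normc_inv_ih// ler_pdivrMl//.
rewrite (le_trans (le_normcD _ _))// normcN (le_trans (lerD H2 H1))//.
by rewrite le_eqVlt; apply/orP; left; apply/eqP; field.
Qed.

Lemma moyal_bracket_diff_quot (h : R) (f g : V -> C) (u : V) : schwartz f -> schwartz g ->
  moyal_bracket h f g u =
  IV (fun eta => fhat f eta * diff_quot h g eta u * expi (dot_phase eta u)).
Proof.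
move=> sf sg; rewrite /moyal_bracket /moyal /osc_int -(intB sV); try exact: moyal_good.
rewrite -(intZ sV).
  congr IV; apply/funext => eta; rewrite /moyal_amp /diff_quot; move: (fhat f eta) => A; ring.
have gg := goodD (moyal_good (h / 2) u sf sg) (goodZ (-1) (moyal_good (- (h / 2)) u sf sg)).
by move: gg; under eq_fun do rewrite mulN1r.
Qed.

(** Multiplying [fhat f] by the coordinates of [eta] differentiates [f]. *)
Lemma int_symp_poisson (f g : V -> C) (u : V) : schwartz f -> schwartz g ->
  IV (fun eta => fhat f eta * (- 'i * cderive (symp eta) g u) * expi (dot_phase eta u)) =
  poisson f g u.
Proof.
move=> sf sg.
have gF (v : V) : good wV (fun eta => fhat (cderive v f) eta * expi (dot_phase eta u)).
  have sf' := schwartz_cderive v sf.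
  apply: goodMexpi; first exact: (rapid_good sV (fhat_cont sf') (fhat_rapid sf')).
  exact: (continuous_pairing_cstl spV).
rewrite poissonE.
transitivity (IV (fun eta => \sum_(j < d)
   (cderive (exi j) g u * (fhat (cderive (ex j) f) eta * expi (dot_phase eta u)) -
    cderive (ex j) g u * (fhat (cderive (exi j) f) eta * expi (dot_phase eta u))))).
  congr IV; apply/funext => eta; rewrite cderive_symp//.
  rewrite mulrA mulr_sumr mulr_suml.
  apply: eq_bigr => j _; rewrite !fhat_cderive// dot_phase_ex dot_phase_exi.
  by move: (fhat f eta) (cderive _ _ _) (cderive _ _ _) (expi _) => A B D e; ring.
rewrite (int_sum sV); last first.
  move=> j; have := goodD (goodZ (cderive (exi j) g u) (gF (ex j)))
    (goodZ (- cderive (ex j) g u) (gF (exi j))).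
  by under eq_fun do rewrite mulNr.
apply: eq_bigr => j _; rewrite (intB sV (goodZ _ (gF (ex j))) (goodZ _ (gF (exi j)))).
have E v c : IV (fun eta => c * (fhat (cderive v f) eta * expi (dot_phase eta u))) =
    c * cderive v f u.
  by rewrite (intZ sV _ (gF v)) (fhat_inv u (schwartz_cderive v sf)).
have E1 := E (ex j) (cderive (exi j) g u); have E2 := E (exi j) (cderive (ex j) g u).
have swap (a b x y x' y' : C) : x = a * x' -> y = b * y' -> x - y = x' * a - y' * b.
  by move=> -> ->; rewrite (mulrC a) (mulrC b).
exact: (swap _ _ _ _ _ _ E1 E2).
Qed.

(** Dominated convergence for the integral of the difference quotients: their
    bound comes from first derivatives, and their limit from second ones. *)
Lemma moyal_bracket_lim (h_ : nat -> R) (f : V -> C) (g_ : nat -> V -> C) (g : V -> C) :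
  (forall k, 0 < h_ k) -> h_ k @[k --> \oo] --> 0 -> schwartz f -> converges g_ g ->
  (exists M, forall k u, normc (moyal_bracket (h_ k) f (g_ k) u) <= M) /\
  forall u, clim \oo (fun k => moyal_bracket (h_ k) f (g_ k) u) (poisson f g u).
Proof.
move=> h0 hl sf cg; have [s_ sg Hg] := cg.
have [B B0 HB] := converges_symp1 cg; have [B' B'0 HB'] := converges_symp2 cg.
have [M M0 HM] := rapid_decay sV 1 (fhat_rapid sf).
have [K K0 HK] := int_bound_gt0 sV.
have cD k (u : V) : ccont (fun eta => fhat f eta * diff_quot (h_ k) (g_ k) eta u * expi (dot_phase eta u)).
  apply: ccontM; last by apply: ccont_expi; exact: (continuous_pairing_cstl spV).
  apply: ccontM; first exact: fhat_cont.
  exact: diff_quot_cont.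
have dD k (u : V) : dominated wV (2 * B * M)
    (fun eta => fhat f eta * diff_quot (h_ k) (g_ k) eta u * expi (dot_phase eta u)).
  move=> eta; rewrite Normc.normcM normc_expi mulr1 Normc.normcM.
  have H1 := diff_quot_le u (h0 k) (s_ k) (HB k eta); have H2 := HM eta.
  rewrite expr1 in H2; rewrite -mulrA.
  apply: le_trans (_ : _ <= normc (fhat f eta) * (2 * (B * `|eta|))) _.
    by rewrite ler_wpM2l// normc_ge0.
  apply: le_trans (_ : _ <= 2 * B * ((1 + `|eta|) * normc (fhat f eta))) _.
    have := normc_ge0 (fhat f eta); move: (normc _) (`|eta|) => a b a0; nra.
  by rewrite [2 * (B * M)]mulrA -[leRHS]mulrA ler_wpM2l// mulr_ge0.
split.
  exists (K * (2 * B * M)) => k u; rewrite moyal_bracket_diff_quot//; exact: HK.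
move=> u; rewrite -int_symp_poisson//.
under eq_fun do rewrite moyal_bracket_diff_quot//.
apply: (int_dct sV (M := 2 * B * M)) => //.
  apply: ccontM; last by apply: ccont_expi; exact: (continuous_pairing_cstl spV).
  apply: ccontM; first exact: fhat_cont.
  apply: ccontM; first exact: ccont_cst.
  exact: cderive_symp_cont.
move=> eta; apply: climM; last exact: clim_cst.
apply: climZ.
have L1 : clim \oo (fun k => - 'i * cderive (symp eta) (g_ k) u) (- 'i * cderive (symp eta) g u).
  by have [_ L] := Hg [:: symp eta]; apply: climZ; exact: L.
have L2 : clim \oo (fun k => diff_quot (h_ k) (g_ k) eta u - - 'i * cderive (symp eta) (g_ k) u) 0.
  apply: (clim_squeeze (g := fun k => 2 * (B' * `|eta| ^+ 2) * h_ k)).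
    by near=> k; rewrite subr0; apply: diff_quot_lim.
  by rewrite -[X in _ --> X](mulr0 (2 * (B' * `|eta| ^+ 2))); apply: cvgM => //; exact: cvg_cst.
have := climD L2 L1; rewrite add0r; under eq_fun do rewrite subrK.
by apply; exact: eventually_filter.
Unshelve. all: end_near. Qed.

(** Both brackets obey the Leibniz rule, so a derivative of a bracket is a sum of
    two brackets, to which the limit theorem applies by induction on the number
    of derivatives. *)
Theorem moyal_bracket_converges (h_ : nat -> R) (f : V -> C) (g_ : nat -> V -> C) (g : V -> C) :
  (forall k, 0 < h_ k) -> h_ k @[k --> \oo] --> 0 -> schwartz f -> converges g_ g ->
  converges (fun k => moyal_bracket (h_ k) f (g_ k)) (poisson f g).
Proof.
move=> h0 hl sf cg; have [s_ sg _] := cg.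
split=> [k||vs]; [exact: moyal_bracket_schwartz|exact: poisson_schwartz|].
elim/last_ind: vs f g_ g sf cg s_ sg => [|vs v IH] f g_ g sf cg s_ sg.
  exact: moyal_bracket_lim.
have [sf' sg' s_'] : [/\ schwartz (cderive v f), schwartz (cderive v g) &
    forall k, schwartz (cderive v (g_ k))].
  by split=> [||k]; exact: schwartz_cderive.
have E k u : iter_cderive (rcons vs v) (moyal_bracket (h_ k) f (g_ k)) u =
    iter_cderive vs (moyal_bracket (h_ k) (cderive v f) (g_ k)) u +
    iter_cderive vs (moyal_bracket (h_ k) f (cderive v (g_ k))) u.
  rewrite iter_cderive_rcons cderive_moyal_bracket// iter_cderiveD//; exact: moyal_bracket_schwartz.
have [[M1 H1] L1] := IH _ _ _ sf' cg s_ sg.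
have [[M2 H2] L2] := IH _ _ _ sf (converges_cderive v cg) s_' sg'.
split.
  exists (M1 + M2) => k u; rewrite E (le_trans (le_normcD _ _))// lerD//.
move=> u; rewrite iter_cderive_rcons cderive_poisson// iter_cderiveD; try exact: poisson_schwartz.
by under eq_fun do rewrite E; exact: climD.
Qed.

End BracketConvergence.

(** * Uniqueness of the Weyl symbol *)

Section Uniqueness.
Context {R : realType} {d : nat}.
Local Notation C := R[i].
Local Notation W := 'rV[R]_d.
Local Notation V := ('rV[R]_d * 'rV[R]_d)%type.
Local Notation IW := (@integral_rV R d).
Local Notation wW := (@weight_rV R d).

Let sV := @integral_spec_phase R d.
Let sW := @integral_spec_rV R d.
Let spW := @pairing_spec_dotrV R d.

Lemma amplitude_kernel (hbar : R) (g : V -> C) (x : W) : schwartz g ->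
  amplitude (fun xi y => expi (dotrV xi x / hbar) * g (2^-1 *: (x + y), xi)).
Proof.
move=> sg.
apply: (amplitude_affine (h := fun xi => expi (dotrV xi x / hbar))
  (L := fun xi y => (2^-1 *: (x + y), xi)) (l := fun v => (2^-1 *: v, 0))) => //.
- by apply: ccont_expi; cont.
- cont.
- move=> xi t v y; congr pair => /=; last by rewrite scaler0 add0r.
  by rewrite addrCA scalerDr !scalerA mulrC.
- move=> m; exists (m + m)%N, ((2 + `|x|) ^+ m); split; first by rewrite exprn_ge0// addr_ge0.
  move=> xi y; rewrite normc_expi mulr1 exprD mulrA -!exprMn.
  set n := `|(_, xi)|.
  have h1 : `|xi| <= n by exact: (norm_snd_le (2^-1 *: (x + y), xi)).
  have h2 : `|y| <= 2 * n + `|x|.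
    have : `|2^-1 *: (x + y)| <= n by exact: (norm_fst_le (2^-1 *: (x + y), xi)).
    rewrite normrZ gtr0_norm ?invr_gt0// ler_pdivrMl// => h.
    have : `|y| <= `|x + y| + `|x| by rewrite -{1}(addKr x y) addrC ler_normB.
    lra.
  have := normr_ge0 xi; have := normr_ge0 y; have := normr_ge0 x => x0 y0 xi0.
  apply: lerXn2r; rewrite ?nnegrE ?mulr_ge0 ?addr_ge0 ?normr_ge0//.
  have n0 : 0 <= n by exact: normr_ge0.
  rewrite mulrC; apply: ler_pM; rewrite ?addr_ge0//; nra.
Qed.

(** Multiplying the kernel by a plane wave shifts the phase of an oscillatory
    integral, so that the product is a Schwartz function. *)
Lemma kernel_wave_schwartz (hbar : R) (g : V -> C) (x zeta : W) : 0 < hbar -> schwartz g ->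
  schwartz (fun y => weyl_kernel hbar g x y * expi (- dotrV zeta y)).
Proof.
move=> h0 sg; pose A (xi : W) : W := - (hbar^-1 *: xi + zeta).
have cA : continuous A by rewrite /A; cont.
have HA xi : `|A xi| <= (hbar^-1 + `|zeta|) * (1 + `|xi|).
  rewrite /A normrN (le_trans (ler_normD _ _))// normrZ gtr0_norm ?invr_gt0//.
  have := normr_ge0 xi; have := normr_ge0 zeta; have : 0 < hbar^-1 by rewrite invr_gt0.
  nra.
have := osc_int_schwartz sW spW cA HA (amplitude_kernel hbar x sg).
congr schwartz; apply/funext => y; rewrite /osc_int /weyl_kernel mulrC -(intZ sW).
  congr IW; apply/funext => xi; rewrite mulrAC -expiD [RHS]mulrCA -expiD mulrC.
  congr (_ * expi _).
  rewrite /A (pairC spW (- _)) (pairNr spW) (pairDr spW) (pairZr spW) (pairBr spW).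
  rewrite (pairC spW y zeta) (pairC spW y xi); ring.
apply: goodMexpi; last by cont.
exact: (slice_good _ (schwartz_good sV sg)).
Qed.

Lemma weyl_kernel_schwartz (hbar : R) (g : V -> C) (x : W) : 0 < hbar -> schwartz g ->
  schwartz (weyl_kernel hbar g x).
Proof.
move=> h0 sg; have := kernel_wave_schwartz x 0 h0 sg.
congr schwartz; apply/funext => y.
by rewrite (pairC spW) (pair0r spW) oppr0 expi0 mulr1.
Qed.

(** The zero transform satisfies the hypothesis of the inversion formula. *)
Lemma fourier_eq0 (f : W -> C) : good wW f ->
  (forall eta, IW (fun x => f x * expi (- dotrV eta x)) = 0) -> forall x, f x = 0.
Proof.
move=> gf F0 x; have F0' : fourier IW (@dotrV R d) f = fun=> 0 by apply/funext => eta; exact: F0.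
have gF : good wW (fourier IW (@dotrV R d) f) by rewrite F0'; exact: good0.
have := fourier_inversion_rV gf gF x.
rewrite F0' (_ : (fun eta => _) = fun=> 0); last by apply/funext => eta; rewrite mul0r.
rewrite (int0 sW) => /esym/eqP; rewrite mulf_eq0 => /orP[|/eqP//].
rewrite eq_complex/= eqxx andbT expf_eq0 mulf_eq0 pnatr_eq0/= gt_eqF ?andbF//.
exact: pi_gt0.
Qed.

(** The kernel vanishes, as one sees by applying the operator to the kernel
    itself times plane waves: this computes the Fourier transform of the square
    of the kernel. The symbol is a partial Fourier transform of the kernel. *)
Theorem weyl_inj0 (hbar : R) (g : V -> C) : 0 < hbar -> schwartz g ->
  (forall phi, schwartz phi -> forall x, weyl hbar g phi x = 0) -> forall u, g u = 0.
Proof.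
move=> h0 sg H.
have K0 x y : weyl_kernel hbar g x y = 0.
  have sk := weyl_kernel_schwartz x h0 sg.
  have gk2 : good wW (fun y => weyl_kernel hbar g x y * weyl_kernel hbar g x y).
    have [M _ HM] := rapid_bounded (schwartz_rapid sk).
    by apply: goodM HM; [exact: (schwartz_good sW)|exact: schwartz_cont].
  suff /(_ y)/eqP : forall y, weyl_kernel hbar g x y * weyl_kernel hbar g x y = 0.
    by rewrite mulf_eq0 orbb => /eqP.
  apply: fourier_eq0 => // zeta.
  have := H _ (kernel_wave_schwartz x zeta h0 sg) x.
  rewrite weyl_kernelE//; last exact: kernel_wave_schwartz.
  move=> /eqP; rewrite mulf_eq0 => /orP[|/eqP]; last first.
    by move=> <-; congr IW; apply/funext => z; rewrite mulrAC.
  rewrite eq_complex/= eqxx andbT invr_eq0 expf_eq0 !mulf_eq0 pnatr_eq0/=.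
  by rewrite (gt_eqF h0) (gt_eqF (pi_gt0 R)) andbF.
case=> q xi; have gq := slice_good q (schwartz_good sV sg).
apply: (fourier_eq0 (f := fun xi => g (q, xi))) => // eta.
rewrite -(K0 (q - (hbar / 2) *: eta) (q + (hbar / 2) *: eta)) /weyl_kernel.
congr IW; apply/funext => z; congr (g (_, _) * expi _).
  by rewrite addrACA addNr addr0 scalerDr -scalerDl -[2^-1]mul1r -splitr scale1r.
rewrite opprD addrACA subrr add0r -opprD -scalerDl -splitr (pairNr spW) (pairZr spW).
by rewrite (pairC spW z); field; rewrite gt_eqF.
Qed.

Corollary weyl_inj (hbar : R) (f g : V -> C) : 0 < hbar -> schwartz f -> schwartz g ->
  (forall phi, schwartz phi -> forall x, weyl hbar f phi x = weyl hbar g phi x) -> f =1 g.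
Proof.
move=> h0 sf sg H u; apply/eqP; rewrite -subr_eq0; apply/eqP; move: u.
apply: (weyl_inj0 h0); first exact: schwartzB.
move=> phi sphi x; have := weyl_lin hbar 1 (-1) x sf sg sphi.
by under eq_fun do rewrite mul1r mulN1r; rewrite mul1r mulN1r H// subrr.
Qed.

End Uniqueness.

(** * Homogeneous symbols *)

Section Homogeneous.
Context {R : realType} {d : nat} (omega : 'rV[R]_d).
Local Notation C := R[i].
Local Notation V := ('rV[R]_d * 'rV[R]_d)%type.

(** The linear functions [zvar] and [wvar] are multipliers, and so are their
    monomials, which makes homogeneous symbols Schwartz functions. *)
Definition multiplier (m : V -> C) := forall f, schwartz f -> schwartz (fun u => m u * f u).

Lemma multiplier1 : multiplier (fun=> 1).
Proof. by move=> f sf; under eq_fun do rewrite mul1r. Qed.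

Lemma multiplierM (m1 m2 : V -> C) : multiplier m1 -> multiplier m2 ->
  multiplier (fun u => m1 u * m2 u).
Proof. by move=> h1 h2 f sf; under eq_fun do rewrite -mulrA; apply: h1; exact: h2. Qed.

Lemma multiplierX (m : V -> C) k : multiplier m -> multiplier (fun u => m u ^+ k).
Proof.
move=> hm; elim: k => [|k IH]; first by under eq_fun do rewrite expr0; exact: multiplier1.
by under eq_fun do rewrite exprS; exact: multiplierM.
Qed.

Lemma multiplier_prod (J : Type) (s : seq J) (m : J -> V -> C) :
  (forall j, multiplier (m j)) -> multiplier (fun u => \prod_(j <- s) m j u).
Proof.
move=> hm; elim: s => [|j s IH]; first by under eq_fun do rewrite big_nil; exact: multiplier1.
by under eq_fun do rewrite big_cons; exact: multiplierM.
Qed.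

Lemma multiplier_linear (a b : R) (c1 c2 : C) (j : 'I_d) :
  multiplier (fun u => c1 * (a * u.1 0 j)%:C + c2 * (b * u.2 0 j)%:C).
Proof.
pose l (u : V) : C := c1 * (a * u.1 0 j)%:C + c2 * (b * u.2 0 j)%:C.
have cj (u : V -> 'rV[R]_d) : continuous u -> continuous (fun v => u v 0 j).
  by move=> cu; exact: (continuous_comp_fun cu (@coord_continuous R 1 d 0 j)).
move=> f; apply: (schwartzM_lin (dl := l) (K := normc c1 * `|a| + normc c2 * `|b|)).
- apply: ccontD; apply: ccontM; try exact: ccont_cst; apply: ccont_real;
    apply: continuous_mulf; try exact: continuous_cst_fun; apply: cj.
  + exact: continuous_fst.
  + exact: continuous_snd.
- move=> u; rewrite (le_trans (le_normcD _ _))// !Normc.normcM !normc_real !normrM.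
  have h1 := le_trans (row_entry_le u.1 j) (norm_fst_le u).
  have h2 := le_trans (row_entry_le u.2 j) (norm_snd_le u).
  rewrite mulrDl; apply: lerD; rewrite mulrA ler_wpM2l// ?mulr_ge0 ?normc_ge0//.
  + by rewrite (le_trans h1)// lerDr.
  + by rewrite (le_trans h2)// lerDr.
- move=> v h u; rewrite /l /= !mxE !mulrDr !rmorphD/= !(mulrCA _ h) !(rmorphM _ h)/=.
  ring.
Qed.

Lemma multiplier_zvar j : multiplier (zvar omega j).
Proof.
have := multiplier_linear (omega 0 j) 1 1 'i j; congr multiplier; apply/funext => u.
by apply/eqP; rewrite eq_complex/=; apply/andP; split; apply/eqP; rewrite /=; ring.
Qed.

Lemma multiplier_wvar j : multiplier (wvar omega j).
Proof.
have := multiplier_linear (omega 0 j) 1 'i 1 j; congr multiplier; apply/funext => u.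
by apply/eqP; rewrite eq_complex/=; apply/andP; split; apply/eqP; rewrite /=; ring.
Qed.

Lemma homogeneous_schwartz n f : homogeneous omega n f -> schwartz f.
Proof.
move=> [m [b [k [l [sb _ fE]]]]]; rewrite (_ : f = fun u => \sum_(i <- index_enum 'I_m)
  (\prod_(j <- index_enum 'I_d) (zvar omega j u ^+ k i j * wvar omega j u ^+ l i j)) * b i u).
  apply: schwartz_sum => i; apply: multiplier_prod; last by have [] := sb i.
  by move=> j; apply: multiplierM; apply: multiplierX;
    [exact: multiplier_zvar|exact: multiplier_wvar].
by apply/funext => u; rewrite fE; apply: eq_bigr => i _; rewrite mulrC.
Qed.

Hypothesis omega_gt0 : forall j, 0 < omega 0 j.

(** Rotations of the phase planes, in the complex coordinates [zvar]: the torus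
    action whose invariants are the actions. *)
Definition rotate (j : 'I_d) (t : R) (u : V) : V :=
  (\row_i (if i == j then (cos t * (omega 0 j * u.1 0 j) - sin t * u.2 0 j) / omega 0 j
           else u.1 0 i),
   \row_i (if i == j then sin t * (omega 0 j * u.1 0 j) + cos t * u.2 0 j else u.2 0 i)).

Lemma rotate_actions j t u : actions omega (rotate j t u) = actions omega u.
Proof.
apply/rowP => i; rewrite !mxE; case: eqVneq => // ->; congr (_ / _).
have w0 : omega 0 j != 0 by rewrite gt_eqF.
rewrite -[omega 0 j ^+ 2 * (_ / _) ^+ 2]exprMn [omega 0 j * (_ / _)]mulrC divfK//.
have := cos2Dsin2 t; move: (cos t) (sin t) => c s cs.
rewrite -[RHS]mul1r -cs; ring.
Qed.

Lemma rotate_zvar j t u i :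
  zvar omega i (rotate j t u) = (if i == j then expi t else 1) * zvar omega i u.
Proof.
rewrite /zvar !mxE; case: eqVneq => [->|_]; last by rewrite mul1r.
have w0 : omega 0 j != 0 by rewrite gt_eqF.
apply/eqP; rewrite eq_complex/=; apply/andP; split; apply/eqP; last by ring.
by rewrite mulrC divfK.
Qed.

Lemma rotate_wvar j t u i :
  wvar omega i (rotate j t u) = (if i == j then expi (- t) else 1) * wvar omega i u.
Proof.
rewrite /wvar !mxE; case: eqVneq => [->|_]; last by rewrite mul1r.
have w0 : omega 0 j != 0 by rewrite gt_eqF.
apply/eqP; rewrite eq_complex/= cosN sinN [omega 0 j * (_ / _)]mulrC divfK//.
by apply/andP; split; apply/eqP; ring.
Qed.

Lemma expiX (t : R) k : expi t ^+ k = expi (t * k%:R) :> C.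
Proof.
elim: k => [|k IH]; first by rewrite expr0 mulr0 expi0.
by rewrite exprS IH -expiD -[in RHS]natr1 mulrDr mulr1 addrC.
Qed.

(** Homogeneity seen as the behaviour under the rotations, which is easier to use
    than the form of the symbol. *)
Definition weight_vector (n : 'rV[int]_d) (f : V -> C) :=
  forall j t u, f (rotate j t u) = expi (t * (n 0 j)%:~R) * f u.

(** The rotation by [t] preserves the actions and multiplies [zvar] by [expi t]
    and [wvar] by [expi (- t)]. *)
Lemma homogeneous_weight n f : homogeneous omega n f -> weight_vector n f.
Proof.
move=> [m [b [k [l [sb kl fE]]]]] j t u; rewrite !fE mulr_sumr; apply: eq_bigr => i _.
have -> : b i (rotate j t u) = b i u.
  by have [_ _ [ft [_ _ H]]] := sb i; rewrite !H rotate_actions.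
rewrite mulrCA; congr (_ * _).
rewrite [LHS](bigD1 j)//= [in RHS](bigD1 j)//= mulrA; congr (_ * _).
  rewrite rotate_zvar rotate_wvar eqxx !exprMn -(kl i j) intrB !expiX.
  rewrite -!pmulrn mulrBr -mulNr expiD; ring.
apply: eq_bigr => i' ij; rewrite rotate_zvar rotate_wvar (negbTE ij).
by rewrite !mul1r.
Qed.

(** Composing with a rotation and subtracting the eigenvalue for [n'] removes the
    component of weight [n'] and multiplies each other one by a scalar. For a
    given [n], the angle [pi / (n j - n' j)] makes this scalar [- 2] times a
    phase. *)
Lemma weight_independent (s : seq 'rV[int]_d) (f : 'rV[int]_d -> V -> C) : uniq s ->
  (forall n, weight_vector n (f n)) -> (forall u, \sum_(n <- s) f n u = 0) ->
  forall n u, n \in s -> f n u = 0.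
Proof.
elim: s f => [//|n' s IH] f /= /andP[n's us] wf f0.
have fs n u : n \in s -> f n u = 0.
  move=> ns; have /rowP nn' : n <> n' by move=> nn'; move: n's; rewrite -nn' ns.
  have [j nj] : exists j, n 0 j != n' 0 j.
    by apply: contrapT => H; apply: nn' => j; apply/eqP; apply: contrapT => /negP nj; apply: H; exists j.
  pose t : R := pi / ((n 0 j)%:~R - (n' 0 j)%:~R).
  pose c (m : 'rV[int]_d) : C := expi (t * (m 0 j)%:~R) - expi (t * (n' 0 j)%:~R).
  have := IH (fun m u => c m * f m u) us _ _ n u ns.
  have c0 : c n != 0.
    have -> : c n = - 2 * expi (t * (n' 0 j)%:~R).
      rewrite /c -[(n 0 j)%:~R](subrK (n' 0 j)%:~R) mulrDr expiD /t divfK; last first.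
        by rewrite subr_eq0 eqr_int.
      rewrite {1}/expi cospi sinpi; rewrite (_ : -1 +i* 0 = -1 :> C); first by ring.
      by apply/eqP; rewrite eq_complex/= oppr0 !eqxx.
    by rewrite mulf_neq0 ?expi_neq0// oppr_eq0 pnatr_eq0.
  move=> /(_ _ _)/eqP; rewrite mulf_eq0 (negbTE c0)/= => H; apply/eqP; apply: H.
  - by move=> m i r v; rewrite wf; ring.
  - move=> v; have := f0 (rotate j t v); have := f0 v; rewrite !big_cons.
    move=> /eqP; rewrite addr_eq0 => /eqP fn'.
    rewrite wf fn' (eq_bigr _ (fun m _ => wf m j t v)) => E.
    rewrite (eq_bigr _ (fun m _ => mulrBl (f m v) _ _)) sumrB -mulr_sumr.
    by rewrite mulrN addrC in E; exact: E.
move=> n u; rewrite inE => /orP[/eqP ->|]; last exact: fs.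
have := f0 u; rewrite big_cons big_seq big1 ?addr0// => m ms; exact: fs.
Qed.

End Homogeneous.

Section Decomposition.
Context {R : realType} {d : nat} (omega : 'rV[R]_d).
Hypothesis omega_gt0 : forall j, 0 < omega 0 j.

(** By uniqueness of the homogeneous decomposition, the components have order
    at least 1 when the series does. *)
Lemma homogeneous_decomposition_order (B : nat -> 'rV[R]_d * 'rV[R]_d -> R[i])
    (Bn : 'rV[int]_d -> nat -> 'rV[R]_d * 'rV[R]_d -> R[i]) p :
  homogeneous_decomposition omega B Bn -> (forall u, B p u = 0) -> forall n u, Bn n p u = 0.
Proof.
move=> [hB finB sB] B0 n u.
pose S := [set n | exists u, Bn n p u <> 0]; have finS : finite_set S := finB p.
have [/mem_set nS|] := pselect (S n); last first.
  by move=> nS; apply: contrapT => nu; apply: nS; exists u.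
apply: (weight_independent (s := finmap.enum_fset (fset_set S)) (f := fun n => Bn n p)) => //.
- exact: finmap.fset_uniq.
- by move=> m; exact: homogeneous_weight.
- move=> v; rewrite -fsbig_finite// -[RHS](B0 v) sB; apply: fsbig_widen => //.
  by move=> m [_ mS]; apply: contrapT => mv; apply: mS; exists v.
- by rewrite in_fset_set.
Qed.

End Decomposition.

(** * Nested brackets *)

Section Words.
Context {R : realType} {d : nat}.
Local Notation C := R[i].
Local Notation V := ('rV[R]_d * 'rV[R]_d)%type.
Local Notation N := 'rV[int]_d.

Definition series_bracket (br : (V -> C) -> (V -> C) -> V -> C) (A B : nat -> V -> C) :
    nat -> V -> C := fun p u => \sum_(i < p.+1) br (A i) (B (p - i)%N) u.

Definition nested_symbol br (Bn : N -> nat -> V -> C) : seq N -> nat -> V -> C :=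
  nested_bracket (fun _ _ => 0) (series_bracket br) Bn.

Lemma nested_bracket_rcons (T : Type) (zero : T) br (B : N -> T) w n : w <> [::] ->
  nested_bracket zero br B (rcons w n) = br (B n) (nested_bracket zero br B w).
Proof. by case: w => [//|n1 w] _; rewrite /= -cats1 foldl_cat. Qed.

Section Symbols.
Variable Bn : N -> nat -> V -> C.
Hypothesis sB : forall n q, schwartz (Bn n q).

Lemma nested_symbol_schwartz br w p :
  (forall f g, schwartz f -> schwartz g -> schwartz (br f g)) -> schwartz (nested_symbol br Bn w p).
Proof.
move=> sbr; elim/last_ind: w p => [|w n IH] p; first exact: schwartz0.
have [->|w0] := pselect (w = [::]); first exact: sB.
rewrite /nested_symbol nested_bracket_rcons// /series_bracket; apply: schwartz_sum => i.
by apply: sbr => //; exact: IH.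
Qed.

(** Operators are compared on Schwartz functions only, which suffices because
    they map Schwartz functions to Schwartz functions. *)
Lemma nested_qbracket (hbar : R) w p phi x : 0 < hbar -> schwartz phi ->
  nested_bracket (fun _ _ _ => 0) (series_qbracket hbar) (fun n q => weyl hbar (Bn n q)) w p phi x =
  weyl hbar (nested_symbol (moyal_bracket hbar) Bn w p) phi x.
Proof.
move=> h0; elim/last_ind: w p phi x => [|w n IH] p phi x sphi; first by rewrite weyl0.
have [->|w0] := pselect (w = [::]); first by [].
rewrite /nested_symbol !nested_bracket_rcons// -!/(nested_symbol _ _ _).
have sQ q : schwartz (nested_symbol (moyal_bracket hbar) Bn w q).
  by apply: nested_symbol_schwartz => f g; exact: moyal_bracket_schwartz.
rewrite /series_bracket weyl_sum//; last by move=> i; exact: moyal_bracket_schwartz.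
apply: eq_bigr => i _; rewrite -qbracket_weyl// /qbracket; congr (_ * (_ - _)).
  by congr (weyl _ _ _ _); apply/funext => y; exact: IH.
by apply: IH; exact: weyl_schwartz.
Qed.

(** The limit theorem for one bracket, along the word. *)
Lemma nested_symbol_converges (h_ : nat -> R) w p :
  (forall k, 0 < h_ k) -> h_ k @[k --> \oo] --> 0 ->
  converges (fun k => nested_symbol (moyal_bracket (h_ k)) Bn w p) (nested_symbol poisson Bn w p).
Proof.
move=> h0 hl; elim/last_ind: w p => [|w n IH] p; first exact/converges_cst/schwartz0.
have [->|w0] := pselect (w = [::]); first exact/converges_cst.
rewrite /nested_symbol nested_bracket_rcons//; under eq_fun do rewrite nested_bracket_rcons//.
apply: (@converges_sum _ _ _ _ xpredT) => i.
by apply: moyal_bracket_converges => //; exact: IH.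
Qed.

Section Vanishing.
Variable br : (V -> C) -> (V -> C) -> V -> C.
Hypotheses (br0l : forall g, br (fun=> 0) g = fun=> 0).
Hypotheses (br0r : forall f, br f (fun=> 0) = fun=> 0).

(** By induction on the word: in each term of the outer bracket either the first
    factor has order 0 or the inner bracket has order less than its length. *)
Lemma nested_symbol_order w p : (forall n, Bn n 0%N = fun=> 0) -> (p < size w)%N ->
  nested_symbol br Bn w p = fun=> 0.
Proof.
move=> B0; elim/last_ind: w p => [//|w n IH] p.
have [->|w0] := pselect (w = [::]); first by case: p => // _; exact: B0.
rewrite size_rcons ltnS => pw; rewrite /nested_symbol nested_bracket_rcons//.
apply/funext => u; apply: big1 => -[[|i] ip] _ /=; first by rewrite B0 br0l.
rewrite -/(nested_symbol br Bn w _) IH ?br0r//.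
by case: p pw ip => [|p] pw // _; rewrite (leq_trans _ pw)// subSS ltnS leq_subr.
Qed.

Lemma nested_symbol_support (s : seq N) w p :
  (forall n q, (q <= p)%N -> n \notin s -> Bn n q = fun=> 0) -> ~~ all (mem s) w ->
  nested_symbol br Bn w p = fun=> 0.
Proof.
elim/last_ind: w p => [//|w n IH] p B0.
have [->|w0] := pselect (w = [::]); first by rewrite /= andbT => ns; exact: B0.
rewrite all_rcons negb_and => H; rewrite /nested_symbol nested_bracket_rcons//.
apply/funext => u; apply: big1 => i _; have ip : (i <= p)%N by rewrite -ltnS.
case/orP: H => [ns|sw]; first by rewrite B0// br0l.
rewrite -/(nested_symbol br Bn w _) IH ?br0r// => m q qp; apply: B0.
by rewrite (leq_trans qp)// leq_subr.
Qed.

End Vanishing.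

End Symbols.

Lemma fhat0 : fhat (fun _ : V => 0 : C) = fun=> 0.
Proof.
apply/funext => eta; rewrite /fhat /ft /fourier (_ : (fun x => _) = fun=> 0).
  by rewrite (int0 (@integral_spec_phase R d)) mulr0.
by apply/funext => x; rewrite mul0r.
Qed.

Lemma moyal0l (t : R) (g : V -> C) : moyal t (fun=> 0) g = fun=> 0.
Proof.
apply/funext => u; rewrite /moyal /osc_int (_ : (fun eta => _) = fun=> 0).
  exact: (int0 (@integral_spec_phase R d)).
by apply/funext => eta; rewrite /moyal_amp fhat0 !mul0r.
Qed.

Lemma moyal0r (t : R) (f : V -> C) : moyal t f (fun=> 0) = fun=> 0.
Proof.
apply/funext => u; rewrite /moyal /osc_int (_ : (fun eta => _) = fun=> 0).
  exact: (int0 (@integral_spec_phase R d)).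
by apply/funext => eta; rewrite /moyal_amp mulr0 mul0r.
Qed.

Lemma moyal_bracket0l (hbar : R) (g : V -> C) : moyal_bracket hbar (fun=> 0) g = fun=> 0.
Proof. by apply/funext => u; rewrite /moyal_bracket !moyal0l subrr mulr0. Qed.

Lemma moyal_bracket0r (hbar : R) (f : V -> C) : moyal_bracket hbar f (fun=> 0) = fun=> 0.
Proof. by apply/funext => u; rewrite /moyal_bracket !moyal0r subrr mulr0. Qed.

Lemma cderive0 (v : V) : cderive v (fun _ : V => 0 : C) = fun=> 0.
Proof. exact: (iter_cderive0 [:: v]). Qed.

Lemma poisson0l (g : V -> C) : poisson (fun=> 0) g = fun=> 0.
Proof. by apply/funext => u; apply: big1 => j _; rewrite !cderive0 !mul0r subrr. Qed.

Lemma poisson0r (f : V -> C) : poisson f (fun=> 0) = fun=> 0.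
Proof. by apply/funext => u; apply: big1 => j _; rewrite !cderive0 !mulr0 subrr. Qed.

(** * Finiteness of the sums over words *)

Fixpoint words (s : seq N) (r : nat) : seq (seq N) :=
  if r is r'.+1 then [seq n :: w | n <- s, w <- words s r'] else [:: [::]].

Lemma mem_words s r w : (w \in words s r) = (size w == r) && all (mem s) w.
Proof.
elim: r w => [|r IH] [|n w] //=.
  by apply/negbTE/allpairsP => -[[a b] []].
apply/allpairsP/and3P => [[[a b] [/= sa]]|[sw sn aw]].
  by rewrite IH => /andP[sb ab] [-> ->].
by exists (n, w); split=> //; rewrite IH aw andbT.
Qed.

Lemma words_uniq s r : uniq s -> uniq (words s r).
Proof.
move=> us; elim: r => [//|r IH]; apply: allpairs_uniq => //.
by move=> [a b] [a' b'] _ _ [-> ->].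
Qed.

Lemma fsbig_seq_support (T : choiceType) (A : set T) (l : seq T) (f : T -> C) : uniq l ->
  (forall i, i \in l -> A i) -> (forall i, A i -> i \notin l -> f i = 0) ->
  \sum_(i \in A) f i = \sum_(i <- l) f i.
Proof.
move=> ul lA f0; rewrite [RHS]fsbig_seq//; symmetry; apply: fsbig_widen => [i /= il|i [Ai /= il]].
  exact: lA.
by apply: f0 => //; apply/negP.
Qed.

(** The words that contribute have length at most [p] and letters in [s]. *)
Lemma sum_words (s : seq N) p (c : nat -> seq N -> C) (T : seq N -> C) : uniq s ->
  (forall w, (p < size w)%N -> T w = 0) -> (forall w, ~~ all (mem s) w -> T w = 0) ->
  \sum_(r \in [set r | (1 <= r)%N]) \sum_(w \in [set w : seq N | size w = r]) c r w * T w =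
  \sum_(r <- iota 1 p) \sum_(w <- words s r) c r w * T w.
Proof.
move=> us T1 T2; have E r : \sum_(w \in [set w : seq N | size w = r]) c r w * T w =
    \sum_(w <- words s r) c r w * T w.
  apply: fsbig_seq_support; first exact: words_uniq.
    by move=> w; rewrite mem_words => /andP[/eqP].
  by move=> w /= wr; rewrite mem_words wr eqxx/= => /T2 ->; rewrite mulr0.
rewrite (fsbig_seq_support (l := iota 1 p)) ?iota_uniq//.
- by apply: eq_bigr => r _; exact: E.
- by move=> r; rewrite mem_iota => /andP[].
- move=> r /= r1; rewrite mem_iota r1/= add1n ltnS -ltnNge => pr; rewrite E big_seq big1// => w.
  by rewrite mem_words => /andP[/eqP wr _]; rewrite T1 ?mulr0// wr.
Qed.

End Words.

(** * Birkhoff normal forms *)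

Section NormalForm.
Context {R : realType} {d : nat}.
Local Notation C := R[i].
Local Notation V := ('rV[R]_d * 'rV[R]_d)%type.
Local Notation N := 'rV[int]_d.
Variables (omega : 'rV[R]_d) (F : mould C) (Bn : N -> nat -> V -> C) (p : nat).
Hypothesis sB : forall n q, schwartz (Bn n q).
Hypothesis B0 : forall n, Bn n 0%N = fun=> 0.
Variable s : seq N.
Hypothesis us : uniq s.
Hypothesis sBn : forall n q, (q <= p)%N -> n \notin s -> Bn n q = fun=> 0.

(** The coefficient of order [p] of the normal form built on the bracket [br], as
    a finite sum. *)
Definition normal_form br : V -> C := fun u =>
  \sum_(r <- iota 1 p) \sum_(w <- words s r)
    r%:R^-1 * F (map (lambda omega) w) * nested_symbol br Bn w p u.

Lemma ZclE : Zcl omega F Bn p = normal_form poisson.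
Proof.
apply/funext => u; rewrite /Zcl /normal_form.
apply: (sum_words (T := fun w => nested_symbol poisson Bn w p u)
  (fun r w => r%:R^-1 * F (map (lambda omega) w)) us) => w H.
- by rewrite nested_symbol_order//; [exact: poisson0l|exact: poisson0r].
- by rewrite (nested_symbol_support _ _ sBn)//; [exact: poisson0l|exact: poisson0r].
Qed.

Lemma normal_form_converges (h_ : nat -> R) : (forall k, 0 < h_ k) -> h_ k @[k --> \oo] --> 0 ->
  converges (fun k => normal_form (moyal_bracket (h_ k))) (normal_form poisson).
Proof.
move=> h0 hl; apply: (@converges_sum _ _ _ _ xpredT) => r.
apply: (@converges_sum _ _ _ _ xpredT) => w.
by apply: convergesZ; exact: nested_symbol_converges.
Qed.

Lemma normal_form_is_weyl_symbol (hbar : R) : 0 < hbar ->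
  is_weyl_symbol hbar (Zqu hbar omega F Bn p) (normal_form (moyal_bracket hbar)).
Proof.
move=> h0; have sQ w : schwartz (nested_symbol (moyal_bracket hbar) Bn w p).
  by apply: nested_symbol_schwartz => // f g; exact: moyal_bracket_schwartz.
have sQ' r w : schwartz (fun u => r%:R^-1 * F (map (lambda omega) w) *
    nested_symbol (moyal_bracket hbar) Bn w p u) by exact: schwartzZ.
have sQ'' (r : nat) : schwartz (fun u => \sum_(w <- words s r) r%:R^-1 * F (map (lambda omega) w) *
    nested_symbol (moyal_bracket hbar) Bn w p u) by exact: schwartz_sum.
split; first exact: schwartz_sum.
move=> phi sphi x.
have nb w := nested_qbracket sB w p x h0 sphi.
rewrite /Zqu (sum_words (p := p) (T := fun w => nested_bracket (fun _ _ _ => 0)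
  (series_qbracket hbar) (fun n q => weyl hbar (Bn n q)) w p phi x)
  (fun r w => r%:R^-1 * F (map (lambda omega) w)) us) => [|w H|w H].
- rewrite /normal_form weyl_sum//; apply: eq_bigr => r _.
  rewrite weyl_sum//; apply: eq_bigr => w _; rewrite nb.
  have := weyl_lin hbar (r%:R^-1 * F (map (lambda omega) w)) 0 x (sQ w) (@schwartz0 R _) sphi.
  by under eq_fun do rewrite mul0r addr0; rewrite mul0r addr0.
- by rewrite nb nested_symbol_order ?weyl0//; [exact: moyal_bracket0l|exact: moyal_bracket0r].
- by rewrite nb (nested_symbol_support _ _ sBn) ?weyl0//; [exact: moyal_bracket0l|exact: moyal_bracket0r].
Qed.

End NormalForm.

Theorem mainTheorem3 (R : realType) (d : nat) (hd : (1 <= d)%N)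
  (omega : 'rV[R]_d) (homega : forall j, 0 < omega 0 j)
  (sigma Bcl : nat -> 'rV[R]_d * 'rV[R]_d -> R[i])
  (hsigma : forall p u,
     sigma p u = (if p == 0%N then sigma0 omega u else 0) + Bcl p u)
  (hBcl : forall p, symbol_class omega reals (Bcl p))
  (hBcl0 : forall u, Bcl 0%N u = 0)
  (X Bqu : R -> nat -> ('rV[R]_d -> R[i]) -> 'rV[R]_d -> R[i])
  (hX : forall hbar : R, 0 < hbar -> forall p phi, schwartz phi -> forall x,
     X hbar p phi x = weyl hbar (sigma p) phi x)
  (hBqu : forall hbar : R, 0 < hbar -> forall p phi, schwartz phi -> forall x,
     X hbar p phi x = (if p == 0%N then X0 hbar omega phi x else 0)
                      + Bqu hbar p phi x)
  (F G : mould R[i]) (hF : alternal F) (hG : alternal G)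
  (hFnabla : forall n, mould_nabla F n = 0)
  (hFG : forall n, mould_nabla (mould_exp G) n =
     mould_mul mould_I (mould_exp G) n - mould_mul (mould_exp G) F n)
  (Bn : 'rV[int]_d -> nat -> 'rV[R]_d * 'rV[R]_d -> R[i])
  (hBn : homogeneous_decomposition omega Bcl Bn) (p : nat) :
  (forall hbar : R, 0 < hbar ->
     exists s, is_weyl_symbol hbar (Zqu hbar omega F Bn p) s) /\
  forall s : R -> 'rV[R]_d * 'rV[R]_d -> R[i],
    (forall hbar : R, 0 < hbar ->
       is_weyl_symbol hbar (Zqu hbar omega F Bn p) (s hbar)) ->
    forall u, (s hbar u : R[i]^o) @[hbar --> 0^'+] --> (Zcl omega F Bn p u : R[i]^o).
Proof.
have [hom finB _] := hBn.
have sB n q : schwartz (Bn n q) by exact: homogeneous_schwartz (hom n q).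
have B0 n : Bn n 0%N = fun=> 0.
  by apply/funext => u; exact: (homogeneous_decomposition_order homega hBn hBcl0).
pose supp q := [set n | exists u, Bn n q u <> 0].
pose l := undup (flatten [seq finmap.enum_fset (fset_set (supp q)) | q <- iota 0 p.+1]).
have ul : uniq l by exact: undup_uniq.
have lB n q : (q <= p)%N -> n \notin l -> Bn n q = fun=> 0.
  move=> qp nl; apply/funext => u; apply: contrapT => Bu; move/negP: nl; apply.
  rewrite mem_undup; apply/flattenP; exists (finmap.enum_fset (fset_set (supp q))).
    by apply/mapP; exists q => //; rewrite mem_iota/= add0n ltnS.
  by rewrite in_fset_set; [apply/mem_set; exists u|exact: finB].
have symb hbar := normal_form_is_weyl_symbol omega F sB B0 ul lB (hbar := hbar).
split=> [hbar h0|s hs u]; first by exists (normal_form omega F Bn p l (moyal_bracket hbar)); exact: symb.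
apply: cvg_of_clim; apply: clim_within_seq => h_ h0 hl.
have [_ _ /(_ [::])[_ /(_ u)]] := normal_form_converges omega F p sB l h0 hl.
rewrite (ZclE omega F B0 ul lB); apply: clim_ext => k /=.
have [ss Hs] := hs _ (h0 k); have [sn Hn] := symb _ (h0 k).
by apply: (weyl_inj (h0 k) ss sn) => phi sphi x; rewrite Hs// Hn.
Qed.
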